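(* Let $1\le m\le n-1$ be integers. For any integers $1 \leq p \leq m$ and $1 \leq k \leq n-m$ and any partition $\mu \in P_{mn}$, the following identities hold in $QH^*_{T}(Gr(m,n))$: \begin{align*} \sigma_{(1)^p} \star \sigma_\mu&=\sum_{0 \leq r \leq p} \ \sum_{\substack{ \lambda/d/\mu = v^r \\ v^r \rightarrow v^p }} q^d\prod_{\alpha \in v^p \setminus v^r}\operatorname{wt}^v(\alpha)\, \sigma_\lambda , \\ \sigma_{(k)} \star \sigma_\mu&=\sum_{0 \leq r \leq k} \ \sum_{\substack{ \lambda/d/\mu = h^r \\ h^r \rightarrow h^k }} q^d\prod_{\alpha \in h^k \setminus h^r}\operatorname{wt}^h(\alpha)\, \sigma_\lambda . \end{align*} Here, in the first (resp. second) formula, the inner sum ranges over all $\lambda\in P_{mn}$ and $d\in\mathbb{Z}_{\ge 0}$ such that the cylindric diagram $\lambda/d/\mu$ is a vertical $r$-strip $v^r$ (resp. a horizontal $r$-strip $h^r$), and, for each such $(\lambda,d)$, over all extensions $v^r\to v^p$ (resp. $h^r\to h^k$). Since $\lambda/d/\mu$ is a vertical (resp. horizontal) strip, $d \in \{0,1\}$.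
   Context: Partitions. $[m]=\{1,\dots,m\}$. $P_{mn}$ is the set of partitions $\lambda=(\lambda_1\ge\cdots\ge\lambda_m\ge 0)$ with $\lambda_1\le n-m$, i.e. whose Young diagram (English notation, row 1 on top) fits in the $m\times(n-m)$ rectangle; $|\lambda|=\sum\lambda_i$. $(1)^p$ is the column with $p$ boxes, $(k)$ the row with $k$ boxes, $\mu'$ the transpose of $\mu$. Up-steps and side-steps. Number by $1,\dots,n$ the steps of the boundary path of $\mu$ from the lower-left to the upper-right corner of the $m\times(n-m)$ rectangle. $U(\mu)$ is the set of numbers of vertical steps, $S(\mu)$ the set of numbers of horizontal steps. Explicitly, the vertical step at the end of row $i$ (from the top) has number $\mu_i+m-i+1$, and the horizontal step at the bottom of column $j$ (from the left) has number $j+m-\mu'_j$. Equivariant (quantum) cohomology. $T$ is the diagonal torus acting on $Gr(m,n)$, the Grassmannian of $m$-planes in $\mathbb{C}^n$, and $H_T^*(\mathrm{pt})=\Lambda=\mathbb{Z}[t_1,\dots,t_n]$. $H^*_T(Gr(m,n))$ is the free $\Lambda$-module on the equivariant Schubert classes $\sigma_\gamma$, $\gamma\in P_{mn}$ (degree $|\gamma|$), with product $\sigma_\lambda\circ\sigma_\mu=\sum_\nu c_{\lambda,\mu}^\nu\sigma_\nu$. Conventions are fixed so that $c_{\lambda,\mu}^\nu\in\mathbb{Z}_{\ge0}[t_2-t_1,\dots,t_n-t_{n-1}]$ ($B$ lower triangular). Concretely, restriction to the $T$-fixed points embeds $H^*_T(Gr(m,n))$ in $\bigoplus_{\eta\in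 P_{mn}}\Lambda$ (pointwise product), with $\sigma_\gamma\mapsto \xi^\gamma$, where $(\xi^\gamma)$ is the unique family with: $\xi^\gamma(\eta)$ homogeneous of degree $|\gamma|$; $\xi^\gamma(\eta)=0$ if $\gamma\not\subseteq\eta$; $\xi^\gamma(\gamma)=\prod_{u\in U(\gamma),\,s\in S(\gamma),\,u>s}(t_u-t_s)$; and $t_a-t_b$ divides $\xi^\gamma(\eta)-\xi^\gamma(\eta')$ whenever $U(\eta')=(U(\eta)\setminus\{a\})\cup\{b\}$. $QH^*_T(Gr(m,n))=\mathbb{Z}[q]\otimes H_T^*(Gr(m,n))$, $\deg q=n$, is the (small) equivariant quantum cohomology ring, with $\Lambda[q]$-basis $\sigma_\lambda$ ($\lambda\in P_{mn}$) and product $\sigma_\lambda\star\sigma_\mu=\sum_{\nu,d}c_{\lambda,\mu}^{\nu,d}q^d\sigma_\nu$, whose structure constants are the equivariant quantum Littlewood-Richardson coefficients (equivariant Gromov-Witten invariants). With these conventions the product is given by the equivariant rim hook rule: if $\sigma_\lambda\circ\sigma_\mu=\sum_\gamma c_{\lambda,\mu}^\gamma\sigma_\gamma$ in $H_T^*(Gr(m,2n-1))$, then $\sigma_\lambda\star\sigma_\mu=\sum_\gamma\varphi(c_{\lambda,\mu}^\gamma)\varphi(\sigma_\gamma)$, where $\varphi(t_i)=t_{i \bmod n}$ (representatives in $\{1,\dots,n\}$), and $\varphi(\sigma_\gamma)=\prod_{i=1}^d((-1)^{\varepsilon_i-m}q)\,\sigma_\nu$ if the $n$-core $\nu$ of $\gamma$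 lies in $P_{mn}$, and $\varphi(\sigma_\gamma)=0$ otherwise; here $d$ is the number of $n$-rim hooks removed from $\gamma$ to reach $\nu$ and $\varepsilon_i$ is the height (number of rows) of the $i$-th one. Cylindric diagrams. The cylinder is $\mathcal C_{mn}=\mathbb{Z}^2/(-m,n-m)\mathbb{Z}$, with matrix-style coordinates $(i,j)$ ($i$ increasing downward, $j$ to the right); box $(i,j)$ is the unit box with southeast corner $(i,j)$. Row $k$ of the cylinder consists of the boxes which are images of boxes $(k,j)$, column $k$ of those which are images of boxes $(i,k)$; thus row indices matter modulo $m$ and column indices modulo $n-m$. For $\lambda\in P_{mn}$ define $\ell_k=\lambda_k$ for $k\in[m]$ and $\ell_{i+m}=\ell_i-(n-m)$ for all $i\in\mathbb{Z}$; this gives the loop $\lambda[0]$. For $d\ge0$ the loop $\lambda[d]$ is $\lambda[0]$ shifted by $(d,d)$, i.e. $\lambda[d]_j=\ell_{j-d}+d$. If $\lambda[d]_i\ge\mu_i$ for all $i\in[m]$, the cylindric diagram $\lambda/d/\mu$ is the set of boxes of $\mathcal C_{mn}$ between $\mu[0]$ and $\lambda[d]$, i.e. the boxes $(i,j)$ with $i\in[m]$, $\mu_i<j\le\lambda[d]_i$. It is a vertical (resp. horizontal) $r$-strip, written $\lambda/d/\mu=v^r$ (resp. $h^r$), if it has exactly $r$ boxes on $\mathcal C_{mn}$, no two in the same row (resp. column) of $\mathcal C_{mn}$. Extensions. Let $\lambda/d/\mu=v^r$ and $r\le p\le m$. An extension $v^r\to v^p$ is a choice of $p-r$ boxes of (the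 Young diagram of) $\mu$, called addable boxes, each sharing a vertical edge with the boundary of $\lambda/d/\mu$, whose union with $\lambda/d/\mu$ is a vertical $p$-strip $v^p$. Explicitly: choose $p-r$ rows $i\in[m]$ with $\lambda[d]_i=\mu_i$ and $\mu_i\ge1$, and add the last box $(i,\mu_i)$ of each. Similarly, if $\lambda/d/\mu=h^r$ and $r\le k\le n-m$, an extension $h^r\to h^k$ is a choice of $k-r$ boxes of $\mu$ each sharing a horizontal edge with the boundary of $\lambda/d/\mu$, whose union with $\lambda/d/\mu$ is a horizontal $k$-strip $h^k$. Explicitly: choose $k-r$ columns $j\in[n-m]$ containing no box of $\lambda/d/\mu$ on the cylinder and with $\mu'_j\ge1$, and add the bottom box $(\mu'_j,j)$ of each. The symbols $v^p\setminus v^r$, $h^k\setminus h^r$ denote the sets of added boxes; empty products are $1$. Weights. For an addable box $\alpha\in v^p\setminus v^r$ in row $i\in[m]$ from the top: $u(\alpha)$ is the number of the vertical boundary step of $\mu$ at the end of row $i$ (so $u(\alpha)=\mu_i+m-i+1$); $r(\alpha)=m-i+1$ is its row number counted from the bottom; $b(\alpha)$ is the number of boxes of $v^p$ (both original and added) in rows strictly below $\alpha$ in the $m\times(n-m)$ rectangle (rows $i'$ with $i<i'\le m$). Then $$\operatorname{wt}^v(\alpha)=t_{u(\alpha)}-t_{r(\alpha)-b(\alpha)}.$$ For an addable box $\alpha\in h^k\setminus h^r$ in column $j\in[n-m]$ from the left: $s(\alpha)$ is the number of the horizontal boundary step of $\mu$ at the bottom of column $j$ (so $s(\alpha)=j+m-\mu'_j$);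 $c(\alpha)=n-m-j+1$ is its column number counted from the right; $rt(\alpha)$ is the number of boxes of $h^k$ (both original and added) in columns strictly to the right of $\alpha$ in the $m\times(n-m)$ rectangle. Then $$\operatorname{wt}^h(\alpha)=t_{n+1-(c(\alpha)-rt(\alpha))}-t_{s(\alpha)}.$$ *)

(* Defs.v *)
From HB Require Import structures.
From mathcomp Require Import all_boot all_order all_algebra.
From mathcomp Require Import mpoly.

Set Implicit Arguments.
Unset Strict Implicit.
Unset Printing Implicit Defensive.

Import Order.TTheory GRing.Theory Num.Theory.
Local Open Scope ring_scope.

(* Rows and columns are indexed from 0 ([i : 'I_m] is row i.+1 of the text and
   [j : 'I_(n - m)] is column j.+1); the variables t_1, ..., t_N and the numbers
   of the boundary steps are indexed from 1. *)

(* The variable t_k, for 1 <= k <= N (and 0 for the other values of k). *)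
Definition tvar (N k : nat) : {mpoly int[N]} := \sum_(i < N | i.+1 == k) 'X_i.

Definition nonincr m w (f : {ffun 'I_m -> 'I_w.+1}) : bool :=
  [forall i : 'I_m, forall j : 'I_m, (i <= j)%N ==> (f j <= f i)%N].

Record part (m n : nat) : Type :=
  Part { part_fun :> {ffun 'I_m -> 'I_(n - m).+1}; _ : nonincr part_fun }.

HB.instance Definition _ m n := [isSub for @part_fun m n].
HB.instance Definition _ m n := [Equality of part m n by <:].
HB.instance Definition _ m n := [Choice of part m n by <:].
HB.instance Definition _ m n := [Countable of part m n by <:].
HB.instance Definition _ m n := [Finite of part m n by <:].

Definition psize m n (g : part m n) : nat := (\sum_(i < m) g i)%N.

Definition pincl m n (g h : part m n) : bool :=
  [forall i : 'I_m, (g i <= h i)%N].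

Definition pconj m n (g : part m n) (j : nat) : nat :=
  #|[set i : 'I_m | (j < g i)%N]|.

Lemma col_nonincr m n p :
  nonincr [ffun i : 'I_m => inord (i < p)%N : 'I_(n - m).+1].
Proof.
apply/forallP=> i; apply/forallP=> j; apply/implyP=> le_ij; rewrite !ffunE.
have [lt_jp|//] := ltnP j p; first by rewrite (leq_ltn_trans le_ij lt_jp).
by rewrite inordK.
Qed.

Lemma row_nonincr m n k :
  nonincr [ffun i : 'I_m =>
             inord (if i == 0 :> nat then k else 0)%N : 'I_(n - m).+1].
Proof.
apply/forallP=> i; apply/forallP=> j; apply/implyP=> le_ij; rewrite !ffunE.
case: (eqVneq (j : nat) 0%N) => [j0|_]; last by rewrite inordK.
by move: le_ij; rewrite j0 leqn0 => ->.
Qed.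

(* The column (1)^p for p <= m (and 1 <= n - m), and the row (k) for k <= n - m
   (and 1 <= m). *)
Definition pcol m n p : part m n := Part (col_nonincr m n p).
Definition prow m n k : part m n := Part (row_nonincr m n k).

Lemma pwiden_leq m n : ((n - m).+1 <= (2 * n - 1 - m).+1)%N.
Proof.
by case: n => // n; rewrite ltnS leq_sub2r // mulSn mul1n addSn subn1 leq_addl.
Qed.

Lemma pwiden_nonincr m n (g : part m n) :
  nonincr [ffun i : 'I_m => widen_ord (pwiden_leq m n) (g i)].
Proof.
case: g => f /= /forallP hf; apply/forallP=> i; apply/forallP=> j.
by rewrite !ffunE; exact: (forallP (hf i) j).
Qed.

(* The same partition, viewed in the m x (2n - 1 - m) rectangle. *)
Definition pwiden m n (g : part m n) : part m (2 * n - 1) :=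
  Part (pwiden_nonincr g).

(* The steps of the boundary path of g are numbered by 1, ..., n from the
   lower-left to the upper-right corner of the rectangle; the element [a : 'I_n]
   of [upsteps g] or [sidesteps g] stands for step a.+1. *)

Definition upnum m n (g : part m n) (i : 'I_m) : nat := (g i + m - i.+1 + 1)%N.

Definition sidenum m n (g : part m n) (j : 'I_(n - m)) : nat :=
  (j.+1 + m - pconj g j)%N.

Definition upsteps m n (g : part m n) : {set 'I_n} :=
  [set a : 'I_n | [exists i : 'I_m, a.+1 == upnum g i]].

Definition sidesteps m n (g : part m n) : {set 'I_n} :=
  [set a : 'I_n | [exists j : 'I_(n - m), a.+1 == sidenum g j]].

(* Equivariant cohomology of Gr(m, N) by restriction to the T-fixed points:
   [xi g e] is the restriction of the Schubert class of g at the point e. These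
   conditions determine xi, and xi determines its structure constants. *)

Record schubert_classes m N (xi : part m N -> part m N -> {mpoly int[N]}) :
    Prop := SchubertClasses {
  schubert_homog : forall g e, xi g e \is (psize g).-homog;
  schubert_supp : forall g e, ~~ pincl g e -> xi g e = 0;
  schubert_diag : forall g,
    xi g g = \prod_(u in upsteps g) \prod_(s in sidesteps g | (s < u)%N)
               (tvar N u.+1 - tvar N s.+1);
  schubert_gkm : forall (e e' : part m N) (a b : 'I_N),
    upsteps e' = b |: (upsteps e :\ a) ->
    forall g, exists f : {mpoly int[N]},
      xi g e - xi g e' = (tvar N a.+1 - tvar N b.+1) * f }.

Definition structure_constants m N
    (xi : part m N -> part m N -> {mpoly int[N]})
    (c : part m N -> part m N -> part m N -> {mpoly int[N]}) : Prop :=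
  forall l mu e, xi l e * xi mu e = \sum_(nu : part m N) c l mu nu * xi nu e.

Definition skew m N (g h : part m N) : {set 'I_m * 'I_(N - m)} :=
  [set b : 'I_m * 'I_(N - m) | (h b.1 <= b.2 < g b.1)%N].

Definition adjbox a b (x y : 'I_a * 'I_b) : bool :=
  [|| (x.1 == y.1) && (x.2.+1 == y.2 :> nat),
      (x.1 == y.1) && (y.2.+1 == x.2 :> nat),
      (x.2 == y.2) && (x.1.+1 == y.1 :> nat)
    | (x.2 == y.2) && (y.1.+1 == x.1 :> nat)].

(* g / h is an n-rim hook: a connected skew shape with n boxes and no 2 x 2
   square. In a skew shape, a 2 x 2 square is detected by its northwest and
   southeast corners. *)
Definition rim_hook n m N (g h : part m N) : bool :=
  [&& pincl h g, #|skew g h| == n,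
      [forall x in skew g h, forall y in skew g h,
         connect [rel a b | [&& a \in skew g h, b \in skew g h & adjbox a b]]
           x y]
    & [forall x in skew g h, forall y in skew g h,
         ~~ ((x.1.+1 == y.1 :> nat) && (x.2.+1 == y.2 :> nat))]].

Definition rim_height m N (g h : part m N) : nat :=
  #|[set b.1 | b in skew g h]|.

(* Removes n-rim hooks from g, at most [fuel] times, until none is left; returns
   the product of the factors (-1)^(height - m) q (the height is at most m), and
   the last partition. *)
Fixpoint rim_reduce n m N (fuel : nat) (g : part m N) :
    {poly {mpoly int[n]}} * part m N :=
  if fuel is fuel'.+1 then
    if [pick h | rim_hook n g h] is Some h then
      let: (s, nu) := rim_reduce n fuel' h in
      ((-1) ^+ (m - rim_height g h) * 'X * s, nu)
    else (1, g)
  else (1, g).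

(* Each n-rim hook has n >= 1 boxes, so |g| steps reach the n-core of g. *)
Definition rim_core n m N (g : part m N) := rim_reduce n (psize g) g.

(* QH*_T(Gr(m, n)) as the free module with basis indexed by [part m n] over
   Lambda[q] = {poly {mpoly int[n]}}, where q = 'X. *)

Definition QH (m n : nat) : Type :=
  {ffun part m n -> ({poly {mpoly int[n]}})^o}.

Definition sigma m n (l : part m n) : QH m n :=
  [ffun nu => if nu == l then 1 else 0].

(* phi(t_i) = t_(i mod n), with representatives in {1, ..., n}. *)
Definition phi_coef n (c : {mpoly int[2 * n - 1]}) : {mpoly int[n]} :=
  comp_mpoly [tuple tvar n (i %% n).+1 | i < 2 * n - 1] c.

Definition phi_class m n (g : part m (2 * n - 1)) : QH m n :=
  let: (s, core) := rim_core n g in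
  if [pick nu : part m n | pwiden nu == core] is Some nu
  then s *: sigma nu else 0.

(* The equivariant rim hook rule, extended bilinearly; c is meant to be the
   family of structure constants of H*_T(Gr(m, 2n - 1)). *)
Definition star_basis m n
    (c : part m (2 * n - 1) -> part m (2 * n - 1) -> part m (2 * n - 1) ->
         {mpoly int[2 * n - 1]}) (l mu : part m n) : QH m n :=
  \sum_(g : part m (2 * n - 1))
    (phi_coef (c (pwiden l) (pwiden mu) g))%:P *: phi_class g.

Definition star m n
    (c : part m (2 * n - 1) -> part m (2 * n - 1) -> part m (2 * n - 1) ->
         {mpoly int[2 * n - 1]}) (x y : QH m n) : QH m n :=
  \sum_(l : part m n) \sum_(mu : part m n)
    (x l * y mu : {poly {mpoly int[n]}}) *: star_basis c l mu.

Definition rowlen m n (l : part m n) (k : nat) : nat :=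
  if insub k is Some i then l i else 0%N.

(* The loop l[d], d >= 0, as a function of the (0-based) row index in Z. *)
Definition loop0 m n (l : part m n) (i : int) : int :=
  (rowlen l `|(i %% m)%Z|)%:Z - (i %/ m)%Z * (n - m)%N%:Z.

Definition loop m n (l : part m n) (d : nat) (i : int) : int :=
  loop0 l (i - d%:Z) + d%:Z.

Definition cyl_valid m n (l : part m n) (d : nat) (mu : part m n) : bool :=
  [forall i : 'I_m, (mu i)%:Z <= loop l d i%:Z].

(* The boxes of l / d / mu, each given by its representative in rows [m]. *)
Definition cyl_boxes m n (l : part m n) (d : nat) (mu : part m n) :
    seq ('I_m * nat) :=
  [seq (i, j) | i <- enum 'I_m,
                j <- iota (mu i) `|loop l d i%:Z - (mu i)%:Z|%N].

Definition box_row m (b : 'I_m * nat) : 'I_m := b.1.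

(* Columns of the cylinder are taken modulo n - m. *)
Definition box_col m n (b : 'I_m * nat) : nat := (b.2 %% (n - m))%N.

Definition vstrip m n (r : nat) (l : part m n) (d : nat) (mu : part m n) :=
  [&& cyl_valid l d mu, size (cyl_boxes l d mu) == r
    & uniq [seq box_row b | b <- cyl_boxes l d mu]].

Definition hstrip m n (r : nat) (l : part m n) (d : nat) (mu : part m n) :=
  [&& cyl_valid l d mu, size (cyl_boxes l d mu) == r
    & uniq [seq box_col n b | b <- cyl_boxes l d mu]].

(* An extension is given by the set E of the rows (resp. columns) of the
   addable boxes. *)

Definition vextension m n (r p : nat) (l : part m n) (d : nat) (mu : part m n)
    (E : {set 'I_m}) : bool :=
  (#|E| == p - r)%N &&
  [forall i in E, (loop l d i%:Z == (mu i)%:Z) && (1 <= mu i)%N].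

Definition hextension m n (r k : nat) (l : part m n) (d : nat) (mu : part m n)
    (E : {set 'I_(n - m)}) : bool :=
  (#|E| == k - r)%N &&
  [forall j in E, ((j : nat) \notin [seq box_col n b | b <- cyl_boxes l d mu])
                  && (1 <= pconj mu j)%N].

(* rr is the row number counted from the bottom, cc the column number counted
   from the right; b and rt count original boxes (first term) and added ones. *)

Definition wtv m n (l : part m n) (d : nat) (mu : part m n) (E : {set 'I_m})
    (i : 'I_m) : {mpoly int[n]} :=
  let rr := (m - i.+1 + 1)%N in
  let b := (count (fun x => i < box_row x)%N (cyl_boxes l d mu)
            + #|[set i' in E | (i < i')%N]|)%N in
  tvar n (upnum mu i) - tvar n (rr - b).

Definition wth m n (l : part m n) (d : nat) (mu : part m n)
    (E : {set 'I_(n - m)}) (j : 'I_(n - m)) : {mpoly int[n]} :=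
  let cc := (n - m - j.+1 + 1)%N in
  let rt := (count (fun x => j < box_col n x)%N (cyl_boxes l d mu)
             + #|[set j' in E | (j < j')%N]|)%N in
  tvar n (n + 1 - (cc - rt)) - tvar n (sidenum mu j).

(* Main.v *)
(* Restricted to the fixed point e, with x_j the parameter of the up-step of e in row j, the
   class of g is the factorial Schur quotient a_g / a_0, where a_g = det ((x_j | t)^(g_i + m - i)):
   this has the right degree and support, satisfies the divisibility conditions, and such families
   are unique. Hence products in H_T^* can be computed with alternants, in any ring.

   Modulo the relation (x | t)^n = (-1)^(m-1) q with t periodic, removing an n-rim hook multiplies
   an alternant by its sign and q. So in the m-th tensor power of R[x] / ((x | t)^n - (-1)^(m-1) q),
   where the alternants a_g (g in P_mn) stay linearly independent, sending sigma_g to a_g turns the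
   quantum product into the ordinary one.

   Multiplying column j of a_mu by z - x_j = (z - t_b) - (x_j - t_b), b being the exponent of the
   row, multiplies a_mu by prod_j (z - x_j) and moves up a set of vertical steps; comparing coefficients in the Newton
   basis in z gives the column rule. An exponent that reaches n is reduced to 0 with a factor q:
   these are the strips with d = 1. The row rule is the same computation on the complementary
   minors, whose rows are indexed by the horizontal steps. *)

Require Import Defs.
From HB Require Import structures.
From mathcomp Require Import all_boot all_order all_algebra all_fingroup.
From mathcomp Require Import mpoly qpoly.
From mathcomp Require Import zify ring.

Set Implicit Arguments.
Unset Strict Implicit.
Unset Printing Implicit Defensive.

Import Order.TTheory GRing.Theory Num.Theory.
Local Open Scope ring_scope.

(** * Newton expansions *)

(** A class must act as a multiplier on alternants, but for m >= 2 the Vandermonde determinant a_0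
    is a zero divisor in the tensor power, so the quotient a_g / a_0 makes no sense there. The
    classes of a column and of a row are therefore given by explicit polynomials in the x_j, up to
    sign [ecoef] and [hcoef]: the Newton coefficients of prod_j (z - x_j), and the top coefficients
    of remainders modulo this product.

    The rim hook rule only sees products in Gr(m, 2n-1), hence exponents below 2n-1. The identities
    are first proved for independent x_j and t_1, ..., t_(2n-1), with a bound on the exponents that
    occur; they are then specialised twice, to the fixed points, which identifies the given
    structure constants, and to the tensor power, which evaluates the quantum product. The bound is
    n + 1 for a column and n + k for a row, both at most 2n-1.

    In the row rule, multiplication by z - x acts on a module of rank n and its determinant enters
    as a common factor. This factor is never computed: it is eliminated by comparison with the empty
    partition, where the answer is known, and by cancelling the monic polynomial prod_j (z -
    x_j). *)

Section DetExpansion.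
Variable R : comNzRingType.

Lemma det_row_expand K (a b : 'I_K -> R) (A B : 'M[R]_K) :
  \det (\matrix_(i, j) (a i * A i j + b i * B i j)) =
  \sum_(J : {set 'I_K}) (\prod_i (if i \in J then b i else a i)) *
     \det (\matrix_(i, j) (if i \in J then B i j else A i j)).
Proof.
rewrite /determinant (eq_bigr (fun s : 'S_K => \sum_(J : {set 'I_K})
  (-1) ^+ s * ((\prod_i (if i \in J then b i else a i)) *
   \prod_i (if i \in J then B i (s i) else A i (s i))))) => [|s _].
  rewrite exchange_big; apply: eq_bigr => J _; rewrite big_distrr /=.
  apply: eq_bigr => s _; rewrite mulrCA; congr (_ * (_ * _)).
  by apply: eq_bigr => i _; rewrite mxE.
rewrite -big_distrr /=; congr (_ * _).
rewrite (eq_bigr (fun i => b i * B i (s i) + a i * A i (s i))) => [|i _].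
  rewrite bigA_distr; apply: eq_bigr => J _; rewrite -big_split /=.
  by apply: eq_bigr => i _; case: ifP.
by rewrite mxE addrC.
Qed.

End DetExpansion.

Section Newton.
Variable R : comNzRingType.
Implicit Types (tau : nat -> R).

Definition newt tau (l : nat) : {poly R} := \prod_(c < l) ('X - (tau c)%:P).

Lemma newtS tau l : newt tau l.+1 = newt tau l * ('X - (tau l)%:P).
Proof. by rewrite /newt big_ord_recr. Qed.

Lemma size_newt tau l : size (newt tau l) = l.+1.
Proof. by rewrite /newt size_prod_XsubC /index_enum -enumT size_enum_ord. Qed.

Lemma newt_monic tau l : newt tau l \is monic.
Proof. exact: monic_prod_XsubC. Qed.

Lemma newt_free tau K (a : 'I_K -> R) :
  \sum_k (a k)%:P * newt tau k = 0 -> forall k, a k = 0.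
Proof.
elim: K a => [|K IH] a; first by move=> _ [].
rewrite big_ord_recr /= => h.
have aK : a ord_max = 0.
  move/(congr1 (fun p : {poly R} => p`_K)): h.
  rewrite coefD coef0 coef_sum big1 => [|i _]; last first.
    rewrite coefCM nth_default ?mulr0 // size_newt; exact: ltn_ord.
  rewrite add0r coefCM.
  have /monicP := newt_monic tau K; rewrite lead_coefE size_newt /= => ->.
  by rewrite mulr1.
rewrite aK polyC0 mul0r addr0 in h.
move=> k; case: (unliftP ord_max k) => [k' ->|-> //].
have := IH _ h k'; rewrite (_ : widen_ord _ k' = lift ord_max k') //.
by apply: val_inj; rewrite /= /bump leqNgt ltn_ord.
Qed.

Lemma newt_free_eq tau K (a b : 'I_K -> R) :
  \sum_k (a k)%:P * newt tau k = \sum_k (b k)%:P * newt tau k ->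
  forall k, a k = b k.
Proof.
move=> h k; apply/subr0_eq; apply: (newt_free (tau := tau) (a := fun k => a k - b k)).
transitivity (\sum_k (a k)%:P * newt tau k - \sum_k (b k)%:P * newt tau k).
  by rewrite -sumrB; apply: eq_bigr => i _; rewrite polyCB mulrBl.
by rewrite h subrr.
Qed.

Lemma newt_span tau (f : {poly R}) K : (size f <= K)%N ->
  exists a : 'I_K -> R, f = \sum_k (a k)%:P * newt tau k.
Proof.
elim: K f => [|K IH] f hf.
  exists (fun=> 0); rewrite big_ord0.
  by apply/eqP; rewrite -size_poly_leq0.
have [|a ha] := IH (f - (f`_K)%:P * newt tau K).
  apply/leq_sizeP => j; rewrite leq_eqVlt => /orP [/eqP <-|hj].
    rewrite coefB coefCM.
    have /monicP := newt_monic tau K; rewrite lead_coefE size_newt /= => ->.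
    by rewrite mulr1 subrr.
  rewrite coefB coefCM (nth_default _ (leq_trans hf hj)) sub0r.
  have h : (newt tau K)`_j = 0 by rewrite nth_default // size_newt.
  by rewrite h mulr0 oppr0.
exists (fun k : 'I_K.+1 => if unlift ord_max k is Some k' then a k' else f`_K).
rewrite big_ord_recr /= unlift_none.
transitivity (f - (f`_K)%:P * newt tau K + (f`_K)%:P * newt tau K); first by rewrite subrK.
rewrite ha; congr (_ + _); apply: eq_bigr => i _.
rewrite (_ : widen_ord _ i = lift ord_max i) ?liftK //.
by apply: val_inj; rewrite /= /bump leqNgt ltn_ord.
Qed.

Definition nabove K (A : {set 'I_K}) (i : 'I_K) : nat :=
  #|[set i' : 'I_K | (i < i')%N && (i' \notin A)]|.

Lemma big_subset_setU1 (M : nmodType) (T : finType) (a : T) (S : {set T})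
    (F : {set T} -> M) : a \notin S ->
  \sum_(E : {set T} | E \subset a |: S) F E =
  \sum_(E : {set T} | E \subset S) (F E + F (a |: E)).
Proof.
move=> aS; rewrite big_split /= (bigID (fun E : {set T} => a \notin E)) /=.
congr (_ + _).
  apply: eq_bigl => E; apply/andP/idP => [[h aE]|h]; last first.
    by split; [apply: subset_trans h (subsetUr _ _)|apply: contra aS; exact: (subsetP h)].
  apply/subsetP => x xE; have /setU1P [xa|//] := subsetP h x xE.
  by rewrite xa in xE; rewrite xE in aE.
rewrite (reindex_onto (fun E => a |: E) (fun E => E :\ a)) /=; last first.
  by move=> E /andP [_]; rewrite negbK => /setD1K.
apply: eq_bigl => E; rewrite setU11 /= andbT; apply/andP/idP => [[h /eqP e]|h].
  have aE : a \notin E by rewrite -e !inE eqxx.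
  apply/subsetP => x xE; have := subsetP h x; rewrite !inE xE orbT.
  by move/(_ isT)/orP => [/eqP xa|//]; rewrite xa (negPf aE) in xE.
split; first exact: setUS.
by rewrite setU1K //; apply: contra aS; exact: (subsetP h).
Qed.

(** Downward induction on [j]: the factor of index [a] is split as [(tau k - y a) + ('X - tau k)],
    where [k] is the number of later factors that contributed an ['X - tau]. The first choice puts
    [a] in [E], the second lengthens the Newton product. So [k] is [nabove (I :|: E) a], which is
    the origin of the shifts b(alpha) and rt(alpha) in the weights. *)
Lemma newton_prod_from tau K (y : 'I_K -> R) (I : {set 'I_K}) j : (j <= K)%N ->
  \prod_(i < K | (j <= i)%N && (i \notin I)) ('X - (y i)%:P) =
  \sum_(E : {set 'I_K} | E \subset [set i : 'I_K | (j <= i)%N] :\: I)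
     (\prod_(i in E) (tau (nabove (I :|: E) i) - y i))%:P
       * newt tau #|[set i : 'I_K | (j <= i)%N] :\: (I :|: E)|.
Proof.
move=> jK; rewrite -(subKn jK); move: (K - j)%N (leq_subr j K) => d {j jK}.
elim: d => [|d IH] dK.
  rewrite subn0 big_pred0 => [|i]; last by rewrite leqNgt ltn_ord.
  have S0 : [set i : 'I_K | (K <= i)%N] = set0.
    by apply/setP => i; rewrite !inE leqNgt ltn_ord.
  rewrite (big_pred1 set0) => [|E]; last by rewrite S0 set0D subset0.
  by rewrite big_set0 S0 set0D cards0 /newt big_ord0 mulr1.
have lt_jK : (K - d.+1 < K)%N by lia.
have [a ea] : exists a : 'I_K, a = (K - d.+1)%N :> nat by exists (Ordinal lt_jK).
have Ej (i : 'I_K) : (K - d.+1 <= i)%N = (i == a :> 'I_K) || (K - d <= i)%N.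
  by rewrite -val_eqE /= ea; have := ltn_ord i; lia.
have aS : a \notin [set i : 'I_K | (K - d <= i)%N] by rewrite inE ea; lia.
have aSF : (K - d <= a)%N = false by rewrite ea; lia.
have Sj : [set i : 'I_K | (K - d.+1 <= i)%N] = a |: [set i : 'I_K | (K - d <= i)%N].
  by apply/setP => i; rewrite !inE Ej.
have IHd := IH (ltnW dK).
have [aI|aI] := boolP (a \in I).
  rewrite (eq_bigl (fun i : 'I_K => (K - d <= i)%N && (i \notin I))) => [|i]; last first.
    rewrite Ej; case: (eqVneq i a) => [->|//] /=; rewrite aI andbF.
    by [].
  rewrite IHd.
  have SI (J : {set 'I_K}) : I \subset J -> [set i : 'I_K | (K - d.+1 <= i)%N] :\: J =
                [set i : 'I_K | (K - d <= i)%N] :\: J.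
    move=> /subsetP sIJ; rewrite Sj; apply/setP => i; rewrite !inE.
    by case: (eqVneq i a) => [->|//]; rewrite (sIJ _ aI).
  apply: eq_big => [E|E _]; first by rewrite SI.
  by rewrite SI ?subsetUl.
rewrite (bigD1 a) /=; last by rewrite Ej eqxx aI.
rewrite (eq_bigl (fun i : 'I_K => (K - d <= i)%N && (i \notin I))) => [|i]; last first.
  rewrite Ej; case: (eqVneq i a) => [->|ne] /=; last by rewrite andbT.
  by rewrite aSF andbF.
rewrite IHd big_distrr /=.
have -> : [set i : 'I_K | (K - d.+1 <= i)%N] :\: I
    = a |: ([set i : 'I_K | (K - d <= i)%N] :\: I).
  rewrite Sj; apply/setP => i; rewrite !inE.
  by case: (eqVneq i a) => [->|//]; rewrite aI.
rewrite big_subset_setU1; last by rewrite !inE aSF andbF.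
apply: eq_bigr => E sE.
have aE : a \notin E.
  by apply/negP => /(subsetP sE); rewrite inE => /andP [_]; rewrite (negPf aS).
have geE i : i \in E -> (a < i)%N.
  by move/(subsetP sE); rewrite !inE ea => /andP [_]; lia.
have S1 : [set i : 'I_K | (K - d.+1 <= i)%N] :\: (I :|: E) =
    a |: ([set i : 'I_K | (K - d <= i)%N] :\: (I :|: E)).
  rewrite Sj; apply/setP => i; rewrite !inE.
  by case: (eqVneq i a) => [->|//]; rewrite (negPf aI) (negPf aE).
have aS' : a \notin [set i : 'I_K | (K - d <= i)%N] :\: (I :|: E).
  by rewrite in_setD (negPf aS) andbF.
rewrite S1 cardsU1 aS' add1n newtS.
have S2 : [set i : 'I_K | (K - d.+1 <= i)%N] :\: (I :|: (a |: E)) =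
    [set i : 'I_K | (K - d <= i)%N] :\: (I :|: E).
  rewrite Sj; apply/setP => i; rewrite !inE.
  by case: (eqVneq i a) => [->|ne] //=; rewrite aSF orbT !andbF.
rewrite S2 big_setU1 //=.
have Na : nabove (I :|: (a |: E)) a = #|[set i : 'I_K | (K - d <= i)%N] :\: (I :|: E)|.
  apply: eq_card => i; rewrite !inE /=.
  have -> : (a < i)%N = (K - d <= i)%N by rewrite ea; lia.
  case: (eqVneq i a) => [->|ne]; last by rewrite andbC.
  by rewrite aSF !andbF.
rewrite Na.
have NE i : i \in E -> nabove (I :|: (a |: E)) i = nabove (I :|: E) i.
  move=> iE; apply: eq_card => i'; rewrite !inE.
  have := geE i iE; case: (eqVneq i' a) => [->|//]; lia.
have -> : \prod_(i in E) (tau (nabove (I :|: (a |: E)) i) - y i) =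
    \prod_(i in E) (tau (nabove (I :|: E) i) - y i).
  by apply: eq_bigr => i iE; rewrite NE.
rewrite polyCM polyCB; ring.
Qed.

Lemma newton_prod tau K (y : 'I_K -> R) (I : {set 'I_K}) :
  \prod_(i | i \notin I) ('X - (y i)%:P) =
  \sum_(E : {set 'I_K} | [disjoint E & I])
     (\prod_(i in E) (tau (nabove (I :|: E) i) - y i))%:P
       * newt tau (K - (#|I| + #|E|)).
Proof.
have := newton_prod_from tau y I (leq0n K); rewrite (eq_bigl (fun i => i \notin I)) //.
have -> : [set i : 'I_K | (0 <= i)%N] = [set: 'I_K] by apply/setP => i; rewrite !inE.
move=> ->; apply: eq_big => [E|E]; first by rewrite setTD disjoints_subset.
rewrite setTD -disjoints_subset disjoint_sym => dEI.
rewrite setTD cardsCs setCK card_ord cardsU.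
by move: dEI; rewrite -setI_eq0 => /eqP ->; rewrite cards0 subn0.
Qed.

(** For the empty partition the parameters [y] are those of [tau] in reverse order, so dropping the
    first [k] factors leaves a Newton polynomial and no correction terms. *)
Lemma newton_prod_initial tau K (y : 'I_K -> R) k :
  (forall i, y i = tau (K - i.+1)%N) -> (k <= K)%N ->
  \prod_(i < K | i \notin [set i : 'I_K | (i < k)%N]) ('X - (y i)%:P) = newt tau (K - k).
Proof.
move=> hy hk; rewrite /newt.
rewrite (eq_bigl (fun i : 'I_K => (k <= i)%N)) => [|i]; last by rewrite inE -leqNgt.
rewrite (reindex_inj rev_ord_inj) /=.
rewrite (eq_bigr (fun i : 'I_K => 'X - (tau i)%:P)); last first.
  by move=> i _; rewrite hy /=; congr ('X - (tau _)%:P); have := ltn_ord i; lia.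
rewrite -(big_mkord (fun i => (k <= K - i.+1)%N) (fun i => 'X - (tau i)%:P)).
rewrite -(big_mkord xpredT (fun i => 'X - (tau i)%:P)).
rewrite (big_cat_nat (n := (K - k)%N)) ?leq_subr //=.
rewrite [X in _ * X]big_nat_cond [X in _ * X]big_pred0 ?mulr1 => [|i]; last by lia.
rewrite big_nat_cond [RHS]big_nat_cond; apply: eq_bigl => i; lia.
Qed.

Lemma card_ord_lt K k : (k <= K)%N -> #|[set i : 'I_K | (i < k)%N]| = k.
Proof.
move=> le_kK; rewrite -sum1_card (eq_bigl (fun i : 'I_K => (i < k)%N)).
  by rewrite -(big_ord_widen K (fun=> 1%N)) ?sum1_card ?card_ord.
by move=> i; rewrite inE.
Qed.

Lemma mem_downset K (S : {set 'I_K}) :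
  (forall i i' : 'I_K, (i <= i')%N -> i' \in S -> i \in S) ->
  forall i : 'I_K, (i \in S) = (i < #|S|)%N.
Proof.
move=> hS i; apply/idP/idP => [iS|].
  rewrite -(card_ord_lt (ltn_ord i)); apply: subset_leq_card; apply/subsetP => i'.
  by rewrite inE ltnS => le; apply: hS iS.
apply: contraLR => iS; rewrite -leqNgt -[X in (_ <= X)%N](card_ord_lt (ltnW (ltn_ord i))).
apply: subset_leq_card; apply/subsetP => i' i'S; rewrite inE ltnNge.
by apply: contra iS => le; apply: hS i'S.
Qed.

(* A set of indices is initial when it has no jump j \notin J, j.+1 \in J. *)
Lemma big_initial_sets (M : nmodType) K (F : {set 'I_K} -> M) :
  (forall (J : {set 'I_K}) (i i' : 'I_K), i' = i.+1 :> nat -> i \notin J -> i' \in J -> F J = 0) ->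
  \sum_J F J = \sum_(k < K.+1) F [set i : 'I_K | (i < k)%N].
Proof.
move=> hF.
have card_init (k : 'I_K.+1) : #|[set i : 'I_K | (i < k)%N]| = k.
  by rewrite card_ord_lt // -ltnS.
have cardlt (J : {set 'I_K}) : (#|J| < K.+1)%N by rewrite ltnS -[X in (_ <= X)%N]card_ord max_card.
rewrite (bigID (fun J : {set 'I_K} => J == [set i : 'I_K | (i < #|J|)%N])) /= addrC big1 ?add0r; last first.
  move=> J hJ.
  have [/existsP [i /existsP [i' /and3P [/eqP e iJ i'J]]]|] := boolP
      [exists i : 'I_K, exists i' : 'I_K, [&& i' == i.+1 :> nat, i \notin J & i' \in J]].
    exact: hF e iJ i'J.
  rewrite negb_exists => /forallP hn.
  have step (i i' : 'I_K) : i' = i.+1 :> nat -> i' \in J -> i \in J.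
    move=> e i'J; have := hn i; rewrite negb_exists => /forallP /(_ i').
    by rewrite e eqxx i'J andbT /= negbK.
  have down d (i : 'I_K) : i \in J -> forall i' : 'I_K, (i' + d = i)%N -> i' \in J.
    elim: d i => [|d IH] i iJ i' e.
      by rewrite (_ : i' = i) //; apply: val_inj; rewrite /= -e addn0.
    have lt1 : (i'.+1 < K)%N by have := ltn_ord i; lia.
    by apply: (step i' (Ordinal lt1)) => //; apply: IH iJ _ _; rewrite /= -e; lia.
  case/eqP: hJ; apply/eqP; rewrite eq_sym eqEcard (card_init (Ordinal (cardlt J))) leqnn andbT.
    apply/subsetP => i; rewrite inE => iJ; apply/negPn/negP => iN.
    have : J \subset [set i' : 'I_K | (i' < i)%N].
      apply/subsetP => i' i'J; rewrite inE ltnNge; apply: contra iN => le.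
      by apply: (down (i' - i)%N i' i'J); rewrite subnKC.
    move/subset_leq_card; have /= -> := card_init (widen_ord (leqnSn K) i).
    by rewrite leqNgt iJ.
rewrite (reindex_onto (fun k : 'I_K.+1 => [set i : 'I_K | (i < k)%N])
  (fun J : {set 'I_K} => Ordinal (cardlt J))) /=; last by move=> J /eqP.
apply: eq_bigl => k; apply/andP; split; first by apply/eqP/setP => i; rewrite !inE card_init.
by apply/eqP/val_inj; exact: card_init.
Qed.

End Newton.

Section Pieri.
Variable R : comNzRingType.

(* The abstract form of the Pieri rules: T is a family of alternants indexed by the strips. *)
Lemma newton_extract tau K (y : 'I_K -> R) (C : {poly R}) (c : nat -> R) (e T0 : R)
    (T : {set 'I_K} -> R) :
  C = \sum_(k < K.+1) (c k)%:P * newt tau (K - k) ->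
  C * T0%:P = \sum_(I : {set 'I_K})
     (e ^+ #|I| * T I)%:P * \prod_(i | i \notin I) ('X - (y i)%:P) ->
  forall k, (k <= K)%N ->
  c k * T0 = \sum_(I : {set 'I_K}) \sum_(E : {set 'I_K} |
       [disjoint E & I] && (#|I| + #|E| == k)%N)
     e ^+ #|I| * (\prod_(i in E) (tau (nabove (I :|: E) i) - y i)) * T I.
Proof.
move=> -> h k lekK.
pose S k := \sum_(I : {set 'I_K}) \sum_(E : {set 'I_K} |
       [disjoint E & I] && (#|I| + #|E| == k)%N)
     e ^+ #|I| * (\prod_(i in E) (tau (nabove (I :|: E) i) - y i)) * T I.
have cardD (I E : {set 'I_K}) : [disjoint E & I] -> (#|I| + #|E| < K.+1)%N.
  move=> dEI; rewrite ltnS -[X in (_ <= X)%N]card_ord.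
  by apply: leq_trans (max_card (I :|: E)); rewrite cardsU setIC;
    move: dEI; rewrite -setI_eq0 => /eqP ->; rewrite cards0 subn0.
suff hS : \sum_(k < K.+1) (c (K - k)%N * T0)%:P * newt tau k =
    \sum_(k < K.+1) (S (K - k)%N)%:P * newt tau k.
  have lt : (K - k < K.+1)%N by rewrite ltnS leq_subr.
  by have /= := newt_free_eq hS (Ordinal lt); rewrite subKn.
have revE (G : nat -> R) : \sum_(k < K.+1) (G (K - k)%N)%:P * newt tau k =
   \sum_(k < K.+1) (G k)%:P * newt tau (K - k).
  rewrite (reindex_inj rev_ord_inj) /=; apply: eq_bigr => i _.
  by rewrite subSS subKn // -ltnS.
rewrite (revE (fun k => c k * T0)) (revE S).
rewrite big_distrl /= in h.
transitivity (\sum_(i < K.+1) (c i)%:P * newt tau (K - i) * T0%:P).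
  by apply: eq_bigr => i _; rewrite polyCM; ring.
rewrite h; under [RHS]eq_bigr => i _ do rewrite /S raddf_sum big_distrl /=.
rewrite exchange_big /=; apply: eq_bigr => I _.
rewrite (newton_prod tau) big_distrr /=.
under [RHS]eq_bigr => i _ do rewrite raddf_sum big_distrl /=.
rewrite (exchange_big_dep (fun E : {set 'I_K} => [disjoint E & I])) /=; last first.
  by move=> i E _ /andP [].
apply: eq_bigr => E dEI; rewrite (big_pred1 (Ordinal (cardD _ _ dEI))) /=.
  by rewrite !polyCM; ring.
by move=> i; rewrite dEI /= eq_sym -val_eqE.
Qed.

Lemma newton_initial_sum tau K (y : 'I_K -> R) (e : R) (T : {set 'I_K} -> R) :
  (forall i, y i = tau (K - i.+1)%N) ->
  (forall (J : {set 'I_K}) (i i' : 'I_K), i' = i.+1 :> nat ->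
     i \notin J -> i' \in J -> T J = 0) ->
  \sum_(I : {set 'I_K})
     (e ^+ #|I| * T I)%:P * \prod_(i | i \notin I) ('X - (y i)%:P) =
  \sum_(k < K.+1) (e ^+ k * T [set i : 'I_K | (i < k)%N])%:P * newt tau (K - k).
Proof.
move=> hy hT; rewrite big_initial_sets => [|J i i' e1 iJ i'J]; last first.
  by rewrite (hT J i i') // mulr0 mul0r.
apply: eq_bigr => k _; rewrite (newton_prod_initial hy); last by rewrite -ltnS.
by rewrite card_ord_lt // -ltnS.
Qed.

End Pieri.

(** * Alternants and their Pieri rules *)

Section Alternants.
Variable R : comNzRingType.
Variable t : nat -> R.

Definition fpow (x : R) k : R := \prod_(l < k) (x - t l).

Lemma fpowS x k : fpow x k.+1 = fpow x k * (x - t k).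
Proof. by rewrite /fpow big_ord_recr. Qed.

Lemma fpow0 x : fpow x 0 = 1.
Proof. by rewrite /fpow big_ord0. Qed.

Lemma horner_newt x k : (newt t k).[x] = fpow x k.
Proof.
elim: k => [|k IH]; first by rewrite /newt big_ord0 hornerC fpow0.
by rewrite newtS hornerM IH fpowS hornerXsubC.
Qed.

Definition alt m (x : 'I_m -> R) (b : 'I_m -> nat) : R :=
  \det (\matrix_(i, j) fpow (x j) (b i)).

Definition charE m (x : 'I_m -> R) : {poly R} := \prod_j ('X - (x j)%:P).

Lemma eq_alt m (x : 'I_m -> R) b b' : b =1 b' -> alt x b = alt x b'.
Proof. by move=> h; congr (\det _); apply/matrixP => i j; rewrite !mxE h. Qed.

Lemma alt_dup m (x : 'I_m -> R) (b : 'I_m -> nat) i i' :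
  i != i' -> b i = b i' -> alt x b = 0.
Proof.
by move=> ne e; apply: (determinant_alternate ne) => j; rewrite !mxE e.
Qed.

Lemma alt_mulE m (x : 'I_m -> R) (b : 'I_m -> nat) :
  charE x * (alt x b)%:P = \sum_(I : {set 'I_m})
    ((-1) ^+ #|I| * alt x (fun i => b i + (i \in I))%N)%:P *
     \prod_(i | i \notin I) ('X - (t (b i))%:P).
Proof.
transitivity (\det (\matrix_(i, j) (('X - (t (b i))%:P) * (fpow (x j) (b i))%:P +
    (-1) * (fpow (x j) (b i).+1)%:P))).
  rewrite /charE /alt -det_map_mx /=.
  have -> : \matrix_(i, j) (('X - (t (b i))%:P) * (fpow (x j) (b i))%:P +
       (-1) * (fpow (x j) (b i).+1)%:P) =
     map_mx polyC (\matrix_(i, j) fpow (x j) (b i)) *m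
       diag_mx (\row_j ('X - (x j)%:P)) :> 'M[{poly R}]_m.
    apply/matrixP => i j; rewrite mul_mx_diag !mxE fpowS polyCM polyCB; ring.
  rewrite det_mulmx det_diag mulrC; congr (_ * _).
  by apply: eq_bigr => j _; rewrite mxE.
pose A := \matrix_(i, j) (fpow (x j) (b i))%:P : 'M[{poly R}]_m.
pose B := \matrix_(i, j) (fpow (x j) (b i).+1)%:P : 'M[{poly R}]_m.
transitivity (\det (\matrix_(i, j) (('X - (t (b i))%:P) * A i j + (-1) * B i j))).
  by congr (\det _); apply/matrixP => i j; rewrite !mxE.
rewrite (det_row_expand (fun i => 'X - (t (b i))%:P) (fun=> -1)).
apply: eq_bigr => I _; rewrite (bigID (mem I)) /= polyCM.
have -> : \prod_(i in I) (if i \in I then -1 else 'X - (t (b i))%:P) =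
    ((-1) ^+ #|I|)%:P :> {poly R}.
  rewrite polyC_exp polyCN polyC1 -prodr_const.
  by apply: eq_bigr => i ->.
have -> : \det (\matrix_(i, j) (if i \in I then B i j else A i j)) =
    (alt x (fun i => b i + (i \in I))%N)%:P.
  rewrite -det_map_mx; congr (\det _); apply/matrixP => i j; rewrite !mxE.
  by case: ifP => _; rewrite ?addn1 ?addn0.
rewrite mulrAC; congr (_ * _).
by apply: eq_bigr => i /negPf ->.
Qed.

(* f(x_j) only depends on f mod E, so that the matrix of alt x b factors through
   the Vandermonde matrix. *)
Lemma alt_factor m (x : 'I_m -> R) b :
  exists s, alt x b = s * alt x (fun i => m - i.+1)%N.
Proof.
have rem k : exists a : 'I_m -> R, forall j, fpow (x j) k = \sum_l a l * fpow (x j) l.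
  have mE : charE x \is monic by apply: monic_prod_XsubC.
  have sE : size (charE x) = m.+1.
    by rewrite /charE size_prod_XsubC /index_enum -enumT size_enum_ord.
  have := Pdiv.RingMonic.rdivp_eq mE (newt t k).
  have := Pdiv.CommonRing.ltn_rmodpN0 (newt t k) (monic_neq0 mE).
  rewrite sE ltnS => /(newt_span t) [a ->] e; exists a => j.
  rewrite -horner_newt e hornerD hornerM.
  have -> : (charE x).[x j] = 0.
    by rewrite /charE horner_prod (bigD1 j) //= hornerXsubC subrr mul0r.
  rewrite mulr0 add0r horner_sum; apply: eq_bigr => l _.
  by rewrite hornerM hornerC horner_newt.
have [a ha] := fin_all_exists (fun i => rem (b i)).
exists (\det (\matrix_(i, l) a i (rev_ord l))).
rewrite /alt -det_mulmx; congr (\det _); apply/matrixP => i j; rewrite !mxE ha.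
by rewrite (reindex_inj rev_ord_inj) /=; apply: eq_bigr => l _; rewrite !mxE.
Qed.

Lemma alt_perm m (x : 'I_m -> R) b (s : 'S_m) :
  alt x (fun i => b (s i)) = (-1) ^+ s * alt x b.
Proof.
rewrite /alt -det_perm -det_mulmx -row_permE; congr (\det _).
by apply/matrixP => i j; rewrite !mxE.
Qed.

End Alternants.

(** * Factorial elementary and complete symmetric functions *)

Section SymmetricCoefficients.
Variables (R : comNzRingType) (t : nat -> R) (m : nat) (x : 'I_m -> R).

(** Up to the sign (-1)^k, the factorial elementary symmetric function; the formula is [newton_prod]
    with [I] empty, applied to [charE x]. *)
Definition ecoef k : R := \sum_(E : {set 'I_m} | #|E| == k)
  \prod_(i in E) (t (nabove E i) - x i).

Lemma charE_newt : charE x = \sum_(k < m.+1) (ecoef k)%:P * newt t (m - k).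
Proof.
have := newton_prod t x set0; rewrite (eq_bigl xpredT) => [|i]; last by rewrite inE.
rewrite -/(charE x) => ->.
rewrite (eq_bigl xpredT) => [|E]; last by rewrite disjoints_subset setC0 subsetT.
have cardE (E : {set 'I_m}) : (#|E| < m.+1)%N.
  by rewrite ltnS -[X in (_ <= X)%N]card_ord max_card.
rewrite (partition_big (fun E : {set 'I_m} => Ordinal (cardE E)) xpredT) //=.
apply: eq_bigr => k _; rewrite raddf_sum big_distrl /=.
apply: eq_big => [E|E]; first by rewrite -val_eqE.
by rewrite -val_eqE => /eqP /= <-; rewrite cards0 set0U.
Qed.

Lemma charE_monic : charE x \is monic.
Proof. exact: monic_prod_XsubC. Qed.

Lemma size_charE : size (charE x) = m.+1.
Proof. by rewrite /charE size_prod_XsubC /index_enum -enumT size_enum_ord. Qed.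

Lemma charE_root j : (charE x).[x j] = 0.
Proof. by rewrite /charE horner_prod (bigD1 j) //= hornerXsubC subrr mul0r. Qed.

Lemma ecoef_mul (b : 'I_m -> nat) k : (k <= m)%N ->
  ecoef k * alt t x b = \sum_(I : {set 'I_m}) \sum_(E : {set 'I_m} |
       [disjoint E & I] && (#|I| + #|E| == k)%N)
     (-1) ^+ #|I| * (\prod_(i in E) (t (nabove (I :|: E) i) - t (b i))) *
       alt t x (fun i => b i + (i \in I))%N.
Proof.
by move=> hk; exact: (newton_extract (c := ecoef) charE_newt (alt_mulE t x b)).
Qed.

Lemma alt_jump (b : 'I_m -> nat) (J : {set 'I_m}) (i i' : 'I_m) :
  i' = i.+1 :> nat -> b i = (b i').+1 -> i \notin J -> i' \in J ->
  alt t x (fun i => b i + (i \in J))%N = 0.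
Proof.
move=> e hb iJ i'J; apply: (@alt_dup _ _ _ _ _ i i').
  by apply/eqP => ii'; move: e; rewrite ii'; lia.
by rewrite i'J (negPf iJ) hb addn0 addn1.
Qed.

(** The exponents of the empty partition are consecutive, so raising a set of rows creates two equal
    rows unless the set is initial; each Newton coefficient is then a single alternant. *)
Lemma ecoef_alt0 k : (k <= m)%N ->
  ecoef k * alt t x (fun i => m - i.+1)%N =
  (-1) ^+ k * alt t x (fun i => m - i.+1 + (i < k))%N.
Proof.
move=> hk; have h := alt_mulE t x (fun i => m - i.+1)%N.
rewrite (newton_initial_sum (tau := t)) in h; first last.
- move=> J i i' e iJ i'J; apply: (alt_jump e) => //.
  by rewrite e; have := ltn_ord i'; lia.
- by [].
rewrite charE_newt big_distrl /= in h.
have := newt_free_eq (tau := t) (K := m.+1)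
  (a := fun k => ecoef (m - k)%N * alt t x (fun i => m - i.+1)%N)
  (b := fun k => (-1) ^+ (m - k)%N * alt t x (fun i => m - i.+1 + (i < m - k))%N).
have lt : (m - k < m.+1)%N by rewrite ltnS leq_subr.
move=> H; have {H} := H _ (Ordinal lt); rewrite /= subKn //; apply.
rewrite (reindex_inj rev_ord_inj) [RHS](reindex_inj rev_ord_inj) /=.
transitivity (\sum_(i < m.+1) (ecoef i)%:P * newt t (m - i) *
    (alt t x (fun i => m - i.+1)%N)%:P).
  apply: eq_bigr => i _; rewrite subSS subKn; last by rewrite -ltnS.
  by rewrite polyCM; ring.
rewrite h; apply: eq_bigr => i _; rewrite subSS subKn; last by rewrite -ltnS.
by congr ((_ * _)%:P * _); apply: eq_alt => j; rewrite inE.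
Qed.

(* The representative of degree < m of newt t (m.-1 + k) modulo charE x. *)
Fixpoint gpol k : {poly R} :=
  if k is k'.+1 then
    ('X - (t (m.-1 + k'))%:P) * gpol k' - ((gpol k')`_m.-1)%:P * charE x
  else newt t m.-1.

(** The factorial analogue of h_k. Building [gpol] by recursion, instead of one division by [charE],
    lets [raising_gpol] follow the exponents one step at a time. *)
Definition hcoef k : R := (gpol k)`_m.-1.

Hypothesis m_gt0 : (0 < m)%N.

Lemma size_gpol k : (size (gpol k) <= m)%N.
Proof.
elim: k => [|k IH] /=; first by rewrite size_newt prednK.
set c := t _; set g := gpol k in IH *.
apply/leq_sizeP => j; rewrite coefB coefCM mulrBl coefB coefCM coefXM.
case: j => [|j]; first by lia.
(* In degree [m] the multiple of the monic [charE] cancels the leading term; beyond it all the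
   coefficients are 0. *)
rewrite /= leq_eqVlt => /orP [/eqP ej|hj].
  have -> : g`_j.+1 = 0 by rewrite nth_default // -ej.
  have /monicP := charE_monic; rewrite lead_coefE size_charE /= => e1.
  by rewrite -ej e1 mulr0 subr0 mulr1 ej subrr.
have -> : g`_j = 0 by rewrite nth_default // (leq_trans IH).
have -> : g`_j.+1 = 0 by rewrite nth_default // (leq_trans IH) // ltnW.
have -> : (charE x)`_j.+1 = 0 by rewrite nth_default // size_charE.
by rewrite !mulr0 !subr0.
Qed.

Lemma gpol_root k j : (gpol k).[x j] = fpow t (x j) (m.-1 + k).
Proof.
elim: k => [|k IH] /=; first by rewrite horner_newt addn0.
rewrite hornerD hornerN !hornerM charE_root mulr0 subr0 IH hornerXsubC addnS fpowS.
by rewrite mulrC.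
Qed.

(** The first row is [gpol k] evaluated at the [x j], a combination of the [newt t l] with [l < m].
    Those with [l < m.-1] are the remaining rows, so only the top coefficient contributes to the
    determinant. *)
Lemma hcoef_alt0 k :
  alt t x (fun i => if i == 0%N :> nat then m.-1 + k else m - i.+1)%N =
  hcoef k * alt t x (fun i => m - i.+1)%N.
Proof.
have [a ha] := newt_span t (size_gpol k).
have lt_m : (m.-1 < m)%N by rewrite prednK.
have hlast : hcoef k = a (Ordinal lt_m).
  rewrite /hcoef ha coef_sum (bigD1 (Ordinal lt_m)) //= coefCM big1 ?addr0 => [|l ne].
    have /monicP := newt_monic t m.-1; rewrite lead_coefE size_newt /= => ->.
    by rewrite mulr1.
  rewrite coefCM nth_default ?mulr0 // size_newt ltn_neqAle.
  by rewrite -ltnS prednK // ltn_ord andbT.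
pose C : 'M[R]_m := \matrix_(i, j) if i == 0%N :> nat then a (rev_ord j) else (i == j)%:R.
have -> : alt t x (fun i => if i == 0%N :> nat then m.-1 + k else m - i.+1)%N =
    \det (C *m \matrix_(i, j) fpow t (x j) (m - i.+1)).
  congr (\det _); apply/matrixP => i j; rewrite !mxE.
  have [i0|i0] := eqVneq (i : nat) 0%N.
    rewrite -gpol_root ha horner_sum (reindex_inj rev_ord_inj) /=.
    apply: eq_bigr => l _; rewrite !mxE i0 eqxx hornerM hornerC horner_newt.
    by [].
  rewrite (bigD1 i) //= big1 ?addr0 => [|l ne]; rewrite !mxE (negPf i0).
    by rewrite eqxx mul1r.
  by rewrite eq_sym (negPf ne) mul0r.
rewrite det_mulmx; congr (_ * _); rewrite -det_tr det_trig.
  pose o := Ordinal m_gt0.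
  rewrite (bigD1 o) //= big1 ?mulr1 => [|i ne]; rewrite !mxE /=.
    by rewrite hlast; congr a; apply: val_inj; rewrite /= subn1.
  by rewrite eqxx; case: eqP => // i0; case/eqP: ne; apply: val_inj.
apply/is_trig_mxP => i j lt; rewrite !mxE -val_eqE.
by case: eqP => [j0|_]; [lia|rewrite gtn_eqF].
Qed.

End SymmetricCoefficients.

(** * Control of the exponents under multiplication *)

Section Raising.
Variables (L : comNzRingType) (tL : nat -> L) (m : nat).

Local Notation U := {mpoly L[m]}.

Definition tU k : U := (tL k)%:MP.
Definition xU (i : 'I_m) : U := 'X_i.

Definition altspan D (u : U) : Prop :=
  exists c : {ffun 'I_m -> 'I_D} -> L,
    u = \sum_b (c b)%:MP * alt tU xU (fun i => b i).

(* The spread k of u controls which products stay in Gr(m, 2n-1): multiplying an alternant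
   with exponents < n by u involves only exponents < n + k. *)
Definition raising k (u : U) : Prop :=
  forall D a, altspan D a -> altspan (D + k) (u * a).

Lemma altspan0 D : altspan D 0.
Proof. by exists (fun=> 0); rewrite big1 // => b _; rewrite mpolyC0 mul0r. Qed.

Lemma altspanD D u v : altspan D u -> altspan D v -> altspan D (u + v).
Proof.
move=> [c ->] [d ->]; exists (fun b => c b + d b).
by rewrite -big_split /=; apply: eq_bigr => b _; rewrite mpolyCD mulrDl.
Qed.

Lemma altspanZ D c u : altspan D u -> altspan D (c%:MP * u).
Proof.
move=> [d ->]; exists (fun b => c * d b).
by rewrite big_distrr /=; apply: eq_bigr => b _; rewrite mpolyCM mulrA.
Qed.

Lemma altspan_sum D (I : finType) (P : pred I) (F : I -> U) :
  (forall i, P i -> altspan D (F i)) -> altspan D (\sum_(i | P i) F i).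
Proof. by move=> h; elim/big_ind: _ => //; [exact: altspan0|exact: altspanD]. Qed.

Lemma altspan_alt D (b : 'I_m -> nat) : (forall i, b i < D)%N ->
  altspan D (alt tU xU b).
Proof.
move=> hb; exists (fun c => ((c == [ffun i => Ordinal (hb i)])%:R)).
rewrite (bigD1 [ffun i => Ordinal (hb i)]) //= big1 => [|c /negPf ->]; last first.
  by rewrite mpolyC0 mul0r.
by rewrite eqxx mpolyC1 mul1r addr0; apply: eq_alt => i; rewrite ffunE.
Qed.

Lemma raising_altP k u :
  (forall D (b : 'I_m -> nat), (forall i, b i < D)%N ->
     altspan (D + k) (u * alt tU xU b)) -> raising k u.
Proof.
move=> h D a [c ->]; rewrite big_distrr /=; apply: altspan_sum => b _.
by rewrite mulrCA; apply: altspanZ; apply: h => i.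
Qed.

Lemma altspanW D D' a : (D <= D')%N -> altspan D a -> altspan D' a.
Proof.
move=> le [c ->]; apply: altspan_sum => b _; apply/altspanZ/altspan_alt => i.
exact: leq_trans (ltn_ord _) le.
Qed.

Lemma raisingW k k' u : (k <= k')%N -> raising k u -> raising k' u.
Proof. by move=> le h D a /h; apply: altspanW; rewrite leq_add2l. Qed.

Lemma raisingC c : raising 0 c%:MP.
Proof. by move=> D a ha; rewrite addn0; apply: altspanZ. Qed.

Lemma raisingD k u v : raising k u -> raising k v -> raising k (u + v).
Proof. by move=> hu hv D a ha; rewrite mulrDl; apply: altspanD; [apply: hu|apply: hv]. Qed.

Lemma raisingN k u : raising k u -> raising k (- u).
Proof.
move=> hu D a ha; rewrite mulNr -mulrN; apply: hu.
by rewrite -mulN1r -mpolyC1 -mpolyCN; apply: altspanZ.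
Qed.

Lemma raisingM k l u v : raising k u -> raising l v -> raising (k + l) (u * v).
Proof.
by move=> hu hv D a ha; rewrite -mulrA addnA addnAC; apply: hu; apply: hv.
Qed.

Lemma raising_sum k (I : finType) (P : pred I) (F : I -> U) :
  (forall i, P i -> raising k (F i)) -> raising k (\sum_(i | P i) F i).
Proof.
move=> h; elim/big_ind: _ => //; last exact: raisingD.
by rewrite -mpolyC0; apply: raisingW (raisingC 0).
Qed.

Lemma raising0_prod (I : finType) (P : pred I) (F : I -> U) :
  (forall i, P i -> raising 0 (F i)) -> raising 0 (\prod_(i | P i) F i).
Proof.
move=> h; elim/big_ind: _ => //; last by move=> u v hu hv; apply: (raisingM hu hv).
by rewrite -mpolyC1; apply: raisingC.
Qed.

(** In [ecoef_mul] each exponent grows by at most 1, whatever [k] is. *)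
Lemma raising_ecoef k : (k <= m)%N -> raising 1 (ecoef tU xU k).
Proof.
move=> hk; apply: raising_altP => D b hb; rewrite ecoef_mul //.
apply: altspan_sum => I _; apply: altspan_sum => E _; rewrite -mulrA.
have -> : (-1) ^+ #|I| = ((-1) ^+ #|I|)%:MP :> U by rewrite rmorph_sign.
apply: altspanZ; rewrite -[X in altspan X]addn0.
apply: raising0_prod => [i _|].
  by rewrite /tU -mpolyCB; apply: raisingC.
apply: altspan_alt => i; have := hb i; case: (i \in I); lia.
Qed.

Lemma raisingPM k l (p q : {poly U}) :
  (forall i, raising k p`_i) -> (forall i, raising l q`_i) ->
  forall i, raising (k + l) (p * q)`_i.
Proof.
by move=> hp hq i; rewrite coefM; apply: raising_sum => j _; apply: raisingM.
Qed.

Lemma raising_XsubC k i : raising 0 ('X - (tU k)%:P)`_i.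
Proof.
rewrite coefB coefX coefC; apply: raisingD; last first.
  apply: raisingN; case: ifP => _; last by rewrite -mpolyC0; apply: raisingC.
  exact: raisingC.
by case: (i == 1%N); rewrite -?mpolyC1 -?mpolyC0; apply: raisingC.
Qed.

Lemma raising_newt l i : raising 0 (newt tU l)`_i.
Proof.
elim: l i => [|l IH] i.
  by rewrite /newt big_ord0 coef1; case: (i == 0%N);
    rewrite -?mpolyC1 -?mpolyC0; apply: raisingC.
by rewrite newtS; apply: (raisingPM IH); apply: raising_XsubC.
Qed.

Lemma raising_charE i : raising 1 (charE xU)`_i.
Proof.
rewrite (charE_newt tU) coef_sum; apply: raising_sum => k _; rewrite coefCM.
have lek : (k <= m)%N by rewrite -ltnS.
exact: (raisingM (raising_ecoef lek) (raising_newt _ _)).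
Qed.

(** Each step of the recursion multiplies by at most one coefficient of [charE], which costs 1; the
    Newton polynomials have constant coefficients and cost nothing. *)
Lemma raising_gpol k i : raising k (gpol tU xU k)`_i.
Proof.
elim: k i => [|k IH] i /=; first exact: raising_newt.
rewrite coefB; apply: raisingD; last apply: raisingN.
  apply: (@raisingW k) => //; rewrite -[X in raising X](add0n k).
  exact: (raisingPM (raising_XsubC _) IH).
by rewrite coefCM -addn1; apply: raisingM; [apply: IH|apply: raising_charE].
Qed.

Lemma raising_hcoef k : raising k (hcoef tU xU k).
Proof. exact: raising_gpol. Qed.

End Raising.

(** * Partitions and boundary paths *)

Lemma dec_gap m (b : 'I_m -> nat) :
  (forall i j : 'I_m, (i < j)%N -> (b j < b i)%N) ->
  forall i j : 'I_m, (i <= j)%N -> (b j + (j - i) <= b i)%N.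
Proof.
move=> hb i; suff H d : forall j : 'I_m, (j = i + d :> nat)%N -> (b j + d <= b i)%N.
  by move=> j le; apply: H; rewrite subnKC.
elim: d => [|d IH] j e.
  by rewrite addn0 (_ : j = i) //; apply: val_inj; rewrite /= e addn0.
have lt : (i + d < m)%N by have := ltn_ord j; lia.
have := IH (Ordinal lt) erefl.
have : (b j < b (Ordinal lt))%N by apply: hb => /=; rewrite e addnS.
lia.
Qed.

Lemma sort_dec m (b : 'I_m -> nat) : injective b ->
  exists s : 'S_m, forall i j : 'I_m, (i < j)%N -> (b (s j) < b (s i))%N.
Proof.
move=> inj_b; pose l := sort geq (codom b).
have hp : perm_eq l [tuple b i | i < m] by rewrite perm_sort /= codomE.
case/tuple_permP: hp => s hs; exists s => i j lt_ij.
have sz : size l = m by rewrite size_sort size_codom card_ord.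
have nthl (k : 'I_m) : nth 0%N l k = b (s k).
  by rewrite hs -tnth_nth tnth_mktuple tnth_mktuple.
have geq_tr : transitive geq by move=> x y z /= h1 h2; apply: leq_trans h2 h1.
have srt : sorted geq l by apply: sort_sorted => x y; apply: leq_total.
have := sorted_leq_nth geq_tr (fun x => leqnn x) 0%N srt i j.
rewrite !inE sz => /(_ (ltn_ord i) (ltn_ord j) (ltnW lt_ij)); rewrite !nthl /= => le.
rewrite ltn_neqAle le andbT; apply/eqP => /inj_b /perm_inj e.
by rewrite e ltnn in lt_ij.
Qed.

Section Partitions.
Variables m n : nat.
Implicit Types g h : part m n.

Lemma part_mono g (i j : 'I_m) : (i <= j)%N -> (g j <= g i)%N.
Proof. by case: g => f /= /forallP /(_ i) /forallP /(_ j) /implyP. Qed.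

Lemma part_le g i : (g i <= n - m)%N.
Proof. by rewrite -ltnS ltn_ord. Qed.

Lemma part_ext g h : (forall i, g i = h i :> nat) -> g = h.
Proof. by move=> e; apply/val_inj/ffunP => i; apply: val_inj; exact: e. Qed.

Lemma part_exists (f : 'I_m -> nat) : (forall i j : 'I_m, (i <= j)%N -> (f j <= f i)%N) ->
  (forall i, f i <= n - m)%N -> exists g, forall i, g i = f i :> nat.
Proof.
move=> mono_f le_f.
have hf i : (f i < (n - m).+1)%N by rewrite ltnS.
have nf : nonincr [ffun i => Ordinal (hf i)].
  apply/forallP => i; apply/forallP => j; apply/implyP => le.
  by rewrite !ffunE; exact: mono_f.
by exists (Part nf) => i; rewrite /= ffunE.
Qed.

(* Steps are numbered from 0 in bnum and snum, from 1 in upnum and sidenum. *)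
Definition bnum g (i : 'I_m) : nat := (g i + (m - i.+1))%N.

Definition snum g (j : 'I_(n - m)) : nat := (j + m - pconj g j)%N.

Lemma bnum_lt (le_mn : (m <= n)%N) g i : (bnum g i < n)%N.
Proof. by have := part_le g i; have := ltn_ord i; rewrite /bnum; lia. Qed.

Lemma bnum_anti g (i j : 'I_m) : (i < j)%N -> (bnum g j < bnum g i)%N.
Proof.
move=> lt; have := part_mono g (ltnW lt); have := ltn_ord j; rewrite /bnum; lia.
Qed.

Lemma bnum_inj g : injective (bnum g).
Proof.
move=> i j e; apply/val_inj => /=; case: (ltngtP i j) => // lt.
  by have := bnum_anti g lt; rewrite e ltnn.
by have := bnum_anti g lt; rewrite e ltnn.
Qed.

Lemma bnum_ext g h : bnum g =1 bnum h -> g = h.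
Proof. by move=> e; apply: part_ext => i; have := e i; rewrite /bnum => /addIn. Qed.

Lemma bnum_exists (b : 'I_m -> nat) : (forall i j : 'I_m, (i < j)%N -> (b j < b i)%N) ->
  (forall i, b i < n)%N -> exists g, bnum g =1 b.
Proof.
move=> dec_b lt_b; have gap := dec_gap dec_b.
have low (i : 'I_m) : (m - i.+1 <= b i)%N.
  have lt : (m.-1 < m)%N by have := ltn_ord i; lia.
  by have := gap i (Ordinal lt); have := ltn_ord i; rewrite /=; lia.
have [||g hg] := part_exists (f := fun i => b i - (m - i.+1))%N.
- by move=> i j le; have := gap i j le; have := ltn_ord j; lia.
- move=> i; have lt : (0 < m)%N by have := ltn_ord i; lia.
  by have := gap (Ordinal lt) i; have := lt_b (Ordinal lt); have := ltn_ord i; rewrite /=; lia.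
by exists g => i; rewrite /bnum hg subnK.
Qed.

Lemma bnum_sort (b : 'I_m -> nat) : injective b -> (forall i, b i < n)%N ->
  exists s : 'S_m, exists g, bnum g =1 (fun i => b (s i)).
Proof.
move=> inj_b lt_b; have [s hs] := sort_dec inj_b; exists s.
by apply: bnum_exists => // i; apply: lt_b.
Qed.

(** Both sequences are strictly decreasing, so [s] is strictly increasing, hence the identity. *)
Lemma bnum_perm g h (s : 'S_m) : (forall i, bnum g i = bnum h (s i)) ->
  s = 1%g /\ g = h.
Proof.
move=> e.
have mono_s (i j : 'I_m) : (i < j)%N -> (s i < s j)%N.
  move=> lt; have := bnum_anti g lt; rewrite !e.
  case: (ltngtP (s i) (s j)) => // [lt'|/val_inj -> ]; last by rewrite ltnn.
  by have := bnum_anti h lt'; lia.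
suff s1 : s = 1%g by split=> //; apply: bnum_ext => i; rewrite e s1 perm1.
apply/permP => i; rewrite perm1; apply: val_inj => /=.
have up k : forall i : 'I_m, (i <= k)%N -> (i <= s i)%N.
  elim: k => [|k IH] {}i; first by rewrite leqn0 => /eqP ->.
  rewrite leq_eqVlt ltnS => /orP [/eqP ei|/IH //].
  have lt : (k < m)%N by have := ltn_ord i; lia.
  have := IH (Ordinal lt) (leqnn _); have := mono_s (Ordinal lt) i; rewrite /=; lia.
have dn k : forall i : 'I_m, (m - i.+1 <= k)%N -> (s i <= i)%N.
  elim: k => [|k IH] {}i.
    by move=> h1; have := ltn_ord (s i); have := ltn_ord i; lia.
  rewrite leq_eqVlt ltnS => /orP [/eqP ei|/IH //].
  have lt : (i.+1 < m)%N by have := ltn_ord i; lia.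
  have := IH (Ordinal lt); have := mono_s i (Ordinal lt); rewrite /=; lia.
by apply/eqP; rewrite eqn_leq (dn _ _ (leqnn _)) (up _ _ (leqnn _)).
Qed.

Lemma psize_bnum g : (\sum_i bnum g i = psize g + \sum_(i < m) (m - i.+1))%N.
Proof. by rewrite /psize -big_split. Qed.

Lemma lt_pconj g (i : 'I_m) j : (i < pconj g j)%N = (j < g i)%N.
Proof.
rewrite /pconj -mem_downset ?inE // => i1 i2 le; rewrite !inE => /leq_trans; apply.
exact: part_mono.
Qed.

Lemma pconj_le g j : (pconj g j <= m)%N.
Proof. by rewrite -[X in (_ <= X)%N](card_ord m) max_card. Qed.

Lemma pconj_mono g j j' : (j <= j')%N -> (pconj g j' <= pconj g j)%N.
Proof.
move=> le; apply/subset_leq_card/subsetP => i; rewrite !inE; exact: leq_ltn_trans.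
Qed.

Lemma psize_pconj g : psize g = (\sum_(j < n - m) pconj g j)%N.
Proof.
have h (i : 'I_m) : (g i = \sum_(j < n - m) (j < g i) :> nat)%N.
  rewrite -[LHS](card_ord_lt (part_le g i)) -sum1_card big_mkcond.
  by apply: eq_bigr => j _; rewrite inE; case: (j < g i)%N.
rewrite /psize (eq_bigr _ (fun i _ => h i)) exchange_big /=.
apply: eq_bigr => j _; rewrite /pconj -sum1_card [RHS]big_mkcond.
by apply: eq_bigr => i _; rewrite inE; case: (j < g i)%N.
Qed.

Lemma pconj_ext g h : (forall j : 'I_(n - m), pconj g j = pconj h j) -> g = h.
Proof.
move=> e; apply: part_ext => i.
have {}e j : (j < n - m)%N -> (j < g i)%N = (j < h i)%N.
  by move=> lt; rewrite -!lt_pconj (e (Ordinal lt)).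
have := part_le g i; have := part_le h i.
case: (ltngtP (g i) (h i)) => // lt h1 h2.
  by have := e (g i); rewrite lt ltnn => /(_ (leq_trans lt h1)).
by have := e (h i); rewrite lt ltnn => /(_ (leq_trans lt h2)).
Qed.

Lemma pconj_exists (f : 'I_(n - m) -> nat) :
  (forall i j : 'I_(n - m), (i <= j)%N -> (f j <= f i)%N) ->
  (forall j, f j <= m)%N -> exists g, forall j : 'I_(n - m), pconj g j = f j.
Proof.
move=> mono_f le_f.
have [||g hg] := @part_exists (fun i => #|[set j : 'I_(n - m) | (i < f j)%N]|).
- move=> i j le; apply/subset_leq_card/subsetP => k; rewrite !inE.
  exact: leq_ltn_trans.
- by move=> i; rewrite -[X in (_ <= X)%N](card_ord (n - m)) max_card.
exists g => j.
have h (i : 'I_m) : (i < pconj g j)%N = (i < f j)%N.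
  rewrite lt_pconj hg -mem_downset ?inE // => j1 j2 le; rewrite !inE => /leq_trans.
  by apply; apply: mono_f.
case: (ltngtP (pconj g j) (f j)) => // lt.
  by have := h (Ordinal (leq_trans lt (le_f j))); rewrite /= lt ltnn.
by have := h (Ordinal (leq_trans lt (pconj_le g j))); rewrite /= lt ltnn.
Qed.

Lemma snum_lt (le_mn : (m <= n)%N) g j : (snum g j < n)%N.
Proof. by have := ltn_ord j; rewrite /snum; lia. Qed.

Lemma snum_mono g (j j' : 'I_(n - m)) : (j < j')%N -> (snum g j < snum g j')%N.
Proof.
move=> lt; have := pconj_mono g (ltnW lt).
have := pconj_le g j; have := pconj_le g j'; rewrite /snum; lia.
Qed.

Lemma snum_inj g : injective (snum g).
Proof.
move=> i j e; apply/val_inj => /=; case: (ltngtP i j) => // lt.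
  by have := snum_mono g lt; rewrite e ltnn.
by have := snum_mono g lt; rewrite e ltnn.
Qed.

(** By [lt_pconj], the number of the up-step is the larger one if the box in row [i] and column [j]
    belongs to [g], and the smaller one if it does not. *)
Lemma bnum_neq_snum g i j : bnum g i <> snum g j.
Proof.
rewrite /bnum /snum => e; have := lt_pconj g i j; have := ltn_ord i.
have := pconj_le g j; lia.
Qed.

Lemma upnumE g i : upnum g i = (bnum g i).+1.
Proof. by rewrite /upnum /bnum; have := ltn_ord i; lia. Qed.

Lemma sidenumE g j : sidenum g j = (snum g j).+1.
Proof. by rewrite /sidenum /snum; have := pconj_le g j; lia. Qed.

Lemma in_upsteps g a : (a \in upsteps g) = [exists i, a == bnum g i :> nat].
Proof. by rewrite inE; apply: eq_existsb => i; rewrite upnumE eqSS. Qed.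

Lemma sidesteps_upsteps g : (m <= n)%N -> sidesteps g = ~: upsteps g.
Proof.
move=> le_mn; apply/eqP; rewrite eqEcard; apply/andP; split.
  apply/subsetP => a; rewrite inE => /existsP [j /eqP]; rewrite sidenumE => -[ea].
  rewrite inE in_upsteps; apply/existsP => -[i /eqP e].
  by case: (@bnum_neq_snum g i j); rewrite -e -ea.
have -> : upsteps g = [set Ordinal (bnum_lt le_mn g i) | i : 'I_m].
  apply/setP => a; rewrite in_upsteps; apply/existsP/imsetP => [[i /eqP e]|[i _ ->]].
    by exists i => //; apply: val_inj.
  by exists i.
have -> : sidesteps g = [set Ordinal (snum_lt le_mn g i) | i : 'I_(n - m)].
  apply/setP => a; rewrite inE; apply/existsP/imsetP => [[i]|[i _ ->]].
    by rewrite sidenumE eqSS => /eqP e; exists i => //; apply: val_inj.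
  by exists i; rewrite sidenumE.
rewrite cardsCs setCK !card_imset ?card_ord // => i j /(congr1 val) /=.
  exact: snum_inj.
exact: bnum_inj.
Qed.

End Partitions.

Section SpecialPartitions.
Variables m n : nat.

Lemma pcolE p i : (m < n)%N -> pcol m n p i = (i < p)%N :> nat.
Proof. by move=> lt; rewrite /= ffunE inordK //; case: (i < p)%N; lia. Qed.

Lemma prowE k i : (k <= n - m)%N ->
  prow m n k i = (if i == 0%N :> nat then k else 0)%N :> nat.
Proof. by move=> le; rewrite /= ffunE inordK //; case: ifP; lia. Qed.

Lemma bnum_pwiden (g : part m n) i : bnum (pwiden g) i = bnum g i.
Proof. by rewrite /bnum /= ffunE. Qed.

End SpecialPartitions.

Section MoreAlternants.
Variable R : comNzRingType.
Implicit Types t : nat -> R.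

Lemma alt_map (R' : comNzRingType) (f : {rmorphism R -> R'}) t m (x : 'I_m -> R) b :
  f (alt t x b) = alt (f \o t) (f \o x) b.
Proof.
rewrite /alt -det_map_mx; congr (\det _); apply/matrixP => i j; rewrite !mxE /fpow.
by rewrite rmorph_prod; apply: eq_bigr => l _; rewrite rmorphB.
Qed.

Lemma eq_altx t m (x x' : 'I_m -> R) b : x =1 x' -> alt t x b = alt t x' b.
Proof. by move=> h; congr (\det _); apply/matrixP => i j; rewrite !mxE h. Qed.

Lemma alt_colperm t m (x : 'I_m -> R) b (s : 'S_m) :
  alt t (x \o s) b = (-1) ^+ s * alt t x b.
Proof.
rewrite /alt -odd_permV -det_perm mulrC -det_mulmx -col_permE.
by congr (\det _); apply/matrixP => i j; rewrite !mxE.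
Qed.

Lemma alt_coldup t m (x : 'I_m -> R) b i j : i != j -> x i = x j -> alt t x b = 0.
Proof.
move=> ne e; rewrite /alt -det_tr; apply: (determinant_alternate ne) => k.
by rewrite !mxE e.
Qed.

(** Rows and columns are reversed together, so the two signs cancel; passing from powers to Newton
    polynomials is then a unitriangular change of basis. *)
Lemma alt_vandermonde t m (x : 'I_m -> R) :
  alt t x (fun i => m - i.+1)%N = \prod_(i < m) \prod_(j < m | (i < j)%N) (x i - x j).
Proof.
pose r := perm (@rev_ord_inj m).
have -> : alt t x (fun i => m - i.+1)%N = alt t (x \o r) (fun i => i).
  rewrite alt_colperm -alt_perm.
  by apply: eq_alt => i; rewrite permE.
have -> : alt t (x \o r) (fun i => i) =
    \det ((\matrix_(i, l) (newt t i)`_l) *m Vandermonde m (\row_j (x (r j)))).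
  congr (\det _); apply/matrixP => i j; rewrite !mxE -horner_newt.
  rewrite (@horner_coef_wide _ m) ?size_newt //.
  by apply: eq_bigr => l _; rewrite !mxE.
rewrite det_mulmx det_Vandermonde det_trig; last first.
  by apply/is_trig_mxP => i j lt; rewrite mxE nth_default // size_newt.
rewrite big1 ?mul1r => [|i _]; last first.
  rewrite mxE; have /monicP := newt_monic t i.
  by rewrite lead_coefE size_newt.
rewrite (exchange_big_dep xpredT) //= (reindex_inj rev_ord_inj) /=.
apply: eq_bigr => i _; rewrite (reindex_inj rev_ord_inj) /=.
apply: eq_big => [j|j _]; first by have := ltn_ord i; have := ltn_ord j; lia.
by rewrite !mxE !permE !rev_ordK.
Qed.

End MoreAlternants.

(** * Restriction to the fixed points *)

Section Differences.
Variable N : nat.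
Local Notation L := {mpoly int[N]}.

Definition tL k : L := tvar N k.+1.

Lemma tvarE (i : 'I_N) : tvar N i.+1 = 'X_i.
Proof.
by rewrite /tvar (big_pred1 i).
Qed.

Definition collapse (a b : 'I_N) : 'I_N -> 'I_N := fun i => if i == a then b else i.

Definition subst (a b : 'I_N) (F : L) : L :=
  comp_mpoly [tuple 'X_(collapse a b i) | i < N] F.

HB.instance Definition _ a b := GRing.RMorphism.copy (subst a b)
  (comp_mpoly [tuple 'X_(collapse a b i) | i < N]).

Lemma substZ a b c F : subst a b (c *: F) = c *: subst a b F.
Proof. exact: comp_mpolyZ. Qed.

Lemma substX a b i : subst a b 'X_i = 'X_(collapse a b i).
Proof. by rewrite /subst /= comp_mpolyXU -tnth_nth tnth_mktuple. Qed.

(** The property holds for the variables and is stable under products and linear combinations. *)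
Lemma subst_ideal a b (F : L) : exists G, F - subst a b F = ('X_a - 'X_b) * G.
Proof.
elim/mpolyind: F => [|c M p _ _ [G hG]].
  by exists 0; rewrite rmorph0 subrr mulr0.
suff [G' hG'] : exists G', 'X_[M] - subst a b 'X_[M] = ('X_a - 'X_b) * G'.
  exists (c *: G' + G); rewrite rmorphD /= substZ.
  rewrite opprD addrACA -scalerBr hG' hG mulrDr scalerAr.
  by [].
pose P (F : L) := exists G, F - subst a b F = ('X_a - 'X_b) * G.
have P1 : P 1 by exists 0; rewrite rmorph1 subrr mulr0.
have PM F F' : P F -> P F' -> P (F * F').
  move=> [G1 h1] [G2 h2]; exists (G1 * F' + subst a b F * G2).
  rewrite rmorphM mulrDr mulrA -h1 mulrCA -h2; ring.
have PX i : P 'X_i.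
  rewrite /P substX /collapse; case: eqP => [->|_]; first by exists 1; rewrite mulr1.
  by exists 0; rewrite subrr mulr0.
rewrite mpolyXE_id -/(P _); elim/big_ind: _ => // i _.
by elim: (M i) => [|k IH]; rewrite ?expr0 // exprS; apply: PM.
Qed.

Lemma homog_msize (F : L) d : F != 0 -> F \is d.-homog -> msize F = d.+1.
Proof.
move=> nz hF; have := dhomog_uniq nz hF (dhomog_msize hF) => ->.
by rewrite prednK // lt0n msize_poly_eq0.
Qed.

Lemma diffX_neq0 (a b : 'I_N) : a != b -> 'X_a - 'X_b != 0 :> L.
Proof.
move=> ne; rewrite subr_eq0; apply: contra ne => /eqP /(congr1 (fun F : L => F@_U_(a))).
rewrite !mcoeffX eqxx => h; have : (U_(b)%MM == U_(a)%MM :> 'X_{1..N}) by case: eqP h.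
by move/eqP/mnmP/(_ a); rewrite !mnm1E eqxx eq_sym; case: (a == b).
Qed.

Lemma msize_diffX (a b : 'I_N) : a != b -> msize ('X_a - 'X_b : L) = 2%N.
Proof.
move=> ne; apply: (homog_msize (diffX_neq0 ne)).
by apply: rpredB; rewrite dhomogX /= mdeg1.
Qed.

(* Setting t_c = t_d does not kill t_a - t_b, so the factors can be divided out one by one. *)
Lemma msize_subst0 (l : seq ('I_N * 'I_N)) (F : L) :
  uniq l -> (forall a b, (a, b) \in l -> (b < a)%N /\ subst a b F = 0) ->
  F != 0 -> (size l < msize F)%N.
Proof.
elim: l F => [|[a b] l IH] F /=.
  by move=> _ _; rewrite -msize_poly_eq0 lt0n.
move=> /andP [abl ul] h nzF.
have [ltab F0] := h a b (mem_head _ _).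
have neab : a != b by rewrite -val_eqE gtn_eqF.
have [G hG] := subst_ideal a b F; rewrite F0 subr0 in hG.
have nzG : G != 0 by apply: contra nzF => /eqP G0; rewrite hG G0 mulr0.
rewrite hG msizeM ?diffX_neq0 // msize_diffX //= ltnS; apply: IH => // c d cdl.
have [ltcd Fc0] := h c d (mem_behead (s := _ :: _) cdl); split=> //.
move: Fc0; rewrite hG rmorphM /= rmorphB /= !substX => /eqP.
rewrite mulf_eq0 => /orP [|/eqP //].
rewrite (negPf (diffX_neq0 _)) // /collapse.
case: (eqVneq a c) => [ac|nac].
  rewrite -ac [b == a]eq_sym (negPf neab); apply: contra abl => /eqP <-.
  by rewrite ac.
case: (eqVneq b c) => [bc|_] //; apply/eqP => ad.
by move: ltcd ltab; rewrite -bc -ad; lia.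
Qed.

End Differences.

Section FixedPoints.
Variables m N : nat.
Hypothesis le_mN : (m <= N)%N.
Local Notation L := {mpoly int[N]}.
Implicit Types g e : part m N.

Lemma psize_lt g e : pincl g e -> g != e -> (psize g < psize e)%N.
Proof.
move=> /forallP h; rewrite ltnNge; apply: contra => le_eg; apply/eqP/part_ext => i.
apply/eqP; rewrite eqn_leq (h i) /=.
move: le_eg; rewrite /psize (bigD1 i) //= [X in (_ <= X)%N](bigD1 i) //= => le_eg.
rewrite -(leq_add2r (\sum_(j < m | j != i) e j)); apply: leq_trans le_eg _.
by rewrite leq_add2l; apply: leq_sum => j _; apply: h.
Qed.

Definition bord g (i : 'I_m) : 'I_N := Ordinal (bnum_lt le_mN g i).

Lemma bord_inj g : injective (bord g).
Proof. by move=> i j /(congr1 val) /bnum_inj. Qed.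

Lemma upsteps_bord g : upsteps g = [set bord g i | i : 'I_m].
Proof.
apply/setP => a; rewrite in_upsteps; apply/existsP/imsetP => [[i /eqP e]|[i _ ->]].
  by exists i => //; apply: val_inj.
by exists i.
Qed.

Lemma tL_bord g i : tL N (bnum g i) = 'X_(bord g i).
Proof. by rewrite /tL -[RHS]tvarE. Qed.

Lemma tL_ord (i : 'I_N) : tL N i = 'X_i.
Proof. exact: tvarE. Qed.

(* The alternant with exponents b at the fixed point e, where x_j is the t of the up-step of e
   in row j. *)
Definition fixalt e (b : 'I_m -> nat) : L := alt (tL N) (fun j => tL N (bnum e j)) b.
Definition vand e : L := fixalt e (fun i => m - i.+1)%N.

Lemma fixalt_homog e b : (forall i, b i <= N)%N -> fixalt e b \is (\sum_i b i)%N.-homog.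
Proof.
move=> hb; have hX k : (k < N)%N -> tL N k \is 1.-homog.
  by move=> lt; rewrite (tL_ord (Ordinal lt)) dhomogX /= mdeg1.
have hprod (I : Type) (r : seq I) (P : pred I) (F : I -> L) (d : I -> nat) :
    (forall i, P i -> F i \is (d i).-homog) ->
    \prod_(i <- r | P i) F i \is (\sum_(i <- r | P i) d i)%N.-homog.
  move=> h; elim/big_rec2: _ => [|i d' F' Pi h']; first exact: dhomog1.
  by apply: dhomogM => //; apply: h.
apply: rpred_sum => s _.
have -> (F : L) : (-1) ^+ s * F = (-1 : int) ^+ s *: F by rewrite scaler_sign; case: (odd_perm s); rewrite ?mulN1r ?mul1r.
apply: rpredZ; apply: (hprod) => i _; rewrite mxE.
have := hprod _ (index_enum 'I_(b i)) xpredT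
  (fun l => tL N (bnum e (s i)) - tL N l) (fun=> 1%N).
rewrite sum_nat_const card_ord muln1; apply=> l _.
apply: rpredB; apply: hX; first exact: bnum_lt.
exact: leq_trans (ltn_ord l) _.
Qed.

Lemma vandE e : vand e = \prod_(i < m) \prod_(j < m | (i < j)%N) (tL N (bnum e i) - tL N (bnum e j)).
Proof. exact: alt_vandermonde. Qed.

Lemma tL_diff_neq0 a b : (a < N)%N -> (b < N)%N -> a != b -> tL N a - tL N b != 0.
Proof.
move=> la lb ne; rewrite (tL_ord (Ordinal la)) (tL_ord (Ordinal lb)).
exact: diffX_neq0.
Qed.

Lemma vand_neq0 e : vand e != 0.
Proof.
rewrite vandE; apply/prodf_neq0 => i _; apply/prodf_neq0 => j lt.
by apply: tL_diff_neq0; rewrite ?bnum_lt // gtn_eqF // bnum_anti.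
Qed.

Lemma fpow_fix e i k : (fpow (tL N) (tL N (bnum e i)) k == 0) = (bnum e i < k)%N.
Proof.
apply/idP/idP => [|lt]; last first.
  by rewrite /fpow (bigD1 (Ordinal lt)) //= subrr mul0r.
apply: contraTT; rewrite -leqNgt => le; apply/prodf_neq0 => l _.
have lt : (l < bnum e i)%N by apply: leq_trans (ltn_ord l) le.
apply: tL_diff_neq0; rewrite ?bnum_lt // ?gtn_eqF //.
by apply: ltn_trans lt (bnum_lt _ _ _).
Qed.

Lemma fixalt_supp g e : ~~ pincl g e -> fixalt e (bnum g) = 0.
Proof.
apply: contraNeq => nz; have [s hs] : exists s : 'S_m, forall i, (bnum g i <= bnum e (s i))%N.
  have [/existsP [s /forallP hs]|] := boolP [exists s : 'S_m, [forall i, bnum g i <= bnum e (s i)]%N].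
    by exists s.
  rewrite negb_exists => /forallP h; case/eqP: nz.
  rewrite /fixalt /alt /determinant big1 // => s _.
  have := h s; rewrite negb_forall => /existsP [i].
  rewrite -ltnNge -fpow_fix => /eqP e0; rewrite (bigD1 i) //= mxE e0 mul0r mulr0.
  by [].
apply/forallP => i.
(* Pigeonhole: the [i.+1] rows up to [i] cannot all be sent by [s] into the [i] rows before [i]. The
   row found gives the chain [bnum g i <= bnum g i' <= bnum e (s i') <= bnum e i]. *)
have [i' lei' lesi] : exists2 i' : 'I_m, (i' <= i)%N & (i <= s i')%N.
  have [/existsP [i' /andP [h1 h2]]|] := boolP [exists i' : 'I_m, (i' <= i)%N && (i <= s i')%N].
    by exists i'.
  rewrite negb_exists => /forallP h.
  have : [set s i' | i' in [set i' : 'I_m | (i' < i.+1)%N]] \subset [set i' : 'I_m | (i' < i)%N].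
    apply/subsetP => _ /imsetP [i' hi' ->]; rewrite !inE ltnS in hi' *.
    by have := h i'; rewrite hi' /= -ltnNge.
  move/subset_leq_card; rewrite card_imset; last exact: perm_inj.
  by rewrite !card_ord_lt ?ltnn // ltnW.
have := hs i'.
have : (bnum e (s i') <= bnum e i)%N.
  by move: lesi; rewrite leq_eqVlt => /orP [/eqP/val_inj <- //|/(bnum_anti e)/ltnW].
have : (bnum g i <= bnum g i')%N.
  by move: lei'; rewrite leq_eqVlt => /orP [/eqP/val_inj <- //|/(bnum_anti g)/ltnW].
by rewrite /bnum; lia.
Qed.

(** At its own fixed point the matrix is triangular. The diagonal entry of row [i] is a product over
    all the steps before [bnum g i]: the up-steps among them build the Vandermonde determinant, the
    side-steps the prescribed diagonal value. *)
Lemma fixalt_diag g : fixalt g (bnum g) =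
  vand g * \prod_(u in upsteps g) \prod_(s in sidesteps g | (s < u)%N)
               (tvar N u.+1 - tvar N s.+1).
Proof.
rewrite vandE upsteps_bord big_imset /=; last by move=> i j _ _; apply: bord_inj.
rewrite -big_split /= /fixalt /alt det_trig.
  apply: eq_bigr => i _; rewrite !mxE /fpow sidesteps_upsteps // upsteps_bord.
  rewrite (big_ord_widen N (fun l => tL N (bnum g i) - tL N l)); last first.
    by rewrite ltnW // bnum_lt.
  rewrite (bigID (mem [set bord g i | i : 'I_m])) /=; congr (_ * _).
    rewrite (eq_bigl (mem [set bord g j | j in [set j : 'I_m | (i < j)%N]])) => [|x].
      rewrite big_imset /=; last by move=> j k _ _; apply: bord_inj.
      by apply: eq_bigl => j; rewrite inE.
    apply/andP/imsetP => [[lt /imsetP [j _ ej]]|[j]].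
      exists j; rewrite // inE ltnNge; apply: contraL lt; rewrite ej /= -leqNgt.
      by rewrite leq_eqVlt => /orP [/eqP/val_inj -> //|/(bnum_anti g)/ltnW].
    by rewrite inE => lt ->; rewrite imset_f // bnum_anti.
  by apply: eq_big => [l|//]; rewrite inE andbC.
apply/is_trig_mxP => i j lt; rewrite !mxE; apply/eqP; rewrite fpow_fix.
exact: bnum_anti.
Qed.

(** Once t_a and t_b are identified, the two fixed points have the same parameters, up to the
    permutation that sorts the new up-steps. *)
Lemma alt_subst a b e e' (d : 'I_m -> nat) (s : 'S_m) :
  (forall i, bord e' i = (if bord e (s i) == a then b else bord e (s i))) ->
  subst a b (fixalt e' d) = (-1) ^+ s * subst a b (fixalt e d).
Proof.
move=> h; have hs e0 : subst a b (fixalt e0 d) =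
    alt (subst a b \o tL N) (subst a b \o (fun j => tL N (bnum e0 j))) d.
  exact: (alt_map (subst a b)).
rewrite [LHS]hs [X in _ = _ * X]hs.
rewrite -(alt_colperm _ (subst a b \o (fun j => tL N (bnum e j)))).
apply: eq_altx => i; rewrite /comp.
rewrite !tL_bord !substX h /collapse.
by case: (eqVneq (bord e (s i)) a) => [_|/negPf -> //]; case: ifP.
Qed.

Lemma subst_fixalt0 a b e (d : 'I_m -> nat) : a != b ->
  a \in upsteps e -> b \in upsteps e -> subst a b (fixalt e d) = 0.
Proof.
rewrite upsteps_bord => ne /imsetP [i _ ei] /imsetP [j _ ej].
rewrite /fixalt alt_map; apply: (@alt_coldup _ _ _ _ _ i j).
  by apply: contraNneq ne => ij; rewrite ei ej ij.
rewrite /= !tL_bord !substX -ei -ej /collapse eqxx.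
by case: ifP.
Qed.

Lemma upstep_pairs e : #|[set ab : 'I_N * 'I_N | (ab.1 \in upsteps e) && (ab.2 < ab.1)%N]|
  = (\sum_i bnum e i)%N.
Proof.
rewrite -sum1_card (eq_bigl (fun ab : 'I_N * 'I_N => (ab.1 \in upsteps e) && (ab.2 < ab.1)%N)).
  rewrite -(pair_big_dep (mem (upsteps e)) (fun a b : 'I_N => (b < a)%N) (fun _ _ => 1%N)) /=.
  rewrite upsteps_bord big_imset /=; last by move=> i j _ _; apply: bord_inj.
  apply: eq_bigr => i _; rewrite -(big_ord_widen N (fun=> 1%N)) ?sum1_card ?card_ord //.
  by rewrite ltnW // bnum_lt.
by move=> ab; rewrite inE.
Qed.

Lemma swap_exists e (a b : 'I_N) : a \in upsteps e -> b \notin upsteps e ->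
  exists s : 'S_m, exists e', 
   (forall i, bord e' i = (if bord e (s i) == a then b else bord e (s i)))
   /\ upsteps e' = b |: (upsteps e :\ a).
Proof.
rewrite upsteps_bord => aU bU.
pose f i := if bord e i == a then b else bord e i.
have inj_f : injective (fun i => val (f i)).
  move=> i j /val_inj; rewrite /f.
  case: (eqVneq _ a) => [ia|na]; case: (eqVneq _ a) => [ja|nb].
  - by move=> _; apply: (@bord_inj e); rewrite ia ja.
  - by move=> ej; case/negP: bU; rewrite ej imset_f.
  - by move=> ei; case/negP: bU; rewrite -ei imset_f.
  - exact: bord_inj.
have [s [e' he']] := bnum_sort inj_f (fun i => ltn_ord (f i)).
have hb i : bord e' i = f (s i) by apply: val_inj; rewrite /= he'.
exists s, e'; split; first by move=> i; rewrite hb.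
apply/setP => c; rewrite upsteps_bord !inE; apply/imsetP/idP => [[i _ ->]|].
  rewrite hb /f; case: (eqVneq _ a) => [_|ne]; first by rewrite eqxx.
  by rewrite ne imset_f // orbT.
case: (eqVneq c b) => [-> _|ne /= /andP [nca /imsetP [i _ ei]]].
  case/imsetP: aU => i _ ei; exists ((s^-1)%g i) => //.
  by rewrite hb permKV /f -ei eqxx.
by exists ((s^-1)%g i) => //; rewrite hb permKV /f -ei (negPf nca).
Qed.

Variable xi : part m N -> part m N -> L.
Hypothesis xiP : schubert_classes xi.

(** Induction on the size of [e]. The difference of the two sides is homogeneous of degree
    [\sum_i bnum g i] and vanishes under t_a = t_b for every up-step a of [e] and every b < a: if b
    is also an up-step, [vand e] and the alternant both vanish; if not, the divisibility condition
    leads to the smaller fixed point where a is replaced by b. There are [\sum_i bnum e i] such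
    pairs, more than the degree when [g] lies strictly inside [e], so the difference is 0. *)
Lemma xi_fixalt g e : vand e * xi g e = fixalt e (bnum g).
Proof.
have [k] := ubnP (psize e); elim: k e => // k IH e; rewrite ltnS => lek.
have [le_ge|nle] := boolP (pincl g e); last first.
  by rewrite (schubert_supp xiP nle) fixalt_supp // mulr0.
have [<-|neq] := eqVneq g e; first by rewrite (schubert_diag xiP) fixalt_diag.
have lt_ge := psize_lt le_ge neq.
apply/eqP; rewrite -subr_eq0; apply/negPn/negP => nz.
set F := _ - _ in nz.
have hF : F \is (\sum_i bnum g i)%N.-homog.
  apply: rpredB; last first.
    by apply: fixalt_homog => i; rewrite ltnW // bnum_lt.
  rewrite psize_bnum addnC; apply: dhomogM; last exact: (schubert_homog xiP).
  by apply: fixalt_homog => i; have := ltn_ord i; lia.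
have := homog_msize nz hF; rewrite psize_bnum => sF.
have := @msize_subst0 N (enum [set ab : 'I_N * 'I_N | (ab.1 \in upsteps e) && (ab.2 < ab.1)%N])
  F (enum_uniq _) _ nz.
rewrite -cardE upstep_pairs sF psize_bnum ltnS leqNgt ltn_add2r lt_ge.
move=> H; suff: ~~ true by [].
apply: H => a b; rewrite mem_enum inE /= => /andP [aU ltba]; split=> //.
have neab : a != b by rewrite -val_eqE gtn_eqF.
have -> : subst a b F = subst a b (vand e) * subst a b (xi g e)
    - subst a b (fixalt e (bnum g)) by rewrite rmorphB rmorphM.
have [bU|bU] := boolP (b \in upsteps e).
  have key (V X A : L) : V = 0 -> A = 0 -> V * X - A = 0.
    by move=> -> ->; rewrite mul0r subrr.
  by apply: key; apply: subst_fixalt0.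
have [s [e' [hs he']]] := swap_exists aU bU.
have [f hf] := schubert_gkm xiP he' g.
have <- : subst a b (xi g e') = subst a b (xi g e).
  apply/eqP; rewrite eq_sym -subr_eq0 -rmorphB hf rmorphM rmorphB /= !tvarE !substX.
  by rewrite /collapse eqxx if_same subrr mul0r.
have : subst a b (vand e' * xi g e') = subst a b (fixalt e' (bnum g)).
  (* Replacing the up-step a by b < a lowers the sum of the up-steps, hence the size. *)
  rewrite IH //; apply: leq_trans lek.
  rewrite -(ltn_add2r (\sum_(i < m) (m - i.+1))%N) -!psize_bnum.
  have sumE e0 : (\sum_i bnum e0 i = \sum_(i in upsteps e0) i)%N.
    by rewrite upsteps_bord big_imset //= => i j _ _; apply: bord_inj.
  rewrite !sumE he' big_setU1 /=; last by rewrite in_setD1 (negPf bU) andbF.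
  by rewrite [X in (_ < X)%N](big_setD1 a) //= ltn_add2r.
have eV : subst a b (vand e') = (-1) ^+ s * subst a b (vand e) by apply: alt_subst.
have eA : subst a b (fixalt e' (bnum g)) = (-1) ^+ s * subst a b (fixalt e (bnum g)).
  exact: alt_subst.
have key (V V' A A' X : L) : V' = (-1) ^+ s * V -> A' = (-1) ^+ s * A ->
    V' * X = A' -> V * X - A = 0.
  by move=> -> ->; rewrite -mulrA => /(can_inj (signrMK s)) ->; rewrite subrr.
by rewrite rmorphM; apply: key eV eA.
Qed.

(** The system is triangular: at the fixed point [nu] only the partitions inside [nu] contribute,
    the smaller ones agree by induction, and [xi nu nu] is nonzero. *)
Lemma structure_constants_unique (c c' : part m N -> part m N -> part m N -> L) l mu :
  structure_constants xi c ->
  (forall e, xi l e * xi mu e = \sum_nu c' l mu nu * xi nu e) ->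
  forall nu, c l mu nu = c' l mu nu.
Proof.
move=> cP c'P nu; have [k] := ubnP (psize nu); elim: k nu => // k IH nu; rewrite ltnS => lek.
have := c'P nu; rewrite (cP l mu nu) => /eqP; rewrite -subr_eq0 -sumrB.
rewrite (bigD1 nu) //= big1 ?addr0 => [|nu' ne].
  rewrite -mulrBl mulf_eq0 subr_eq0 => /orP [/eqP //|].
  have : vand nu * xi nu nu != 0.
    rewrite xi_fixalt /fixalt /alt det_trig.
      by apply/prodf_neq0 => i _; rewrite !mxE fpow_fix ltnn.
    apply/is_trig_mxP => i j lt; rewrite !mxE; apply/eqP; rewrite fpow_fix.
    exact: bnum_anti.
  by rewrite mulf_eq0 => /norP [_ /negPf ->].
have [le|nle] := boolP (pincl nu' nu); last by rewrite (schubert_supp xiP nle) !mulr0 subrr.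
rewrite IH ?subrr //; apply: leq_trans lek.
by apply: psize_lt.
Qed.

End FixedPoints.

(** * From structure constants to products of alternants *)

Section Product.
Variables m N : nat.
Hypothesis le_mN : (m <= N)%N.
Local Notation L := {mpoly int[N]}.
Local Notation U := {mpoly L[m]}.
Local Notation altU := (alt (@tU _ (tL N) m) (@xU L m)).

Lemma eq_altt (R : comNzRingType) (t t' : nat -> R) (x x' : 'I_m -> R) b :
  t =1 t' -> x =1 x' -> alt t x b = alt t' x' b.
Proof.
move=> ht hx; congr (\det _); apply/matrixP => i j; rewrite !mxE hx.
by apply: eq_bigr => l _; rewrite ht.
Qed.

Lemma altspan_part D (a : U) : (D <= N)%N -> altspan (tL N) D a ->
  exists c : part m N -> L, a = \sum_g (c g)%:MP * altU (bnum g).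
Proof.
move=> leDN [d ->].
suff H (b : {ffun 'I_m -> 'I_D}) : exists c : part m N -> L,
    altU (fun i => b i) = \sum_g (c g)%:MP * altU (bnum g).
  have /fin_all_exists [c hc] := H.
  exists (fun g => \sum_b d b * c b g).
  rewrite (eq_bigr _ (fun b _ => congr1 (fun x => (d b)%:MP * x) (hc b))).
  under eq_bigr => b _ do rewrite big_distrr /=.
  rewrite exchange_big /=; apply: eq_bigr => g _.
  rewrite raddf_sum big_distrl /=; apply: eq_bigr => b _.
  by rewrite mpolyCM mulrA.
have [/injectiveP inj_b|/injectivePn [i [j ne e]]] := boolP (injectiveb b); last first.
  exists (fun=> 0); rewrite big1 => [|g _]; last by rewrite mpolyC0 mul0r.
  by apply: (@alt_dup _ _ _ _ _ i j) => //; rewrite e.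
have inj_b' : injective (fun i => val (b i)) by move=> i j /val_inj /inj_b.
have [i|s [g hg]] := bnum_sort (n := N) inj_b'; first exact: leq_trans (ltn_ord _) leDN.
exists (fun h => if h == g then (-1) ^+ s else 0).
rewrite (bigD1 g) //= eqxx big1 ?addr0 => [|h /negPf ->]; last by rewrite mpolyC0 mul0r.
rewrite rmorph_sign (eq_alt _ _ hg) (alt_perm _ _ (fun i => val (b i)) s).
by rewrite signrMK.
Qed.

Variable xi : part m N -> part m N -> L.
Hypothesis xiP : schubert_classes xi.
Variable c : part m N -> part m N -> part m N -> L.
Hypothesis cP : structure_constants xi c.

(** The bound [D + k <= N] ensures that [u] times the generic alternant of [mu] expands in
    alternants of partitions of the rectangle of Gr(m, N). Specialising this expansion to the fixed
    points shows that its coefficients are the structure constants; specialising it through [f] and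
    [x] then carries it to any ring. *)
Lemma product_alt (l mu : part m N) k D (u : U) :
  raising (tL N) k u -> u * altU (fun i => m - i.+1)%N = altU (bnum l) ->
  (forall i, bnum mu i < D)%N -> (D + k <= N)%N ->
  forall (R : comNzRingType) (f : {rmorphism L -> R}) (x : 'I_m -> R),
  exists2 v : R, v * alt (f \o tL N) x (fun i => m - i.+1)%N = alt (f \o tL N) x (bnum l)
   & v * alt (f \o tL N) x (bnum mu) =
     \sum_g f (c l mu g) * alt (f \o tL N) x (bnum g).
Proof.
move=> hu ul hD hDk.
have [c' hc'] := altspan_part hDk (hu _ _ (altspan_alt _ hD)).
have mapU (R : comNzRingType) (f : {rmorphism L -> R}) (x : 'I_m -> R) b :
    mmap f x (altU b) = alt (f \o tL N) x b.
  rewrite (alt_map (mmap f x)); apply: eq_altt => i /=; first by rewrite /tU mmapC.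
  by rewrite /xU mmapX mmap1U.
have mapE (R : comNzRingType) (f : {rmorphism L -> R}) (x : 'I_m -> R) :
    mmap f x u * alt (f \o tL N) x (bnum mu) =
    \sum_g f (c' g) * alt (f \o tL N) x (bnum g).
  rewrite -(mapU _ f x (bnum mu)) -[LHS](rmorphM (mmap f x)) hc' rmorph_sum /=.
  apply: eq_bigr => g _.
  by rewrite rmorphM /= mmapC mapU.
have mapl (R : comNzRingType) (f : {rmorphism L -> R}) (x : 'I_m -> R) :
    mmap f x u * alt (f \o tL N) x (fun i => m - i.+1)%N = alt (f \o tL N) x (bnum l).
  rewrite -(mapU _ f x (bnum l)) -ul rmorphM; congr (_ * _).
  exact: esym (mapU _ f x _).
have cE g : c l mu g = c' g.
  apply: (structure_constants_unique le_mN xiP (c' := fun _ _ => c') (l := l) (mu := mu)) => // e.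
  pose x i := tL N (bnum e i).
  have fixE b : alt (idfun \o tL N) x b = fixalt e b by [].
  have xil : mmap idfun x u = xi l e.
    apply: (mulfI (vand_neq0 le_mN e)).
    by rewrite (xi_fixalt le_mN xiP) mulrC; exact: (mapl _ idfun x).
  have := mapE _ idfun x; rewrite xil fixE -(xi_fixalt le_mN xiP) => h.
  apply: (mulfI (vand_neq0 le_mN e)); rewrite mulrCA h big_distrr /=.
  apply: eq_bigr => g' _; rewrite (fixE (bnum g')) -(xi_fixalt le_mN xiP).
  by rewrite mulrCA.
move=> R f x; exists (mmap f x u); first exact: mapl.
by rewrite mapE; apply: eq_bigr => g _; rewrite cE.
Qed.

End Product.

(** * The quantum relation and rim hooks *)

Section Tensor.

Lemma fpow_map (R R' : comNzRingType) (f : {rmorphism R -> R'}) t x k :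
  f (fpow t x k) = fpow (f \o t) (f x) k.
Proof. by rewrite /fpow rmorph_prod; apply: eq_bigr => l _; rewrite rmorphB. Qed.

(* B is the m-fold tensor power of R[x] / ((x | t)^n - q). *)
Lemma tensor_ring (R : comNzRingType) (t : nat -> R) (q : R) n m : (1 < n)%N ->
  exists (B : comNzRingType) (f : {rmorphism R -> B}) (x : 'I_m -> B),
    (forall j, fpow (f \o t) (x j) n = f q) /\
    forall a : {ffun 'I_m -> 'I_n} -> R,
      \sum_b f (a b) * \prod_j fpow (f \o t) (x j) (b j) = 0 -> forall b, a b = 0.
Proof.
move=> n_gt1; elim: m => [|m [B [f [x [hx free]]]]].
  exists R, idfun, (fun=> 0); split=> [[]//|a h b].
  move: h; rewrite (big_pred1 b) => [|b' /=]; first by rewrite big_ord0 mulr1.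
  by symmetry; apply/eqP/ffunP => -[].
pose P : {poly B} := newt (f \o t) n - (f q)%:P.
have szP : size P = n.+1.
  rewrite /P size_polyDl size_newt // size_polyN size_polyC.
  by case: (f q != 0); lia.
have mP : P \is monic.
  rewrite monicE /P lead_coefDl; first exact: newt_monic.
  rewrite size_newt size_polyN size_polyC.
  by case: (f q != 0); lia.
(* The quotient is taken modulo [mk_monic P], which has a default value when [P] is not monic of
   positive degree. *)
have mkP : mk_monic P = P by rewrite /mk_monic szP mP ltnS ltnW.
pose g : {rmorphism {poly B} -> {poly %/ P}} := in_qpoly P.
pose f' : {rmorphism R -> {poly %/ P}} := g \o (polyC \o f).
pose x' (j : 'I_m.+1) : {poly %/ P} :=
  if unlift ord0 j is Some j' then g (x j')%:P else g 'X.
have fX k : fpow (f' \o t) (g 'X) k = g (newt (f \o t) k).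
  by rewrite /newt /fpow rmorph_prod; apply: eq_bigr => l _; rewrite rmorphB.
have fC k j : fpow (f' \o t) (g (x j)%:P) k = g (fpow (f \o t) (x j) k)%:P.
  by rewrite [in RHS](fpow_map (@polyC B)) (fpow_map g).
exists {poly %/ P}, f', x'; split=> [j|a h].
  rewrite /x'; case: unliftP => [j' _|_]; first by rewrite fC hx.
  have eP : newt (f \o t) n = P + (f q)%:P by rewrite /P subrK.
  rewrite fX eP rmorphD.
  suff -> : g P = 0 by rewrite add0r.
  apply/val_inj; rewrite /= mkP.
  exact: Pdiv.RingMonic.rmodpp mP.
pose cons (k : 'I_n) (b : {ffun 'I_m -> 'I_n}) : {ffun 'I_m.+1 -> 'I_n} :=
  [ffun j => if unlift ord0 j is Some j' then b j' else k].
pose tl (b : {ffun 'I_m.+1 -> 'I_n}) : {ffun 'I_m -> 'I_n} := [ffun j => b (lift ord0 j)].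
have consK (b : {ffun 'I_m.+1 -> 'I_n}) : cons (b ord0) (tl b) = b.
  by apply/ffunP => j; rewrite ffunE; case: unliftP => [j' ->|->] //; rewrite ffunE.
have tlK k (b : {ffun 'I_m -> 'I_n}) : tl (cons k b) = b by apply/ffunP => j; rewrite !ffunE liftK.
have cons0 k (b : {ffun 'I_m -> 'I_n}) : cons k b ord0 = k by rewrite ffunE unlift_none.
(* The part of the relation whose first exponent is [k], a coefficient in the previous ring. A
   polynomial of degree below [n] is 0 as soon as its class is, so [newt_free] kills each [c k], and
   the induction hypothesis applies to it. *)
pose c (k : nat) : B := if insub k is Some k' then
  \sum_(b : {ffun 'I_m -> 'I_n}) f (a (cons k' b)) * \prod_j fpow (f \o t) (x j) (b j) else 0.
have cE (k : 'I_n) : c k = \sum_(b : {ffun 'I_m -> 'I_n}) f (a (cons k b)) * \prod_j fpow (f \o t) (x j) (b j).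
  by rewrite /c valK.
have g0 : g (\sum_(k < n) (c k)%:P * newt (f \o t) k) = 0.
  rewrite -[RHS]h (reindex (fun kb : 'I_n * {ffun 'I_m -> 'I_n} => cons kb.1 kb.2)) /=; last first.
    exists (fun b : {ffun 'I_m.+1 -> 'I_n} => (b ord0, tl b)) => [[k b] _|b _] /=; last exact: consK.
    by rewrite cons0 tlK.
  rewrite -(pair_big xpredT xpredT (fun k (b : {ffun 'I_m -> 'I_n}) => f' (a (cons k b)) *
      \prod_j fpow (f' \o t) (x' j) (cons k b j))) /=.
  rewrite rmorph_sum; apply: eq_bigr => k _.
  rewrite rmorphM cE raddf_sum rmorph_sum big_distrl /=; apply: eq_bigr => b _.
  rewrite big_ord_recl cons0 /x' unlift_none fX polyCM rmorphM.
  rewrite -mulrA; congr (_ * _); rewrite mulrC; congr (_ * _).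
  rewrite rmorph_prod rmorph_prod; apply: eq_bigr => j _.
  by rewrite liftK ffunE liftK fC.
have sz : (size (\sum_(k < n) (c k)%:P * newt (f \o t) k : {poly B})%R < size (mk_monic P))%N.
  rewrite mkP szP ltnS; apply: leq_trans (size_sum _ _ _) _.
  apply/bigmax_leqP => k _; apply: leq_trans (size_polyMleq _ _) _.
  rewrite size_polyC size_newt; have := ltn_ord k; case: (c k != 0) => /=; lia.
have {}g0 : \sum_(k < n) (c k)%:P * newt (f \o t) k = 0.
  by rewrite -(in_qpoly_small sz) -/(g _) g0.
move=> b; rewrite -(consK b).
have := newt_free g0 (b ord0); rewrite cE => /free.
exact.
Qed.

End Tensor.

Lemma lift_lt m (i : 'I_m.+1) (k : 'I_m) : (k < i)%N -> lift i k = k :> nat.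
Proof. by move=> lt; rewrite /= /bump leqNgt lt. Qed.

Lemma lift_ge m (i : 'I_m.+1) (k : 'I_m) : (i <= k)%N -> lift i k = k.+1 :> nat.
Proof. by move=> le; rewrite /= /bump le. Qed.

Section RimHookShape.
Variables (m n N : nat).
Implicit Types g h : part m.+1 N.
Hypothesis n_gt0 : (0 < n)%N.

Lemma pinclP g h : reflect (forall i, (g i <= h i)%N) (pincl g h).
Proof. exact: forallP. Qed.

Lemma in_skew g h (x : 'I_m.+1 * 'I_(N - m.+1)) : (x \in Defs.skew g h) = (h x.1 <= x.2 < g x.1)%N.
Proof. by rewrite inE. Qed.

Lemma skew_box g h i k : (h i <= k < g i)%N ->
  exists j : 'I_(N - m.+1), j = k :> nat /\ (i, j) \in Defs.skew g h.
Proof.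
move=> /andP [le lt]; have ltN := leq_trans lt (part_le g i).
by exists (Ordinal ltN); rewrite in_skew /= le lt.
Qed.

Lemma card_skew g h : #|Defs.skew g h| = (\sum_i (g i - h i))%N.
Proof.
rewrite -sum1_card (eq_bigl (fun x : 'I_m.+1 * 'I_(N - m.+1) =>
  true && (h x.1 <= x.2 < g x.1)%N)) => [|x]; last by rewrite in_skew.
rewrite -(pair_big_dep xpredT (fun (i : 'I_m.+1) (j : 'I_(N - m.+1)) => (h i <= j < g i)%N)
   (fun _ _ => 1%N)) /=.
apply: eq_bigr => i _.
have cg := card_ord_lt (part_le g i); have ch := card_ord_lt (part_le h i).
transitivity #|[set j : 'I_(N - m.+1) | (j < g i)%N] :\: [set j : 'I_(N - m.+1) | (j < h i)%N]|.
  by rewrite -sum1_card; apply: eq_bigl => j; rewrite !inE -leqNgt.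
rewrite cardsD cg; have [le|lt] := leqP (h i) (g i).
  rewrite (setIidPr _) ?ch //; apply/subsetP => j; rewrite !inE => lt.
  exact: leq_trans lt le.
rewrite (setIidPl _) ?cg ?subnn; first by symmetry; apply/eqP; rewrite subn_eq0 ltnW.
by apply/subsetP => j; rewrite !inE => lt'; exact: ltn_trans lt' lt.
Qed.

Lemma psize_skew g h : pincl h g -> psize g = (psize h + #|Defs.skew g h|)%N.
Proof.
move=> /pinclP le; rewrite card_skew /psize -big_split /=; apply: eq_bigr => i _.
by rewrite subnKC.
Qed.

(** The hook occupies consecutive rows [i0], ..., [i1]. Connectedness makes neighbouring rows share
    a column, and the absence of a 2 x 2 square makes it the only one: [bnum g] at one row is
    [bnum h] at the row above. Thus the numbers of [h] are those of [g], with the one of row [i0]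
    lowered by [n] and moved to row [i1]. *)
Lemma rim_hook_shape g h : rim_hook n g h ->
  exists i0 i1 : 'I_m.+1, [/\ (i0 <= i1)%N,
     rim_height g h = (i1 - i0).+1
   & forall i, bnum g i = (bnum h (lift_perm i0 i1 1%g i) + (i == i0) * n)%N].
Proof.
case/and4P => /pinclP le_hg /eqP cS /forall_inP hconn /forall_inP hsq.
have /card_gt0P [x0 x0S] : (0 < #|Defs.skew g h|)%N by rewrite cS.
pose P i := (h i < g i)%N.
have Px0 : P x0.1 by move: x0S; rewrite in_skew => /andP [h1 h2]; apply: leq_ltn_trans h1 h2.
have [i0 Pi0 min_i0] : exists2 i0 : 'I_m.+1, P i0 & forall j : 'I_m.+1, P j -> (i0 <= j)%N.
  by case: (arg_minnP (P := P) (fun i : 'I_m.+1 => i : nat) Px0) => i0 h1 h2; exists i0.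
have [i1 Pi1 max_i1] : exists2 i1 : 'I_m.+1, P i1 & forall j : 'I_m.+1, P j -> (j <= i1)%N.
  by case: (arg_maxnP (P := P) (fun i : 'I_m.+1 => i : nat) Px0) => i1 h1 h2; exists i1.
have box (i : 'I_m.+1) : P i -> exists2 j : 'I_(N - m.+1), j = h i :> nat & (i, j) \in Defs.skew g h.
  by move=> Pi; have [|j [h1 h2]] := @skew_box g h i (h i); [rewrite leqnn|exists j].
have le01 : (i0 <= i1)%N by apply: min_i0.
(* Otherwise no box of row [i] is adjacent to a box of row [i'], and the rows up to [i] form a
   closed set that separates [i0] from [i1]. *)
have cross (i i' : 'I_m.+1) : (i0 <= i)%N -> (i < i1)%N -> i' = i.+1 :> nat -> (h i < g i')%N.
  move=> le0i lti1 ei'; rewrite ltnNge; apply/negP => le_gh.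
  have [j0 _ s0] := box _ Pi0; have [j1 _ s1] := box _ Pi1.
  have /forall_inP /(_ _ s1) := hconn _ s0.
  set e := [rel a b | _] => cn.
  have cl : closed e [pred x : 'I_m.+1 * 'I_(N - m.+1) | (x.1 <= i)%N].
    have bad (a b : 'I_m.+1 * 'I_(N - m.+1)) : a \in Defs.skew g h -> b \in Defs.skew g h ->
        a.2 = b.2 :> nat -> a.1.+1 = b.1 :> nat -> (a.1 <= i)%N -> (b.1 <= i)%N.
      rewrite !in_skew => /andP [ha1 ha2] /andP [hb1 hb2] e2 e1 leai.
      rewrite leqNgt; apply/negP => ltib.
      have ai : a.1 = i by apply: val_inj => /=; lia.
      have bi : b.1 = i' by apply: val_inj => /=; rewrite ei' -e1 ai.
      by rewrite ai in ha1; rewrite bi in hb2; lia.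
    move=> a b /= /and3P [aS bS]; rewrite !inE.
    case/or4P => /andP [/eqP h1 /eqP h2]; rewrite ?h1 //; apply/idP/idP.
    - by apply: bad => //; rewrite h1.
    - by move=> ?; rewrite -ltnS ltnW // h2.
    - by move=> ?; rewrite -ltnS ltnW // h2.
    - by apply: bad => //; rewrite h1.
  by have := closed_connect cl cn; rewrite !inE /= le0i leqNgt lti1.
(* A longer row [i'] would give a 2 x 2 square with corners in columns [h i] and [(h i).+1]. *)
have step (i i' : 'I_m.+1) : (i0 <= i)%N -> (i < i1)%N -> i' = i.+1 :> nat -> g i' = (h i).+1 :> nat.
  move=> le0i lti1 ei'; have lt := cross _ _ le0i lti1 ei'.
  apply/eqP; rewrite eqn_leq lt andbT leqNgt; apply/negP => lt2.
  have le_gg : (g i' <= g i)%N by apply: part_mono; rewrite ei'.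
  have le_hh : (h i' <= h i)%N by apply: part_mono; rewrite ei'.
  have [|j [ej jS]] := @skew_box g h i (h i); first by rewrite leqnn; lia.
  have [|j' [ej' jS']] := @skew_box g h i' (h i).+1; first by lia.
  have /forall_inP /(_ _ jS') := hsq _ jS.
  by rewrite /= ei' ej ej' !eqxx.
have out (i : 'I_m.+1) : ~~ (i0 <= i <= i1)%N -> g i = h i :> nat.
  move=> hi; apply/eqP; rewrite eqn_leq le_hg andbT leqNgt; apply: contra hi => Pi.
  by rewrite (min_i0 i Pi) (max_i1 i Pi).
have inn (i : 'I_m.+1) : (i0 <= i <= i1)%N -> P i.
  move=> /andP [h1 h2]; have [->//|ne] := eqVneq i i1.
  have lt1 : (i < i1)%N by rewrite ltn_neqAle h2 andbT.
  have ltm : (i.+1 < m.+1)%N by have := ltn_ord i1; lia.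
  have := cross i (Ordinal ltm) h1 lt1 erefl; rewrite /P.
  have := part_mono g (i := i) (j := Ordinal ltm) (leqnSn i); lia.
have hne (i : 'I_m.+1) : i != i0 -> bnum g i = bnum h (lift_perm i0 i1 1%g i).
  case: (unliftP i0 i) => [k ->|->]; last by rewrite eqxx.
  move=> _; rewrite lift_perm_lift perm1.
  have [lt_ki0|ge_ki0] := ltnP k i0.
    have e0 := lift_lt lt_ki0; have e1 := lift_lt (leq_trans lt_ki0 le01).
    have -> : lift i1 k = lift i0 k by apply: ord_inj; rewrite e0 e1.
    by rewrite /bnum out // e0 leqNgt lt_ki0.
  have [lt_ki1|ge_ki1] := ltnP k i1; last first.
    have e0 := lift_ge ge_ki0; have e1 := lift_ge ge_ki1.
    have -> : lift i1 k = lift i0 k by apply: ord_inj; rewrite e0 e1.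
    by rewrite /bnum out // e0 [(k.+1 <= i1)%N]ltnNge ge_ki1 andbF.
  have e1 := lift_lt lt_ki1; have e0 := lift_ge ge_ki0.
  rewrite /bnum (step (lift i1 k) (lift i0 k)) ?e0 ?e1 //.
  by have := ltn_ord k; rewrite /=; lia.
exists i0, i1; split=> //.
  have -> : rim_height g h = #|[set i : 'I_m.+1 | (i0 <= i)%N && (i < i1.+1)%N]|.
    rewrite /rim_height; congr #|pred_of_set _|; apply/setP => i; rewrite inE ltnS.
    apply/imsetP/idP => [[x xS ->]|hi].
      have Px : P x.1 by move: xS; rewrite in_skew => /andP [h1 h2]; apply: leq_ltn_trans h1 h2.
      by rewrite (min_i0 _ Px) (max_i1 _ Px).
    by have [j _ jS] := box _ (inn _ hi); exists (i, j).
  have -> : [set i : 'I_m.+1 | (i0 <= i)%N && (i < i1.+1)%N] =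
      [set i : 'I_m.+1 | (i < i1.+1)%N] :\: [set i : 'I_m.+1 | (i < i0)%N].
    by apply/setP => i; rewrite !inE -leqNgt.
  rewrite cardsD (setIidPr _) ?card_ord_lt ?subSn // 1?ltnW //.
  apply/subsetP => i; rewrite !inE; lia.
move=> i; have [->|ne] := eqVneq i i0; last by rewrite mul0n addn0 hne.
rewrite mul1n.
(* Only row [i0] remains, and the total number of boxes forces its value. *)
have := psize_skew (introT (pinclP _ _) le_hg); rewrite cS => e.
have : (\sum_i bnum g i = \sum_i bnum h i + n)%N by rewrite !psize_bnum e addnAC.
rewrite (bigD1 i0) //= [in RHS](reindex_inj (@perm_inj _ (lift_perm i0 i1 1%g))) /=.
rewrite [in RHS](bigD1 i0) //= (eq_bigr _ hne) => /eqP.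
by rewrite addnAC eqn_add2r => /eqP.
Qed.

(** The converse move: lower the largest number by [n] and sort again. The lowered number [b] lands
    in row [i1], the last one whose number exceeds [b], and the numbers of the rows below the first
    one, down to [i1], move up by one place. *)
Lemma rim_hook_exists g : (m.+1 <= N)%N -> (n <= bnum g ord0)%N ->
  (forall i, bnum g i != (bnum g ord0 - n)%N) -> exists h, rim_hook n g h.
Proof.
move=> le_mN le_n hb; pose b := (bnum g ord0 - n)%N.
pose S := [set i : 'I_m.+1 | (b < bnum g i)%N].
have Sdown (i i' : 'I_m.+1) : (i <= i')%N -> i' \in S -> i \in S.
  rewrite !inE => le lt; apply: leq_trans lt _.
  by move: le; rewrite leq_eqVlt => /orP [/eqP/val_inj -> //|/(bnum_anti g)/ltnW].
have S0 : ord0 \in S by rewrite inE /b; lia.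
have cS : (0 < #|S| <= m.+1)%N.
  by rewrite card_gt0 -[X in _ && (_ <= X)%N](card_ord m.+1) max_card andbT; apply/set0Pn; exists ord0.
have lt_i1 : (#|S|.-1 < m.+1)%N by lia.
have [i1 ei1] : exists i1 : 'I_m.+1, i1 = #|S|.-1 :> nat by exists (Ordinal lt_i1).
have inS (i : 'I_m.+1) : (b < bnum g i)%N = (i <= i1)%N.
  by rewrite ei1; have := mem_downset Sdown i; rewrite inE => ->; case: #|S| cS => [|s] //.
pose b' (i : 'I_m.+1) := if (i < i1)%N then bnum g (inord i.+1)
    else if i == i1 then b else bnum g i.
have anti (i j : 'I_m.+1) : (i < j)%N -> (bnum g j < bnum g i)%N by apply: bnum_anti.
have nxt (i : 'I_m.+1) : (i < i1)%N -> (inord i.+1 : 'I_m.+1) = i.+1 :> nat.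
  by move=> lt; rewrite inordK //; have := ltn_ord i1; lia.
have gtb (i : 'I_m.+1) : (i1 < i)%N -> (bnum g i < b)%N.
  by move=> lt; have := inS i; have := hb i; rewrite -/b; lia.
have le_b' i : (b' i <= bnum g i)%N.
  rewrite /b'; case: ifP => [lt|_]; first by rewrite ltnW // anti // nxt.
  by case: eqP => // ->; rewrite ltnW // inS.
have [||h hh] := bnum_exists (n := N) (b := b').
- move=> i j lt; rewrite /b'; case: (ltnP j i1) => [ltj|lej].
    by rewrite (ltn_trans lt ltj) anti // !nxt ?ltnS // (ltn_trans lt ltj).
  case: (ltnP i i1) => [lti|lei].
    case: (eqVneq j i1) => [_|ne]; first by rewrite inS nxt.
    apply: anti; rewrite nxt //.
    have : (i1 : nat) != j by rewrite eq_sym val_eqE.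
    lia.
  have -> : (j == i1) = false by apply/eqP => ej; move: lt; rewrite ej; lia.
  case: (eqVneq i i1) => [ei|_]; last exact: anti.
  by apply: gtb; rewrite -ei.
- move=> i; apply: leq_ltn_trans (le_b' i) _.
  exact: bnum_lt.
have hE (i : 'I_m.+1) : (i < i1)%N -> g (inord i.+1) = (h i).+1 :> nat.
  by move=> lt; have := hh i; rewrite /b' lt /bnum nxt //; have := ltn_ord i1; lia.
have hlt (i : 'I_m.+1) : (i <= i1)%N -> (h i < g i)%N.
  move=> le; have := hh i; rewrite /b'; case: ifP => [lt|ge].
    by have := hE i lt; have := @part_mono _ _ g i (inord i.+1); rewrite nxt //; lia.
  have -> : i = i1 by apply: val_inj => /=; lia.
  by rewrite eqxx; have := inS i1; rewrite /bnum; lia.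
have hout (i : 'I_m.+1) : (i1 < i)%N -> h i = g i :> nat.
  move=> lt; have := hh i; rewrite /b' ltnNge (ltnW lt) /=.
  have -> : (i == i1) = false by apply/eqP => ej; move: lt; rewrite ej; lia.
  by rewrite /bnum; lia.
have le_hg (i : 'I_m.+1) : (h i <= g i)%N.
  by have := le_b' i; rewrite -hh /bnum; lia.
have row (i : 'I_m.+1) (j : 'I_(N - m.+1)) : (i, j) \in Defs.skew g h -> (i <= i1)%N.
  rewrite in_skew /= => h1; rewrite leqNgt; apply/negP => /hout; lia.
exists h; apply/and4P; split.
- exact/pinclP.
- have shift (i : 'I_m.+1) : i != ord0 -> bnum g i = bnum h (lift_perm ord0 i1 1%g i).
    case: (unliftP ord0 i) => [k ->|->]; last by rewrite eqxx.
    move=> _; rewrite lift_perm_lift perm1 hh /b'.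
    have e0 : lift ord0 k = k.+1 :> nat by rewrite /= /bump.
    case: ltnP => [lt|le].
      have e1 : lift i1 k = k :> nat by move: lt; rewrite /= /bump; lia.
      by congr bnum; apply: ord_inj; rewrite e0 e1 inordK //; have := ltn_ord k; rewrite /=; lia.
    have -> : (lift i1 k == i1) = false by apply/eqP => /esym /eqP; rewrite (negPf (neq_lift _ _)).
    by congr bnum; apply: ord_inj; rewrite e0; move: le; rewrite /= /bump; lia.
  have := psize_skew (introT (pinclP _ _) le_hg).
  have : (\sum_i bnum g i = \sum_i bnum h i + n)%N.
    rewrite (bigD1 ord0) //= [in RHS](reindex_inj (@perm_inj _ (lift_perm ord0 i1 1%g))) /=.
    rewrite [in RHS](bigD1 ord0) //= (eq_bigr _ shift) addnAC; congr (_ + _)%N.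
    by rewrite lift_perm_id hh /b' ltnn eqxx subnK.
  rewrite !psize_bnum addnAC => /addIn -> /addnI <-; exact: eqxx.
- set e := [rel a b | _].
  have sym_e : ssrbool.symmetric e.
    move=> x y; rewrite /= andbCA; do 2 congr (_ && _).
    rewrite /adjbox [y.1 == x.1]eq_sym [y.2 == x.2]eq_sym.
    by rewrite orbCA; do 2 congr (_ || _); rewrite orbC.
  have csym := sym_connect_sym sym_e.
  have walk (d : nat) : forall i (j j' : 'I_(N - m.+1)), (i, j) \in Defs.skew g h -> (i, j') \in Defs.skew g h ->
      j' = (j + d)%N :> nat -> connect e (i, j) (i, j').
    elim: d => [|d IH] i j j' jS j'S ej.
      by rewrite (_ : j' = j) //; apply: val_inj; rewrite /= ej addn0.
    have ltd : (j + d < N - m.+1)%N by have := ltn_ord j'; lia.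
    have dS : (i, Ordinal ltd) \in Defs.skew g h by move: jS j'S; rewrite !in_skew /=; lia.
    apply: connect_trans (IH i j (Ordinal ltd) jS dS erefl) (connect1 _).
    by rewrite /= dS j'S /adjbox /= eqxx ej addnS eqxx.
  (* Every box is joined to the first box of the top row, going down row by row: by [hE], the last
     box of a row lies just below the first box of the row above. *)
  have [j0 [ej0 j0S]] : exists j : 'I_(N - m.+1), j = h ord0 :> nat /\ (ord0, j) \in Defs.skew g h.
    by apply: skew_box; rewrite leqnn hlt.
  have all_conn k : forall (i : 'I_m.+1) j, i = k :> nat -> (i, j) \in Defs.skew g h ->
      connect e (ord0, j0) (i, j).
    elim: k => [|k IH] i j ei ijS.
      have i0 : i = ord0 by apply: val_inj.
      rewrite i0 in ijS *; apply: (walk (j - j0)%N) => //.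
      by move: ijS; rewrite in_skew /= ej0 => /andP [le _]; rewrite subnKC.
    have lei := row _ _ ijS.
    have ltk : (k < m.+1)%N by have := ltn_ord i; lia.
    pose i' := Ordinal ltk; have lt' : (i' < i1)%N by rewrite /=; lia.
    have [|j' [ej' j'S]] := @skew_box g h i' (h i'); first by rewrite leqnn hlt // ltnW.
    have ei' : inord i'.+1 = i by apply: val_inj; rewrite /= inordK // -ei.
    have gi := hE _ lt'; rewrite ei' in gi.
    have ij'S : (i, j') \in Defs.skew g h.
      rewrite in_skew /= ej' gi ltnSn andbT.
      by have := @part_mono _ _ h i' i; rewrite /= ei => /(_ (leqnSn k)).
    apply: connect_trans (IH i' j' erefl j'S) _.
    apply: (@connect_trans _ _ (i, j')).
      by apply: connect1; rewrite /= j'S ij'S /adjbox /= eqxx ei !eqxx /= !orbT.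
    rewrite csym; apply: (walk (j' - j)%N) => //.
    by move: ijS; rewrite in_skew /= gi ej' => /andP [_ lt2]; rewrite subnKC.
  apply/forall_inP => -[i j] xS; apply/forall_inP => -[i' j'] yS.
  by apply: connect_trans (all_conn _ _ _ erefl yS); rewrite csym; apply: all_conn.
- apply/forall_inP => -[i j] xS; apply/forall_inP => -[i' j'] yS /=.
  apply/negP => /andP [/eqP e1 /eqP e2].
  have le1 := row _ _ yS; have lt1 : (i < i1)%N by lia.
  have := hE i lt1; have -> : inord i.+1 = i' by apply: val_inj; rewrite /= nxt.
  by move: xS yS; rewrite !in_skew /=; lia.
Qed.

End RimHookShape.

(** * Evaluation of quantum classes as alternants *)

Section Evaluation.
Variables (m n : nat) (B : comNzRingType) (F : {rmorphism {poly {mpoly int[n]}} -> B}).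
Variables (t : nat -> B) (x : 'I_m -> B).

(* The additive map that sends sigma g to the alternant of g; it is injective when B is the
   ring of tensor_ring. *)
Definition ev (a : QH m n) : B := \sum_g F (a g) * alt t x (bnum g).

Lemma evD a b : ev (a + b) = ev a + ev b.
Proof.
rewrite /ev -big_split; apply: eq_bigr => g _.
by rewrite ffunE rmorphD mulrDl.
Qed.

Lemma ev0 : ev 0 = 0.
Proof. by rewrite /ev big1 // => g _; rewrite ffunE rmorph0 mul0r. Qed.

Lemma ev_sum (I : finType) (P : pred I) (a : I -> QH m n) :
  ev (\sum_(i | P i) a i) = \sum_(i | P i) ev (a i).
Proof. exact: (big_morph ev evD ev0). Qed.

Lemma evZ c a : ev (c *: a) = F c * ev a.
Proof.
rewrite /ev big_distrr; apply: eq_bigr => g _ /=.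
by rewrite ffunE mulrA -rmorphM.
Qed.

Lemma ev_sigma g : ev (sigma g) = alt t x (bnum g).
Proof.
rewrite /ev (bigD1 g) //= ffunE eqxx rmorph1 mul1r big1 ?addr0 // => h /negPf ne.
by rewrite ffunE ne rmorph0 mul0r.
Qed.

(** The expanded alternants give monomials indexed by a partition [h] and a permutation [s]. By
    [bnum_perm], only [h = g] and [s = 1] produce the exponents of [g] in decreasing order, so the
    coefficient of that monomial is [a g]. *)
Lemma ev_inj : (m <= n)%N ->
  (forall a : {ffun 'I_m -> 'I_n} -> {poly {mpoly int[n]}},
      \sum_b F (a b) * \prod_j fpow t (x j) (b j) = 0 -> forall b, a b = 0) ->
  injective ev.
Proof.
move=> le_mn free; suff ev_eq0 a : ev a = 0 -> a = 0.
  move=> a b e; apply/subr0_eq/ev_eq0.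
  by rewrite evD -scaleN1r evZ rmorphN1 mulN1r e subrr.
move=> e; apply/ffunP => g; rewrite ffunE.
pose bf (h : part m n) (s : 'S_m) : {ffun 'I_m -> 'I_n} := [ffun j => bord le_mn h ((s^-1)%g j)].
pose d (b : {ffun 'I_m -> 'I_n}) := \sum_h \sum_(s : 'S_m) if bf h s == b then (-1) ^+ s * a h else 0.
have dE : d (bf g 1%g) = a g.
  rewrite /d (bigD1 g) //= (bigD1 1%g) //= eqxx odd_perm1 mul1r.
  rewrite !big1 ?addr0 //= => [h ne|s ne].
    rewrite big1 // => s _; case: eqP => // /ffunP eh.
    case/eqP: ne; symmetry; have [] // := @bnum_perm m n g h (s^-1)%g _.
    by move=> i; have := congr1 val (eh i); rewrite !ffunE /= invg1 perm1 => ->.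
  case: eqP => // /ffunP eh; case/eqP: ne.
  have [|s1 _] := @bnum_perm m n g g (s^-1)%g.
    by move=> i; have := congr1 val (eh i); rewrite !ffunE /= invg1 perm1 => ->.
  by apply: (can_inj (@invgK _)); rewrite s1 invg1.
rewrite -dE; apply: free; rewrite -[RHS]e /ev.
transitivity (\sum_h \sum_(s : 'S_m) F ((-1) ^+ s * a h) *
    \prod_j fpow t (x j) (bf h s j)).
  under eq_bigr => b _ do rewrite /d rmorph_sum big_distrl /=.
  rewrite exchange_big /=; apply: eq_bigr => h _.
  under eq_bigr => b _ do rewrite rmorph_sum big_distrl /=.
  rewrite exchange_big /=; apply: eq_bigr => s _.
  rewrite (bigD1 (bf h s)) //= eqxx [X in _ + X]big1 ?addr0 // => b ne.
  by rewrite eq_sym (negPf ne) rmorph0 mul0r.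
apply: eq_bigr => h _; rewrite /alt /determinant big_distrr /=.
apply: eq_bigr => s _; rewrite rmorphM rmorph_sign mulrCA -!mulrA; congr (_ * (_ * _)).
rewrite (reindex_inj (@perm_inj _ s)) /=; apply: eq_bigr => i _.
by rewrite mxE ffunE permK.
Qed.

End Evaluation.

Lemma alt_period (R : comNzRingType) (t : nat -> R) m (x : 'I_m -> R) n (Q : R)
    (b : 'I_m -> nat) i0 :
  (forall k j, fpow t (x j) (k + n) = Q * fpow t (x j) k) ->
  alt t x (fun i => b i + (i == i0) * n)%N = Q * alt t x b.
Proof.
case: m x b i0 => [|m] x b i0 per; first by case: i0.
rewrite /alt (@determinant_multilinear _ _ _ (\matrix_(i, j) fpow t (x j) (b i))
   (\matrix_(i, j) fpow t (x j) (b i)) i0 Q 0).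
- by rewrite mul0r addr0.
- by apply/rowP => j; rewrite !mxE eqxx mul1n mul0r addr0 per.
- by apply/matrixP => i j; rewrite !mxE eq_sym (negPf (neq_lift _ _)) mul0n addn0.
- by apply/matrixP => i j; rewrite !mxE eq_sym (negPf (neq_lift _ _)) mul0n addn0.
Qed.

Section RimHookRule.
Variables (m n : nat) (B : comNzRingType) (F : {rmorphism {poly {mpoly int[n]}} -> B}).
Variables (t : nat -> B) (x : 'I_m.+1 -> B).
Hypothesis m_lt : (m.+1 < n)%N.
Hypothesis per : forall k j, fpow t (x j) (k + n) = (-1) ^+ m * F 'X * fpow t (x j) k.

(** The permutation of [rim_hook_shape] has sign (-1)^(i0 + i1) and the relation brings (-1)^m. As
    the height is i1 - i0 + 1 and there are m + 1 rows, the product is the sign of the rim hook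
    rule. *)
Lemma alt_rim_hook N (g h : part m.+1 N) : rim_hook n g h ->
  alt t x (bnum g) = (-1) ^+ (m.+1 - rim_height g h) * F 'X * alt t x (bnum h).
Proof.
have n_gt0 : (0 < n)%N by apply: leq_trans m_lt.
case/(rim_hook_shape n_gt0) => i0 [i1 [le01 -> hb]].
rewrite (eq_alt _ _ hb) (alt_period (fun i => bnum h (lift_perm i0 i1 1%g i)) i0 per).
rewrite alt_perm odd_lift_perm odd_perm1 addbF mulrA [_ * F 'X * _]mulrAC; congr (_ * _ * _).
have sgn_odd a b : odd a = odd b -> (-1) ^+ a = (-1) ^+ b :> B.
  by move=> e; rewrite -signr_odd e signr_odd.
transitivity ((-1) ^+ (m + (i0 + i1)) : B).
  by rewrite !exprD; congr (_ * _); rewrite signr_addb !signr_odd.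
apply: sgn_odd; have := ltn_ord i1; rewrite subSS => lt.
rewrite oddB; last by lia.
by rewrite oddB // !oddD; case: (odd m); case: (odd i0); case: (odd i1).
Qed.

(** By [rim_hook_exists], the largest exponent lowered by [n] must already be present; after
    reduction two rows are equal. *)
Lemma alt_core0 N (g : part m.+1 N) : (m.+1 <= N)%N -> (n <= bnum g ord0)%N ->
  (forall h, ~~ rim_hook n g h) -> alt t x (bnum g) = 0.
Proof.
move=> le_mN le_n nh.
have [/existsP [i /eqP ei]|] := boolP [exists i, bnum g i == (bnum g ord0 - n)%N]; last first.
  rewrite negb_exists => /forallP h.
  have n_gt0 : (0 < n)%N by apply: leq_trans m_lt.
  by have [h' hh'] := rim_hook_exists n_gt0 le_mN le_n h; have := nh h'; rewrite hh'.
have ne : i != ord0.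
  by apply/eqP => e; move: ei m_lt; rewrite e; lia.
have e : bnum g =1 (fun i' => (if i' == ord0 then bnum g i else bnum g i') + (i' == ord0) * n)%N.
  by move=> i'; case: (eqVneq i' ord0) => [->|_]; rewrite ?mul1n ?ei ?subnK ?mul0n ?addn0.
rewrite (eq_alt _ _ e) (alt_period _ _ per) (@alt_dup _ _ _ _ _ i ord0) ?mulr0 //.
by rewrite (negPf ne) eqxx.
Qed.

(** The product of the accumulated factor and the current alternant is invariant, whichever hook
    [pick] returns. Each removal lowers the size by [n], which is positive, so a fuel of [psize g]
    exhausts the hooks. *)
Lemma rim_reduce_alt N fuel (g : part m.+1 N) :
  let: (s, core) := rim_reduce n fuel g in
  alt t x (bnum g) = F s * alt t x (bnum core) /\
  ((psize g <= fuel)%N -> forall h, ~~ rim_hook n core h).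
Proof.
have n_gt0 : (0 < n)%N by apply: leq_trans m_lt.
have hook_size (g1 h1 : part m.+1 N) : rim_hook n g1 h1 -> psize g1 = (psize h1 + n)%N.
  by case/and4P => le /eqP <- _ _; apply: psize_skew.
elim: fuel g => [|fuel IH] g /=.
  rewrite rmorph1 mul1r; split=> // + h; rewrite leqn0 => /eqP g0.
  by apply/negP => /hook_size; rewrite g0; lia.
case: pickP => [h hh|nh]; last first.
  by rewrite rmorph1 mul1r; split=> // _ h; rewrite nh.
have := IH h; case: (rim_reduce n fuel h) => s core [IH1 IH2]; split.
  by rewrite (alt_rim_hook hh) IH1 !rmorphM rmorph_sign mulrA.
by move=> le; apply: IH2; have := hook_size _ _ hh; lia.
Qed.

(** When the last partition does not fit in the small rectangle, [phi_class] is 0 by definition; its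
    first exponent is then at least [n], and [alt_core0] gives the same value. *)
Lemma ev_phi_class (g : part m.+1 (2 * n - 1)) :
  ev F t x (phi_class g) = alt t x (bnum g).
Proof.
have := rim_reduce_alt (psize g) g; rewrite /phi_class /rim_core.
case: (rim_reduce n (psize g) g) => s core [-> /(_ (leqnn _)) nh].
case: pickP => [nu /eqP <-|nn]; last first.
  rewrite ev0 alt_core0 ?mulr0 //; first by lia.
  rewrite leqNgt; apply/negP => lt.
  have [||nu hnu] := @part_exists m.+1 n (fun i => core i).
  - exact: part_mono.
  - move=> i; have := part_mono core (leq0n i : (ord0 <= i)%N).
    by move: lt; rewrite /bnum /=; lia.
  have := nn nu; rewrite (_ : pwiden nu = core) ?eqxx //.
  by apply: part_ext => i; rewrite -hnu /= ffunE.
rewrite evZ ev_sigma; congr (_ * _); apply: eq_alt => i.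
by rewrite bnum_pwiden.
Qed.

End RimHookRule.

(** * Complementary minors *)

Section Complement.
Variables (R : comNzRingType) (t : nat -> R) (m K : nat) (x : 'I_m -> R) (Q : R).

Definition ucol (s : nat) (i : 'I_(m + K)) : R := (i == s :> nat)%:R.

(** A side-step moves down by one; step 0 wraps around to the last one, with the factor [Q] of the
    quantum relation. *)
Definition dcol (s : nat) (i : 'I_(m + K)) : R :=
  if s is s'.+1 then ucol s' i else Q * ucol (m + K).-1 i.

Definition cmx (w : 'I_K -> 'I_(m + K) -> R) : 'M[R]_(m + K) :=
  \matrix_(i, j) match split j with inl a => fpow t (x a) i | inr b => w b i end.

(* Up to a sign, the alternant whose exponents form the complement of w. *)
Definition calt (w : 'I_K -> nat) : R := \det (cmx (fun b => ucol (w b))).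

Definition cmove (w : 'I_K -> nat) (J : {set 'I_K}) : R :=
  \det (cmx (fun b => if b \in J then dcol (w b) else ucol (w b))).

(* The matrix z - X of multiplication by z - x on R[x] / ((x | t)^(m+K) - Q). *)
Definition zmx : 'M[{poly R}]_(m + K) :=
  \matrix_(i, k) (('X - (t i)%:P) * (k == i :> nat)%:R - (k == i.+1 :> nat)%:R
     - Q%:P * (i.+1 == m + K)%N%:R * (k == 0%N :> nat)%:R).

Hypothesis xQ : forall j, fpow t (x j) (m + K) = Q.

Lemma split_lshift (a : 'I_m) : split (lshift K a) = inl a.
Proof. exact: (unsplitK (inl _ a)). Qed.

Lemma split_rshift (b : 'I_K) : split (rshift m b) = inr b.
Proof. exact: (unsplitK (inr _ b)). Qed.

Lemma sum_eq_ord (S : comNzRingType) N (G : 'I_N -> S) (s : nat) :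
  \sum_(k < N) (k == s :> nat)%:R * G k = if insub s is Some k then G k else 0.
Proof.
case: insubP => [k _ ek|nlt].
  rewrite (bigD1 k) //= ek eqxx mul1r big1 ?addr0 // => l ne.
  by rewrite -ek -[_ == _ :> nat]/(l == k) (negPf ne) mul0r.
rewrite big1 // => k _; case: eqP => [e|_]; last by rewrite mul0r.
by rewrite -e ltn_ord in nlt.
Qed.

Lemma zmx_mul (i : 'I_(m + K)) (G : nat -> {poly R}) :
  \sum_k zmx i k * G k = ('X - (t i)%:P) * G i - (i.+1 < m + K)%N%:R * G i.+1
    - Q%:P * (i.+1 == m + K)%N%:R * G 0%N.
Proof.
have n_gt0 : (0 < m + K)%N by apply: leq_ltn_trans (ltn_ord i).
under eq_bigr => k _ do rewrite mxE !mulrBl -!mulrA.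
rewrite !sumrB -!big_distrr /= !(sum_eq_ord (fun k : 'I_(m + K) => G k)) valK.
rewrite -!mulrA; congr (_ - _ - _ * (_ * _)).
- by rewrite mulrBl.
- by case: ltnP => lt; [rewrite insubT mul1r|rewrite insubF ?mul0r // ltnNge lt].
by rewrite insubT.
Qed.

(** The matrix [zmx] multiplies the column of powers of [x a] by ['X - x a], and sends the unit
    column of step [w b] to ['X - t (w b)] times itself minus [dcol (w b)]. The left side expands
    the determinant along the unit columns. *)
Lemma calt_mulE (w : 'I_K -> nat) : (forall b, w b < m + K)%N ->
  charE x * (\sum_(J : {set 'I_K}) ((-1) ^+ #|J| * cmove w J)%:P *
      \prod_(b | b \notin J) ('X - (t (w b))%:P)) = \det zmx * (calt w)%:P.
Proof.
move=> lt_w; rewrite /calt -det_map_mx -det_mulmx.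
pose dl (j : 'I_(m + K)) : {poly R} := match split j with inl a => 'X - (x a)%:P | inr _ => 1 end.
pose al (j : 'I_(m + K)) : {poly R} :=
  match split j with inl _ => 1 | inr b => 'X - (t (w b))%:P end.
pose be (j : 'I_(m + K)) : {poly R} := match split j with inl _ => 0 | inr b => -1 end.
pose A : 'M[{poly R}]_(m + K) := map_mx polyC (cmx (fun b => ucol (w b)))^T.
pose C : 'M[{poly R}]_(m + K) := map_mx polyC (cmx (fun b => dcol (w b)))^T.
have -> : zmx *m map_mx polyC (cmx (fun b => ucol (w b))) =
    (\matrix_(j, i) (al j * A j i + be j * C j i))^T *m diag_mx (\row_j dl j).
  apply/matrixP => i j; rewrite mul_mx_diag !mxE /al /be /dl.
  case: (splitP j) => a ej.
    rewrite (eq_bigr (fun k : 'I__ => zmx i k * (fpow t (x a) k)%:P)) => [|k _]; last first.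
      by rewrite !mxE (_ : j = lshift K a) ?split_lshift //; apply: val_inj.
    rewrite (zmx_mul i (fun k => (fpow t (x a) k)%:P)).
    rewrite fpow0 mul1r mul0r addr0 mulr1.
    have := ltn_ord i; rewrite leq_eqVlt => /orP [/eqP ei|lt].
      (* In the last row, the power of exponent [m + K] is replaced by [Q] through the relation. *)
      have hQ : Q = fpow t (x a) i * (x a - t i) by rewrite -fpowS ei xQ.
      rewrite ei eqxx ltnn mul0r subr0 mulr1 [in Q%:P]hQ polyCM polyCB.
      by ring.
    by rewrite lt (ltn_eqF lt) mulr0 subr0 mul1r fpowS polyCM polyCB; ring.
  rewrite (eq_bigr (fun k : 'I__ => zmx i k * ((k == w a :> nat)%:R)%:P)) => [|k _]; last first.
    by rewrite !mxE (_ : j = rshift m a) ?split_rshift //; apply: val_inj.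
  rewrite (zmx_mul i (fun k => ((k == w a)%:R)%:P)).
  rewrite mulr1 /ucol.
  have -> : ('X - (t i)%:P) * ((i == w a :> nat)%:R)%:P =
     ('X - (t (w a))%:P) * ((i == w a :> nat)%:R)%:P.
    by case: eqP => [->|_] //; rewrite polyC0 !mulr0.
  rewrite -addrA; congr (_ + _); have := lt_w a; rewrite /dcol /ucol.
  case: (w a) => [_|s lts].
    rewrite polyC0 mulr0 polyC1 mulr1 oppr0 add0r mulN1r; congr (- _).
    rewrite polyCM; congr (_ * _); rewrite -polyC_natr; congr (_ %:R)%:P.
    by have := ltn_ord i; lia.
  rewrite polyC0 mulr0 subr0 mulN1r; congr (- _); rewrite eqSS.
  case: (eqVneq (i : nat) s) => [->|_]; last by rewrite polyC0 mulr0.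
  by rewrite lts mul1r.
rewrite det_mulmx det_tr det_diag mulrC.
have -> : \prod_j (\row_j0 dl j0) 0 j = charE x.
  rewrite big_split_ord /= [X in _ * X]big1 ?mulr1 => [|b _].
    by apply: eq_bigr => a _; rewrite mxE /dl split_lshift.
  by rewrite mxE /dl split_rshift.
congr (_ * _); rewrite det_row_expand.
(* A set that meets the columns of powers contributes 0, because [be] vanishes there; the other sets
   come from subsets of ['I_K]. *)
rewrite (bigID (fun J : {set 'I_(m + K)} => [forall a : 'I_m, lshift K a \notin J])) /=.
rewrite [X in _ = _ + X]big1 ?addr0 => [|J]; last first.
  rewrite negb_forall => /existsP [a]; rewrite negbK => aJ.
  by rewrite (bigD1 (lshift K a)) //= aJ /be split_lshift !mul0r.
rewrite (reindex_onto (fun J : {set 'I_K} => [set rshift m b | b in J])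
  (fun J : {set 'I_(m + K)} => [set b | rshift m b \in J])) /=; last first.
  move=> J /forallP hJ; apply/setP => j; apply/imsetP/idP => [[b]|jJ].
    by rewrite inE => bJ ->.
  case: (splitP j) => [a ej|b ej].
    by have := hJ a; rewrite (_ : lshift K a = j) ?jJ //; apply: val_inj.
  have e : j = rshift m b by apply: val_inj.
  by exists b => //; rewrite inE -e.
have memr (J : {set 'I_K}) b : (rshift m b \in [set rshift m b | b in J]) = (b \in J).
  by rewrite mem_imset //; apply: rshift_inj.
have meml (J : {set 'I_K}) a : (lshift K a \in [set rshift m b | b in J]) = false.
  apply/imsetP => -[b _ /(congr1 val) /=]; have := ltn_ord a; lia.
apply: eq_big => [J|J _].
  symmetry; apply/andP; split; first by apply/forallP => a; rewrite meml.
  by apply/eqP/setP => b; rewrite inE memr.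
have -> : \prod_(i < m + K) (if i \in [set rshift m b | b in J] then be i else al i) =
    \prod_(b < K) (if b \in J then -1 else 'X - (t (w b))%:P).
  rewrite big_split_ord /= big1 ?mul1r => [|a _]; last by rewrite meml /al split_lshift.
  by apply: eq_bigr => b _; rewrite memr /al /be split_rshift.
have -> : \prod_(b < K) (if b \in J then -1 else 'X - (t (w b))%:P) =
    ((-1) ^+ #|J|)%:P * \prod_(b | b \notin J) ('X - (t (w b))%:P) :> {poly R}.
  rewrite (bigID (mem J)) /=; congr (_ * _); last by apply: eq_bigr => b /negPf ->.
  rewrite polyC_exp polyCN polyC1 -prodr_const.
  by apply: eq_bigr => i ->.
rewrite polyCM mulrAC; congr (_ * _).
rewrite /cmove -det_tr -det_map_mx; congr (\det _); apply/matrixP => j i.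
case: (split_ordP j) => a ->; rewrite !mxE ?meml ?memr ?split_lshift ?split_rshift //.
by case: ifP.
Qed.

Lemma cmx_coldup (W : 'I_K -> 'I_(m + K) -> R) b b' : b != b' -> W b =1 W b' ->
  \det (cmx W) = 0.
Proof.
move=> ne e; rewrite -det_tr; apply: (@determinant_alternate _ _ _ (rshift m b) (rshift m b')).
  by apply: contra ne => /eqP/rshift_inj ->.
by move=> i; rewrite !mxE !split_rshift e.
Qed.

Lemma eq_cmx W W' : (forall b, W b =1 W' b) -> \det (cmx W) = \det (cmx W').
Proof.
move=> e; congr (\det _); apply/matrixP => i j; rewrite !mxE.
by case: (split j) => // b; rewrite e.
Qed.

Hypothesis m_gt0 : (0 < m)%N.

(** The side-steps of the empty partition are [m + b], and [t (m + b) = tau (K - b.+1)], the order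
    required by [newton_initial_sum]. *)
Let tau c := t (m + K - c.+1)%N.

(** For the empty partition, [hrow] and [calt_mulE] show that [\det zmx] acts on [calt] as
    [charE x * S1], with [S1] the generating polynomial of the [hcoef]. Multiplied by [s] this
    carries over to [w]; cancelling [charE x] in [calt_mulE] leaves an identity from which
    [newton_extract] reads the coefficients. *)
Lemma hcoef_calt (w : 'I_K -> nat) (s : R) :
  (forall k : nat, (k <= K)%N ->
     (-1) ^+ k * calt (fun b => m + b - (b < k))%N =
     hcoef t x k * calt (fun b => m + b)%N) ->
  (forall b, w b < m + K)%N -> calt w = s * calt (fun b => m + b)%N ->
  forall k, (k <= K)%N ->
  hcoef t x k * calt w = \sum_(I : {set 'I_K}) \sum_(E : {set 'I_K} |
       [disjoint E & I] && (#|I| + #|E| == k)%N)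
     (-1) ^+ #|I| * (\prod_(b in E) (tau (nabove (I :|: E) b) - t (w b))) * cmove w I.
Proof.
move=> hrow lt_w ws.
pose S1 := \sum_(k < K.+1) (hcoef t x k)%:P * newt tau (K - k).
apply: (newton_extract (C := S1)); first by [].
have w0 (b : 'I_K) : (m + b < m + K)%N by rewrite ltn_add2l.
have E0 := calt_mulE w0; have Ew := calt_mulE lt_w.
rewrite (newton_initial_sum (tau := tau)) in E0; first last.
- move=> J b b' eb bJ b'J; apply: (@cmx_coldup _ b b').
    by apply/eqP => e; move: eb; rewrite e; lia.
  by rewrite (negPf bJ) b'J => i; rewrite /dcol eb addnS.
- by move=> b; rewrite /tau; congr t; have := ltn_ord b; lia.
have E1 : charE x * (S1 * (calt (fun b => m + b)%N)%:P) =
    \det zmx * (calt (fun b => m + b)%N)%:P.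
  rewrite -E0; congr (_ * _); rewrite /S1 big_distrl /=; apply: eq_bigr => k _.
  have -> : cmove (fun b => m + b)%N [set i : 'I_K | (i < k)%N] =
      calt (fun b => m + b - (b < k))%N.
    apply: eq_cmx => b i; rewrite inE; case: ltnP => _; last by rewrite subn0.
    by rewrite -(prednK m_gt0) addSn /= subn1.
  by rewrite hrow; [rewrite polyCM mulrAC|rewrite -ltnS].
have lregE : GRing.lreg (charE x) by apply/monic_lreg/charE_monic.
apply: lregE; rewrite Ew ws polyCM.
by rewrite [LHS]mulrA [LHS]mulrCA -[charE x * S1 * _]mulrA E1 mulrCA.
Qed.

End Complement.

Section ComplementSign.
Variables (R : comNzRingType) (t : nat -> R) (m n : nat) (x : 'I_m -> R).
Hypothesis le_mn : (m <= n)%N.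
Local Notation K := (n - m)%N.
Implicit Types g : part m n.

Lemma pos_lt g (j : 'I_(m + K)) :
  (match split j with inl a => bnum g a | inr b => snum g b end < m + K)%N.
Proof. by rewrite subnKC //; case: (split j) => a; rewrite ?bnum_lt ?snum_lt. Qed.

Definition pos g j : 'I_(m + K) := Ordinal (pos_lt g j).

Lemma pos_inj g : injective (pos g).
Proof.
move=> j j' /(congr1 val) /=; rewrite -{2}(splitK j) -{2}(splitK j').
case: (split j) (split j') => a [] a' /= e.
- by rewrite (bnum_inj e).
- by case: (bnum_neq_snum e).
- by case: (bnum_neq_snum (esym e)).
- by rewrite (snum_inj e).
Qed.

(** Listing the rows by up-steps, then by side-steps, makes the matrix block triangular, with an
    identity block from the unit columns. *)
Lemma calt_pos g : (-1) ^+ perm (@pos_inj g) * calt t x (snum g) = alt t x (bnum g).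
Proof.
rewrite /calt -det_perm -det_mulmx -row_permE.
have -> : row_perm (perm (@pos_inj g)) (cmx t x (fun b => ucol R (snum g b))) =
    block_mx (\matrix_(i, j) fpow t (x j) (bnum g i)) 0
      (\matrix_(i, j) fpow t (x j) (snum g i)) 1%:M.
  apply/matrixP => i j; case: (split_ordP i) => a ->; case: (split_ordP j) => a' ->.
  - by rewrite block_mxEul !mxE permE /= !split_lshift.
  - rewrite block_mxEur !mxE permE /= split_lshift split_rshift /ucol /=.
    by rewrite split_lshift; case: eqP => // e; case: (bnum_neq_snum e).
  - by rewrite block_mxEdl !mxE permE /= split_lshift split_rshift.
  - rewrite block_mxEdr !mxE permE /= split_rshift /ucol /= split_rshift.
    by rewrite (inj_eq (@snum_inj _ _ g)).
by rewrite det_lblock det1 mulr1.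
Qed.

(** Removing the corner box of the last nonempty row exchanges the consecutive numbers of an up-step
    and a side-step: one box for one transposition. *)
Lemma pos_odd g g0 : psize g0 = 0%N ->
  odd_perm (perm (@pos_inj g)) = odd_perm (perm (@pos_inj g0)) (+) odd (psize g).
Proof.
move=> sz0; have [k] := ubnP (psize g); elim: k g => // k IH g; rewrite ltnS => lek.
have zero g1 i : psize g1 = 0%N -> g1 i = 0%N :> nat.
  by move=> /eqP; rewrite sum_nat_eq0 => /forallP /(_ i) /eqP.
have [g_eq0|] := eqVneq (psize g) 0%N.
  rewrite g_eq0 addbF; congr odd_perm; apply/permP => j; rewrite !permE.
  by rewrite (_ : g = g0) //; apply: part_ext => i; rewrite !zero.
rewrite -lt0n => g_gt0.
have [i0 gi0] : exists i, (0 < g i)%N.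
  apply/existsP; apply: contraLR g_gt0; rewrite negb_exists -leqNgt leqn0 => /forallP h.
  by rewrite sum_nat_eq0; apply/forallP => i; have := h i; rewrite -leqNgt leqn0.
have [i gi_gt0 max_i] : exists2 i : 'I_m, (0 < g i)%N & forall j : 'I_m, (0 < g j)%N -> (j <= i)%N.
  by case: (arg_maxnP (P := fun i => (0 < g i)%N) (fun i : 'I_m => i : nat) gi0) => i h1 h2; exists i.
have [||h hh] := @part_exists m n (fun i' => if i' == i then (g i).-1 else g i').
- move=> j j' le; case: (eqVneq j' i) => [ej'|nj']; case: (eqVneq j i) => [ej|nj] //.
  + by apply: leq_trans (leq_pred _) _; apply: part_mono; rewrite -ej'.
  + have [gj'|] := posnP (g j'); first by rewrite gj'.
    move=> /max_i le'; case/eqP: nj'; apply: val_inj => /=; rewrite ej in le; lia.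
  + exact: part_mono.
- by move=> j; case: ifP => _; [apply: leq_trans (leq_pred _) (part_le _ _)|apply: part_le].
have szg : psize g = (psize h).+1.
  rewrite /psize (bigD1 i) //= [in RHS](bigD1 i) //= hh eqxx.
  rewrite -addSn prednK //; congr (_ + _)%N.
  by apply: eq_bigr => j ne; rewrite hh (negPf ne).
have bh (a : 'I_m) : a != i -> bnum h a = bnum g a by move=> ne; rewrite /bnum hh (negPf ne).
have bi : bnum g i = (bnum h i).+1 by rewrite /bnum hh eqxx -addSn prednK.
have lt_c : ((g i).-1 < K)%N by rewrite prednK // part_le.
pose c := Ordinal lt_c.
have pc : pconj g c = i.+1.
  apply/eqP; rewrite eqn_leq lt_pconj /= prednK // leqnn andbT leqNgt.
  apply/negP => lt; have lt' := leq_trans lt (pconj_le _ _).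
  have := lt_pconj g (Ordinal lt') c; rewrite lt => /esym h1.
  by have := max_i (Ordinal lt') (leq_ltn_trans (leq0n _) h1); rewrite /= ltnn.
have pE (b : 'I_K) : pconj g b = (pconj h b + (b == c))%N.
  rewrite /pconj (cardsD1 i) [in RHS](cardsD1 i) !inE hh eqxx addnAC.
  congr (_ + _)%N; last first.
    by apply: eq_card => a; rewrite !inE hh; case: eqP.
  by rewrite -val_eqE /=; case: (ltngtP b (g i).-1); lia.
have sb (b : 'I_K) : b != c -> snum h b = snum g b.
  by move=> ne; rewrite /snum pE (negPf ne) addn0.
have sc : snum h c = bnum g i.
  have := pE c; rewrite /snum pc eqxx addn1 => -[<-].
  by rewrite /bnum /=; have := ltn_ord i; lia.
have sc' : snum g c = bnum h i.
  by have := bi; rewrite /snum pc /bnum /=; have := ltn_ord i; lia.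
pose p := Ordinal (leq_trans (bnum_lt le_mn h i) (eq_leq (esym (subnKC le_mn)))).
pose p' := Ordinal (leq_trans (bnum_lt le_mn g i) (eq_leq (esym (subnKC le_mn)))).
have -> : perm (@pos_inj g) = (perm (@pos_inj h) * tperm p p')%g.
  apply/permP => j; rewrite permM permE [X in tperm _ _ X]permE; apply: val_inj.
  have valt (y : 'I_(m + K)) : val (tperm p p' y) = if y == p :> nat then p' : nat
      else if y == p' :> nat then p : nat else y.
    by rewrite permE /= -!val_eqE /=; case: eqP => // _; case: eqP.
  rewrite valt /=; case: (split j) => a.
    case: (eqVneq a i) => [->|ne]; first by rewrite eqxx.
    rewrite (inj_eq (@bnum_inj _ _ h)) (negPf ne) bh //.
    by rewrite (inj_eq (@bnum_inj _ _ g)) (negPf ne).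
  have -> : (snum h a == bnum h i) = false by apply/eqP => /esym; apply: bnum_neq_snum.
  case: (eqVneq a c) => [->|ne]; first by rewrite sc eqxx sc'.
  rewrite sb //; have -> : (snum g a == bnum g i) = false.
    by apply/eqP => /esym; apply: bnum_neq_snum.
  by [].
rewrite odd_permM odd_tperm IH; last by rewrite -szg.
rewrite szg /= -val_eqE /= bi; have -> : (bnum h i != (bnum h i).+1) by lia.
by rewrite -addbA addbT.
Qed.

End ComplementSign.

(** * Cylindric strips *)

Section Cycle.

(** The cyclic shift of rows, or of columns, that turns the loop l[0] into l[1]. *)
Definition cyc K : 'S_K := perm (@ord_pred_inj K).

Lemma cycE K (i : 'I_K) : cyc K i = (if i == 0%N :> nat then K.-1 else i.-1) :> nat.
Proof.
rewrite permE /=; have := ltn_ord i; case: (eqVneq (i : nat) 0%N) => [->|ne] lt.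
  by rewrite add0n modn_small // prednK.
rewrite -subn1 -addnBAC ?lt0n // addnC modnDl modn_small ?subn1 //.
by apply: leq_ltn_trans lt; apply: leq_pred.
Qed.

Lemma cyc_odd K : cyc K = odd K.-1 :> bool.
Proof.
case: K => [|K]; first by rewrite (_ : cyc 0 = 1%g) ?odd_perm1 //; apply/permP => -[].
have -> : cyc K.+1 = lift_perm ord0 ord_max 1%g.
  apply/permP => i; apply: ord_inj; rewrite cycE.
  case: (unliftP ord0 i) => [k ->|->]; last by rewrite lift_perm_id.
  by rewrite lift_perm_lift perm1 lift_ge // lift_lt //= ltn_ord.
by rewrite odd_lift_perm odd_perm1 addbF.
Qed.

End Cycle.

Section Loop.
Variables m n : nat.
Hypothesis m_gt0 : (0 < m)%N.
Implicit Types l mu : part m n.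

Lemma rowlenE l (i : 'I_m) : rowlen l i = l i.
Proof. by rewrite /rowlen valK. Qed.

Lemma loop_d0 l (i : 'I_m) : loop l 0 i%:Z = (l i)%:Z.
Proof.
rewrite /loop /loop0 subr0 addr0 modz_small ?ltz_nat ?ltn_ord //.
by rewrite divz_small ?ltz_nat ?ltn_ord // mul0r subr0 rowlenE.
Qed.

Lemma loop_d1 l (i : 'I_m) :
  loop l 1 i%:Z = (l (cyc m i) + 1 + (i == 0%N :> nat) * (n - m))%N%:Z.
Proof.
have := cycE i; rewrite /loop /loop0; case: eqP => [-> e|/eqP ne e].
  have m0 : m%:Z != 0 by rewrite eqz_nat -lt0n.
  have h : (0 - 1)%R = -1 * m%:Z + (m.-1)%:Z :> int by lia.
  rewrite h modzMDl modz_small; last by lia.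
  rewrite divzMDl // divz_small; last by lia.
  rewrite /= -e rowlenE; lia.
have h : (i%:Z - 1)%R = i.-1%:Z :> int by lia.
have := ltn_ord i => lt.
rewrite h modz_small; last by lia.
rewrite divz_small; last by lia.
by rewrite /= -e rowlenE mul0r subr0 addn0; lia.
Qed.

Lemma loop_ge l d (i : int) : i < d%:Z -> (n - m)%N%:Z + d%:Z <= loop l d i.
Proof.
move=> lt; rewrite /loop /loop0 lerD2r.
have : ((i - d%:Z) %/ m%:Z)%Z <= -1.
  have := divz_eq (i - d%:Z) m%:Z; have := modz_ge0 (i - d%:Z) (_ : m%:Z != 0).
  set a := (_ %/ _)%Z; set b := (_ %% _)%Z => /(_ _) hb e.
  have {}hb : 0 <= b by apply: hb; lia.
  have : a * m%:Z < 0 by lia.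
  have : 0 < m%:Z by lia.
  nia.
set a := (_ %/ _)%Z; nia.
Qed.

End Loop.

Section Boxes.
Variables m n : nat.
Implicit Types l mu : part m n.

Lemma count_cyl (P : pred ('I_m * nat)) l d mu :
  count P (cyl_boxes l d mu) =
  (\sum_(i < m) count (fun j => P (i, j)) (iota (mu i) `|loop l d i%:Z - (mu i)%:Z|%N))%N.
Proof.
rewrite /cyl_boxes count_flatten -map_comp sumnE big_map big_enum /=.
by apply: eq_bigr => i _; rewrite /= count_map.
Qed.

Lemma uniq_count (T : eqType) (s : seq T) :
  uniq s <-> (forall x, count_mem x s <= 1)%N.
Proof.
split=> [us x|h]; first by rewrite count_uniq_mem //; case: (x \in s).
apply: count_mem_uniq => x; have := h x; rewrite -has_pred1 has_count.
by case: (count_mem x s) => [|[|]].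
Qed.

Definition vsupp l d mu : {set 'I_m} := [set i : 'I_m | loop l d i%:Z != (mu i)%:Z].

Lemma vstripP r l d mu : reflect
  ((forall i : 'I_m, loop l d i%:Z = (mu i + (i \in vsupp l d mu))%N%:Z) /\ r = #|vsupp l d mu|)
  (vstrip r l d mu).
Proof.
have cnt (i : 'I_m) : count_mem i [seq box_row b | b <- cyl_boxes l d mu] =
    `|loop l d i%:Z - (mu i)%:Z|%N.
  rewrite count_map count_cyl (bigD1 i) //= /box_row /= eqxx big1 => [|i' /negPf ne].
    by rewrite addn0 -[RHS](size_iota (mu i)) -count_predT; apply: eq_count.
  by rewrite -[RHS](count_pred0 (iota (mu i') `|loop l d i'%:Z - (mu i')%:Z|%N));
    apply: eq_count => j /=; rewrite ne.
have sz : size (cyl_boxes l d mu) = (\sum_(i < m) `|loop l d i%:Z - (mu i)%:Z|)%N.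
  rewrite -count_predT count_cyl; apply: eq_bigr => i _.
  by rewrite count_predT size_iota.
have card : #|vsupp l d mu| = (\sum_(i < m) (i \in vsupp l d mu))%N.
  by rewrite -sum1_card big_mkcond; apply: eq_bigr => i _; case: ifP.
apply: (iffP and3P) => [[/forallP val /eqP <- /uniq_count u]|[h ->]].
  have e (i : 'I_m) : loop l d i%:Z = (mu i + (i \in vsupp l d mu))%N%:Z.
    by have := u i; rewrite cnt; have := val i; rewrite inE; case: eqP; lia.
  by split=> //; rewrite sz card; apply: eq_bigr => i _; rewrite e; lia.
split; first by apply/forallP => i; rewrite h; lia.
  by rewrite sz card; apply/eqP/eq_bigr => i _; rewrite h; lia.
by apply/uniq_count => i; rewrite cnt h; case: (i \in _); lia.
Qed.

Lemma vstrip_count_above r l d mu (i : 'I_m) : vstrip r l d mu ->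
  count (fun b => i < box_row b)%N (cyl_boxes l d mu) =
  #|[set i' in vsupp l d mu | (i < i')%N]|.
Proof.
move=> /vstripP [h _]; rewrite count_cyl -sum1_card [RHS]big_mkcond.
apply: eq_bigr => i' _; rewrite h /box_row /=.
have -> : (i' \in [set i' in vsupp l d mu | (i < i')%N]) =
    (i' \in vsupp l d mu) && (i < i')%N by rewrite in_set.
have -> : `|(mu i' + (i' \in vsupp l d mu))%N%:Z - (mu i')%:Z|%N = (i' \in vsupp l d mu) by lia.
by case: (i' \in _); case: (i < i')%N.
Qed.

End Boxes.

(** Passes from sums over moved sets [I] to sums over strips with support [I]. The Newton expansion
    allows every [E] disjoint from [I], whereas an extension only adds boxes of mu; the last
    hypothesis discards the other sets, as their weight is 0. *)
Lemma pieri_assemble (B : comNzRingType) (K p : nat) (Lam : finType) (q : B)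
    (st : nat -> Lam -> nat -> bool) (supp : Lam -> nat -> {set 'I_K}) (pos : pred 'I_K)
    (T : {set 'I_K} -> B) (A : Lam -> B) (W : {set 'I_K} -> {set 'I_K} -> B) :
  (forall I, T I = \sum_l \sum_(d < 2 | st #|I| l d && (supp l d == I)) q ^+ d * A l) ->
  (forall r l d, st r l d -> r = #|supp l d|) ->
  (forall r l d (E : {set 'I_K}) i, st r l d -> [disjoint E & supp l d] -> i \in E -> ~~ pos i ->
     W (supp l d) E = 0) ->
  \sum_(I : {set 'I_K}) \sum_(E : {set 'I_K} | [disjoint E & I] && (#|I| + #|E| == p)%N) W I E * T I =
  \sum_(r < p.+1) \sum_l \sum_(d < 2 | st r l d)
    \sum_(E : {set 'I_K} | (#|E| == p - r)%N && [forall i in E, (i \notin supp l d) && pos i])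
      q ^+ d * W (supp l d) E * A l.
Proof.
move=> hT hst h0.
transitivity (\sum_l \sum_(d < 2 | st #|supp l d| l d)
    \sum_(E : {set 'I_K} | [disjoint E & supp l d] && (#|supp l d| + #|E| == p)%N)
      W (supp l d) E * (q ^+ d * A l)).
  under eq_bigr => I _ do rewrite -big_distrl /= hT big_distrr /=.
  rewrite exchange_big /=; apply: eq_bigr => l _.
  under eq_bigr => I _ do rewrite big_distrr /=.
  rewrite (exchange_big_dep (fun d : 'I_2 => st #|supp l d| l d)) /=; last first.
    by move=> I d _ /andP [h /eqP e]; rewrite e.
  apply: eq_bigr => d hd; rewrite (big_pred1 (supp l d)) => [|I /=].
    by rewrite big_distrl.
  by rewrite eq_sym; case: eqP => [->|_]; rewrite ?hd ?andbF.
rewrite exchange_big /=; apply: eq_bigr => l _.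
rewrite [RHS](exchange_big_dep xpredT) //= [LHS]big_mkcond; apply: eq_bigr => d _.
case: ifP => hd; last first.
  rewrite big_pred0 // => r; apply/negbTE/negP => h.
  by rewrite -(hst _ _ _ h) h in hd.
have [le|lt] := leqP #|supp l d| p; last first.
  rewrite [LHS]big_pred0 => [|E]; last first.
    have -> : (#|supp l d| + #|E| == p)%N = false by lia.
    by rewrite andbF.
  rewrite big_pred0 // => r; apply/negbTE/negP => /hst e.
  by have := ltn_ord r; rewrite e; lia.
have lt : (#|supp l d| < p.+1)%N by rewrite ltnS.
rewrite [RHS](big_pred1 (Ordinal lt)) => [|r /=]; last first.
  by apply/idP/eqP => [/hst e|-> //]; apply: val_inj.
rewrite big_mkcond [RHS]big_mkcond /=; apply: eq_bigr => E _.
have -> : (#|supp l d| + #|E| == p)%N = (#|E| == p - #|supp l d|)%N by lia.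
case: eqP => _; rewrite ?andbF ?andbT //=.
case: (boolP [disjoint E & supp l d]) => dE; last first.
  case: ifP => // /forall_inP h; case/negP: dE; rewrite disjoint_subset.
  by apply/subsetP => i /h /andP [].
case: ifP => [_|/negbT]; first by ring.
rewrite negb_forall => /existsP [i]; rewrite negb_imply negb_and => /andP [iE].
rewrite (disjointFr dE iE) /= => np.
by rewrite (h0 _ _ _ _ _ hd dE iE np) mul0r.
Qed.

(* The lowest index of E at or beyond i has weight tau_c - tau_c. *)
Lemma weight0 (R : comNzRingType) K (tau : nat -> R) (y : 'I_K -> R) (I E : {set 'I_K}) i :
  i \in E -> (forall i' : 'I_K, (i <= i')%N -> y i' = tau (K - i'.+1)%N) ->
  (forall i' : 'I_K, (i <= i')%N -> i' \notin I) ->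
  \prod_(b in E) (tau (nabove (I :|: E) b) - y b) = 0.
Proof.
move=> iE hy hI; pose P j := (j \in E) && (i <= j)%N.
have Pi : P i by rewrite /P iE leqnn.
case: (arg_maxnP (P := P) (fun j : 'I_K => j : nat) Pi) => j /andP [jE leij] max_j.
rewrite (bigD1 j) //= hy //; have -> : nabove (I :|: E) j = (K - j.+1)%N.
  transitivity #|[set: 'I_K] :\: [set k : 'I_K | (k < j.+1)%N]|; last first.
    by rewrite cardsDS ?subsetT // cardsT card_ord card_ord_lt.
  apply: eq_card => k.
  rewrite !inE andbT ltnS -ltnNge; case: ltnP => //= lt.
  rewrite negb_or (hI k (leq_trans leij (ltnW lt))) /=.
  apply/negP => kE; have := max_j k; rewrite /P kE (leq_trans leij (ltnW lt)).
  by move=> /(_ isT); rewrite /= leqNgt lt.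
by rewrite subrr mul0r.
Qed.

Section VerticalStrips.
Variables (m n : nat) (B : comNzRingType) (t : nat -> B) (x : 'I_m -> B) (q : B).
Hypothesis m_gt0 : (0 < m)%N.
Hypothesis lt_mn : (m < n)%N.
Hypothesis per : forall k j, fpow t (x j) (k + n) = (-1) ^+ m.-1 * q * fpow t (x j) k.
Implicit Types l mu : part m n.

Let o : 'I_m := Ordinal m_gt0.

Lemma o_eq (i : 'I_m) : (i == o) = (i == 0%N :> nat). Proof. by []. Qed.

Lemma vrel0 l mu (I : {set 'I_m}) :
  (forall i : 'I_m, loop l 0 i%:Z = (mu i + (i \in I))%N%:Z) <->
  (forall i, bnum mu i + (i \in I) = bnum l i)%N.
Proof.
by split=> h i; have := h i; rewrite loop_d0 // /bnum; lia.
Qed.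

(** A strip with d = 1 shifts the exponents of [l] cyclically and adds [n] to the one that comes
    first, which the quantum relation then absorbs. *)
Lemma vrel1 l mu (I : {set 'I_m}) :
  (forall i : 'I_m, loop l 1 i%:Z = (mu i + (i \in I))%N%:Z) <->
  (forall i, bnum mu i + (i \in I) = bnum l (cyc m i) + (i == o) * n)%N.
Proof.
split=> h i; have := h i; rewrite loop_d1 // /bnum o_eq cycE; have := ltn_ord i;
  case: (eqVneq (i : nat) 0%N) => [->|ne]; lia.
Qed.

Lemma vstrip_suppP l d mu (I : {set 'I_m}) :
  vstrip #|I| l d mu && (vsupp l d mu == I) <->
  (forall i : 'I_m, loop l d i%:Z = (mu i + (i \in I))%N%:Z).
Proof.
split=> [/andP [/vstripP [h _] /eqP <-] //|h].
have e : vsupp l d mu = I by apply/setP => i; rewrite inE h; case: (i \in I); lia.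
by rewrite e eqxx andbT; apply/vstripP; rewrite e.
Qed.

(** The sum has at most one term. If the raised exponents are distinct, they are either all below
    [n], which is a strip with d = 0, or the first one is [n]: it reduces to 0, and this is a strip
    with d = 1 unless the exponent 0 is already there. In the other cases both sides vanish. *)
Lemma alt_vmove mu (I : {set 'I_m}) :
  alt t x (fun i => bnum mu i + (i \in I))%N =
  \sum_l \sum_(d < 2 | vstrip #|I| l d mu && (vsupp l d mu == I)) q ^+ d * alt t x (bnum l).
Proof.
pose b' i := (bnum mu i + (i \in I))%N.
have altE l (d : 'I_2) : vstrip #|I| l d mu && (vsupp l d mu == I) ->
    alt t x b' = q ^+ d * alt t x (bnum l).
  move=> /vstrip_suppP; case: d => -[|[|//]] /= lt.
    by move/vrel0 => h; rewrite mul1r; apply: eq_alt.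
  move/vrel1 => h; rewrite (eq_alt _ _ h).
  (* The sign of the [m]-cycle cancels the sign (-1)^(m-1) of the relation, leaving the factor
     [q]. *)
  rewrite (alt_period (fun i => bnum l (cyc m i)) o per) alt_perm cyc_odd.
  by rewrite signr_odd mulrACA -exprD addnn -muln2 exprM sqrr_sign mul1r expr1.
have b'0 l : (forall i : 'I_m, loop l 1 i%:Z = (mu i + (i \in I))%N%:Z) -> (n <= b' o)%N.
  by move/vrel1 => h; rewrite /b' h eqxx; lia.
have [/existsP [l /existsP [d h]]|] := boolP [exists l, exists d : 'I_2,
    vstrip #|I| l d mu && (vsupp l d mu == I)].
  have uniq l' (d' : 'I_2) : vstrip #|I| l' d' mu && (vsupp l' d' mu == I) -> l' = l /\ d' = d.
    move: h => /vstrip_suppP h /vstrip_suppP h'.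
    case: d h => -[|[|//]] /= ltd h; case: d' h' => -[|[|//]] /= ltd' h'.
    - split; last exact: val_inj.
      by apply: bnum_ext => i; have := (vrel0 _ _ _).1 h i; have := (vrel0 _ _ _).1 h' i; lia.
    - exfalso; have := b'0 _ h'; have := (vrel0 _ _ _).1 h o; have := bnum_lt (ltnW lt_mn) l o.
      by rewrite /b' => lt_l ->; rewrite leqNgt lt_l.
    - exfalso; have := b'0 _ h; have := (vrel0 _ _ _).1 h' o; have := bnum_lt (ltnW lt_mn) l' o.
      by rewrite /b' => lt_l ->; rewrite leqNgt lt_l.
    - split; last exact: val_inj.
      apply: bnum_ext => i; rewrite -(permKV (cyc m) i).
      have := (vrel1 _ _ _).1 h ((cyc m)^-1%g i); have := (vrel1 _ _ _).1 h' ((cyc m)^-1%g i).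
      lia.
  rewrite (bigD1 l) //= (bigD1 d) //= -(altE _ _ h) [X in _ + X + _]big1 => [|d' /andP [h' ne]].
    rewrite big1 ?addr0 // => l' ne; rewrite big_pred0 // => d'.
    by apply/negbTE/negP => /uniq [e _]; rewrite e eqxx in ne.
  by case: (uniq _ _ h') => _ e; rewrite e eqxx in ne.
rewrite negb_exists => /forallP nex.
have {}nex l (d : 'I_2) : (forall i : 'I_m, loop l d i%:Z = (mu i + (i \in I))%N%:Z) -> False.
  by move/vstrip_suppP => h; have := nex l; rewrite negb_exists => /forallP /(_ d); rewrite h.
rewrite [RHS]big1 => [|l _]; last first.
  by rewrite big_pred0 // => d; apply/negbTE/negP => /vstrip_suppP; apply: nex.
rewrite -/b'.
have [/injectiveP inj_b|/injectivePn [i [j ne e]]] := boolP (injectiveb b'); last first.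
  exact: (@alt_dup _ _ _ _ _ i j).
have dec (i j : 'I_m) : (i < j)%N -> (b' j < b' i)%N.
  move=> lt; rewrite ltn_neqAle; apply/andP; split.
    by apply/eqP => /inj_b e; rewrite e ltnn in lt.
  by have := bnum_anti mu lt; rewrite /b'; case: (i \in I); case: (j \in I); lia.
have [lt_b0|ge_b0] := ltnP (b' o) n.
  have [|l hl] := bnum_exists (n := n) dec.
    move=> i; apply: leq_ltn_trans lt_b0.
    have [->//|ne] := eqVneq i o; apply/ltnW/dec; rewrite lt0n.
    by move: ne; rewrite o_eq.
  case: (nex l (Ordinal (ltn0Sn 1))) => /=; apply/vrel0 => i.
  by rewrite hl.
have b0n : b' o = n.
  by have := bnum_lt (ltnW lt_mn) mu o; move: ge_b0; rewrite /b'; case: (o \in I); lia.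
have bE i : b' i = ((if i == o then 0 else b' i) + (i == o) * n)%N.
  by case: eqP => [->|_]; rewrite ?mul1n ?mul0n ?addn0.
have [/existsP [i /andP [ne /eqP bi]]|] := boolP [exists i, (i != o) && (b' i == 0%N)].
  rewrite (eq_alt _ _ bE) (alt_period _ _ per) (@alt_dup _ _ _ _ _ i o ne) ?mulr0 //.
  by rewrite (negPf ne) eqxx bi.
rewrite negb_exists => /forallP nz.
have pred_i (i : 'I_m) : (i != o) -> cyc m i = i.-1 :> nat.
  by rewrite o_eq cycE => /negPf ->.
have pred_o : cyc m o = m.-1 :> nat by rewrite cycE.
(* The exponents of [l]: the first one, reduced to 0, goes to the end and the others move up by one
   row. *)
pose c i := if (cyc m)^-1%g i == o then 0%N else b' ((cyc m)^-1%g i).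
have cyc_c i : c (cyc m i) = if i == o then 0%N else b' i by rewrite /c permK.
have dec_c (i j : 'I_m) : (i < j)%N -> (c j < c i)%N.
  rewrite -(permKV (cyc m) i) -(permKV (cyc m) j) !cyc_c.
  move: ((cyc m)^-1%g i) ((cyc m)^-1%g j) => {}i {}j.
  have [->|nei] := eqVneq i o; first by rewrite pred_o; have := ltn_ord (cyc m j); lia.
  have [->|nej] := eqVneq j o.
    by move=> _; have := nz i; rewrite nei /= lt0n.
  rewrite !pred_i // => lt; apply: dec; move: nei nej; rewrite !o_eq; lia.
have [|l hl] := bnum_exists (n := n) dec_c.
  move=> i; rewrite -(permKV (cyc m) i) cyc_c; case: eqP => [_|/eqP ne]; first by lia.
  apply: leq_trans (dec o _ _) _; last by rewrite b0n.
  by move: ne; rewrite o_eq /= lt0n.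
case: (nex l (Ordinal (ltnSn 1))) => /=; apply/vrel1 => i.
by rewrite hl cyc_c -bE.
Qed.

End VerticalStrips.

Section Residues.
Variables (K j : nat).
Hypothesis lt_jK : (j < K)%N.

Lemma count_residue e : (e <= K)%N ->
  count (fun b => b %% K == j)%N (iota 0 e) = (j < e)%N.
Proof.
elim: e => [|e IH] le //; rewrite -[in iota 0 _]addn1 iotaD count_cat (IH (ltnW le)) add0n /=.
by rewrite addn0 modn_small //; case: (ltngtP j e) => h; lia.
Qed.

Lemma count_residueK e :
  count (fun b => b %% K == j)%N (iota 0 (K + e)) =
  (1 + count (fun b => b %% K == j)%N (iota 0 e))%N.
Proof.
rewrite iotaD count_cat count_residue // lt_jK add0n; congr (1 + _)%N.
rewrite -[X in iota X e]addn0 iotaDl count_map; apply: eq_count => b /=.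
by rewrite modnDl.
Qed.

Lemma count_residueB a c :
  (count (fun b => b %% K == j)%N (iota 0 a) + count (fun b => b %% K == j)%N (iota a c) =
  count (fun b => b %% K == j)%N (iota 0 (a + c)))%N.
Proof. by rewrite [in RHS]iotaD count_cat. Qed.

End Residues.

Lemma size_count_mem K (s : seq nat) : all (fun b => b < K)%N s ->
  size s = (\sum_(j < K) count_mem (j : nat) s)%N.
Proof.
elim: s => [_|b s IH /= /andP [lt /IH ->]]; first by rewrite big1.
rewrite big_split /= -add1n; congr (_ + _)%N.
rewrite (bigD1 (Ordinal lt)) //= eqxx big1 ?addn0 // => j ne.
by apply/eqP; rewrite eqb0 eq_sym; apply: contra ne => /eqP e; apply/eqP/val_inj.
Qed.

(** * Horizontal strips through column lengths *)

Section HBoxes.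
Variables m n : nat.
Hypothesis m_gt0 : (0 < m)%N.
Hypothesis lt_mn : (m < n)%N.
Local Notation K := (n - m)%N.
Implicit Types l mu : part m n.

Definition hcols l d mu := [seq box_col n b | b <- cyl_boxes l d mu].

Definition hsupp l d mu : {set 'I_K} := [set j : 'I_K | (j : nat) \in hcols l d mu].

(* The column lengths of the loop l[d], for d <= 1. *)
Definition lconj l d (j : 'I_K) : nat :=
  if d is 0%N then pconj l j else (pconj l (cyc K j) + 1 + (j == 0%N :> nat) * m)%N.

Let K_gt0 : (0 < K)%N. Proof. by rewrite subn_gt0. Qed.

Lemma hcols_lt l d mu : all (fun b => b < K)%N (hcols l d mu).
Proof. by apply/allP => _ /mapP [b _ ->]; rewrite /box_col ltn_mod. Qed.

Lemma count_hcols l d mu (j : nat) : count_mem j (hcols l d mu) =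
  (\sum_(i < m) count (fun b => b %% K == j)%N (iota (mu i) `|loop l d i%:Z - (mu i)%:Z|%N))%N.
Proof. by rewrite count_map count_cyl. Qed.

Lemma pconj_sum l j : pconj l j = (\sum_(i < m) (j < l i))%N.
Proof.
by rewrite /pconj -sum1_card big_mkcond; apply: eq_bigr => i _; rewrite inE; case: ifP.
Qed.

(** Each row of the loop is counted from column 0, modulo [K]; the boxes before [mu i] give the
    column lengths of mu. A full period of [K] boxes contributes one box to every column. *)
Lemma count_hcols_lconj l d mu (j : 'I_K) : (d < 2)%N -> cyl_valid l d mu ->
  (count_mem (j : nat) (hcols l d mu) + pconj mu j = lconj l d j)%N.
Proof.
move=> d2 /forallP val; rewrite count_hcols pconj_sum -big_split /=.
pose F e := count (fun b => b %% K == j)%N (iota 0 e).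
have Flo e : (e <= K)%N -> F e = (j < e)%N by apply: count_residue.
have e1 : (\sum_(i < m) (count (fun b => b %% K == j)%N
      (iota (mu i) `|loop l d i%:Z - (mu i)%:Z|) + (j < mu i)) =
    \sum_(i < m) F `|loop l d i%:Z|)%N.
  apply: eq_bigr => i _; rewrite -(Flo _ (part_le _ _)) addnC /F count_residueB.
  by congr (count _ (iota _ _)); have := val i; lia.
rewrite e1; case: d d2 val {e1} => [|[|//]] _ val; rewrite /lconj.
  by rewrite pconj_sum; apply: eq_bigr => i _; rewrite loop_d0 //= Flo ?part_le.
pose o : 'I_m := Ordinal m_gt0.
have FK e : F (K + e)%N = (1 + F e)%N by apply: count_residueK.
have Fl i : F (l i + 1)%N = ((j < l i + 1) + (j == 0%N :> nat) * (l i == K :> nat))%N.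
  (* A full row of [l] becomes [K + 1] boxes long, and its last box wraps around to column 0. *)
  have := part_le l i; rewrite leq_eqVlt => /orP [/eqP ->|lt].
    by rewrite FK (Flo 1%N) // eqxx muln1; have := ltn_ord j; lia.
  by rewrite Flo ?addn1 // (ltn_eqF lt) muln0 addn0.
transitivity (\sum_(i < m) (F (l (cyc m i) + 1)%N + (i == o)))%N.
  apply: eq_bigr => i _; rewrite loop_d1 //= -[(i == o)]/(i == 0%N :> nat).
  by case: eqP => _; rewrite ?mul1n ?mul0n ?addn0 // addnC FK addnC.
have s1 : (\sum_(i < m) (i == o) = 1)%N.
  by rewrite (bigD1 o) //= big1 // => i /negPf ->.
rewrite big_split /= s1.
have -> : (\sum_(i < m) F (l (cyc m i) + 1) = \sum_(i < m) F (l i + 1))%N.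
  by rewrite [RHS](reindex_inj (@perm_inj _ (cyc m))).
rewrite (eq_bigr _ (fun i _ => Fl i)) big_split /= -big_distrr /=.
have := cycE j; case: (eqVneq (j : nat) 0%N) => [j0 ->|nj ->].
  have -> : (\sum_(i < m) (j < l i + 1) = m)%N.
    rewrite (eq_bigr (fun=> 1%N)) => [|i _]; first by rewrite sum1_card card_ord.
    by rewrite j0 addn1.
  have -> : (\sum_(i < m) (l i == K :> nat) = pconj l K.-1)%N.
    rewrite pconj_sum; apply: eq_bigr => i _; have := part_le l i; have := K_gt0.
    by case: eqP; lia.
  by lia.
rewrite !mul0n !addn0; congr (_ + _)%N; rewrite pconj_sum; apply: eq_bigr => i _.
by rewrite addn1 ltnS; congr nat_of_bool; lia.
Qed.

Lemma cyl_valid_lconj l d mu : (d < 2)%N ->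
  (forall j : 'I_K, pconj mu j <= lconj l d j)%N -> cyl_valid l d mu.
Proof.
move=> d2 h; apply/forallP => i; case: d d2 h => [|[|//]] _ h.
  rewrite loop_d0 // lez_nat leqNgt; apply/negP => lt.
  have ltK : (l i < K)%N by apply: leq_trans lt (part_le _ _).
  have := h (Ordinal ltK); rewrite /lconj /= leqNgt => /negP; apply.
  apply: leq_ltn_trans (_ : i < _)%N; last by rewrite lt_pconj.
  by rewrite leqNgt lt_pconj ltnn.
rewrite loop_d1 // lez_nat; have le := part_le mu i; have := cycE i.
case: (eqVneq (i : nat) 0%N) => [_ _|ni ei]; first by lia.
rewrite mul0n addn0 leqNgt; apply/negP => lt.
have ltK : (l (cyc m i) + 1 < K)%N by apply: leq_trans lt le.
have := h (Ordinal ltK); rewrite /lconj cycE /= addn1 /= mul0n addn0 leqNgt => /negP; apply.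
apply: leq_ltn_trans (_ : i < _)%N; last by rewrite lt_pconj -addn1.
have := lt_pconj l (cyc m i) (l (cyc m i)); rewrite ltnn ei; lia.
Qed.

Lemma in_hsupp l d mu (j : 'I_K) :
  (j \in hsupp l d mu) = (0 < count_mem (j : nat) (hcols l d mu))%N.
Proof. by rewrite in_set -has_count has_pred1. Qed.

Lemma hstripP r l d mu : (d < 2)%N -> reflect
  ((forall j, lconj l d j = (pconj mu j + (j \in hsupp l d mu))%N) /\ r = #|hsupp l d mu|)
  (hstrip r l d mu).
Proof.
move=> d2.
have card : #|hsupp l d mu| = (\sum_(j < K) (j \in hsupp l d mu))%N.
  by rewrite -sum1_card big_mkcond; apply: eq_bigr => i _; case: ifP.
have sz : size (cyl_boxes l d mu) = (\sum_(j < K) count_mem (j : nat) (hcols l d mu))%N.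
  by rewrite -(size_count_mem (hcols_lt l d mu)) size_map.
apply: (iffP and3P) => [[val /eqP <- /uniq_count u]|[h ->]].
  have e (j : 'I_K) : count_mem (j : nat) (hcols l d mu) = (j \in hsupp l d mu).
    by have := u j; rewrite in_hsupp -/(hcols l d mu); case: (count_mem _ _) => [|[|]].
  split; first by move=> j; rewrite -(count_hcols_lconj j d2 val) e addnC.
  by rewrite sz card; apply: eq_bigr => j _; rewrite e.
have val : cyl_valid l d mu.
  by apply: (cyl_valid_lconj d2) => j; rewrite h leq_addr.
have e (j : 'I_K) : count_mem (j : nat) (hcols l d mu) = (j \in hsupp l d mu).
  by have := count_hcols_lconj j d2 val; rewrite h addnC => /addnI.
split=> //; first by rewrite sz card; apply/eqP/eq_bigr => j _; rewrite e.
apply/uniq_count => b; rewrite -/(hcols l d mu); have [lt|le] := ltnP b K.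
  by rewrite (e (Ordinal lt)); case: (_ \in _).
rewrite leqNgt; apply/negP => /ltnW; rewrite -has_count has_pred1 => /(allP (hcols_lt _ _ _)).
by rewrite /= ltnNge le.
Qed.

Lemma hstrip_suppP l d mu (J : {set 'I_K}) : (d < 2)%N ->
  hstrip #|J| l d mu && (hsupp l d mu == J) <->
  (forall j, lconj l d j = pconj mu j + (j \in J))%N.
Proof.
move=> d2; split=> [/andP [/(hstripP _ _ _ d2) [h _] /eqP <-] //|h].
have val : cyl_valid l d mu.
  by apply: (cyl_valid_lconj d2) => j; rewrite h leq_addr.
have e : hsupp l d mu = J.
  apply/setP => j; rewrite in_hsupp; have := count_hcols_lconj j d2 val.
  by rewrite h addnC => /addnI ->; case: (j \in J).
by rewrite e eqxx andbT; apply/(hstripP _ _ _ d2); rewrite e.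
Qed.

Lemma hstrip_count_right r l d mu (j : 'I_K) : (d < 2)%N -> hstrip r l d mu ->
  count (fun b => j < box_col n b)%N (cyl_boxes l d mu) =
  #|[set j' in hsupp l d mu | (j < j')%N]|.
Proof.
move=> d2 st; have us : uniq (hcols l d mu) by case/and3P: st.
have -> : count (fun b => j < box_col n b)%N (cyl_boxes l d mu) =
    size (filter (fun b => j < b)%N (hcols l d mu)) by rewrite size_filter count_map.
rewrite (size_count_mem (K := K)); last first.
  by apply/allP => b; rewrite mem_filter => /andP [_ /(allP (hcols_lt _ _ _))].
rewrite -sum1_card [RHS]big_mkcond; apply: eq_bigr => j' _.
rewrite count_uniq_mem ?filter_uniq // mem_filter.
have -> : (j' \in [set j' in hsupp l d mu | (j < j')%N]) =
    (j' \in hsupp l d mu) && (j < j')%N by rewrite in_set.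
by rewrite in_set andbC; case: (_ && _).
Qed.

(** If d >= 2, the top row of the loop reaches at least [n - m + d], too far for a vertical strip.
    For a horizontal strip with m >= 2, the second row reaches as far, and both rows contain a box
    in the column just after the top row of mu. With m = 1, the only row has more than [n - m] boxes
    and meets a column twice. *)
Lemma strip_lt2 r l d mu : vstrip r l d mu || hstrip r l d mu -> (d < 2)%N.
Proof.
pose o : 'I_m := Ordinal m_gt0.
case/orP => [/vstripP [h _]|/and3P [/forallP val _ /uniq_count u]]; rewrite ltnNge; apply/negP => d2.
  have ho : loop l d 0 = (mu o + (o \in vsupp l d mu))%N := h o.
  have := @loop_ge m n m_gt0 l d 0; rewrite ho; have := part_le mu o.
  by case: (o \in _); lia.
have lo : (n - m)%N%:Z + d%:Z <= loop l d o%:Z by apply: loop_ge => //; rewrite ltz_nat ltnW.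
have le0 := part_le mu o; have vo := val o.
have cnt a c : (0 < c)%N -> (0 < count (fun b => b %% K == a %% K)%N (iota a c))%N.
  by case: c => [//|c] _; rewrite /= eqxx.
have := u (mu o %% K)%N; rewrite -/(hcols l d mu) count_hcols (bigD1 o) //.
have [m1|m_gt1] := leqP m 1.
  have l1 : 2%:Z * (n - m)%N%:Z + d%:Z <= loop l d o%:Z.
    have em : m%:Z = 1 by lia.
    by rewrite /loop /loop0 em divz1 /=; nia.
  have [c [ec c_gt0]] : exists c, `|loop l d o%:Z - (mu o)%:Z|%N = (K + c)%N /\ (0 < c)%N.
    by exists (`|loop l d o%:Z - (mu o)%:Z| - K)%N; split; lia.
  rewrite ec iotaD count_cat; have := cnt (mu o) K K_gt0.
  have := cnt (mu o + K)%N c c_gt0; rewrite modnDr => h2 h1 h.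
  have key (a b s : nat) : (a + b + s <= 1)%N -> (0 < a)%N -> (0 < b)%N -> False by lia.
  exact: key h h1 h2.
pose o1 : 'I_m := Ordinal m_gt1; have ne : o1 != o by [].
have l1 : (n - m)%N%:Z + d%:Z <= loop l d o1%:Z by apply: loop_ge => //; rewrite ltz_nat.
have mono := @part_mono _ _ mu o o1 isT; have v1 := val o1.
rewrite (bigD1 o1) //.
have [c [ec c_gt0]] : exists c, `|loop l d o1%:Z - (mu o1)%:Z|%N = ((mu o - mu o1) + c)%N /\ (0 < c)%N.
  by exists (`|loop l d o1%:Z - (mu o1)%:Z| - (mu o - mu o1))%N; split; lia.
have c0 : (0 < `|loop l d o%:Z - (mu o)%:Z|)%N by lia.
rewrite ec iotaD count_cat subnKC //; have := cnt (mu o) _ c0; have := cnt (mu o) c c_gt0.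
move=> h2 h1 h; have key (a b b' s : nat) : (a + (b' + b + s) <= 1)%N -> (0 < a)%N ->
  (0 < b)%N -> False by lia.
exact: key h h1 h2.
Qed.

Lemma hrel0 l mu (J : {set 'I_K}) :
  (forall j, lconj l 0 j = pconj mu j + (j \in J))%N <->
  (forall j, snum mu j = snum l j + (j \in J))%N.
Proof.
split=> h j; have := h j; have := pconj_le l j; have := pconj_le mu j;
  have := ltn_ord j; rewrite /lconj /snum; case: (j \in J); lia.
Qed.

Lemma hrel1 l mu (J : {set 'I_K}) :
  (forall j, lconj l 1 j = pconj mu j + (j \in J))%N <->
  (forall j, snum mu j + (j == 0%N :> nat) * n = snum l (cyc K j) + (j \in J))%N.
Proof.
split=> h j; have := h j; have := pconj_le l (cyc K j); have := pconj_le mu j;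
  have := ltn_ord j; have := ltnW lt_mn; have := m_gt0; rewrite /lconj /snum cycE;
  case: (eqVneq (j : nat) 0%N) => [->|ne]; case: (j \in J); lia.
Qed.

Lemma snum_exists (c : 'I_K -> nat) : (forall i j : 'I_K, (i < j)%N -> (c i < c j)%N) ->
  (forall j, c j < n)%N -> exists l, forall j, snum l j = c j.
Proof.
move=> inc lt_c.
have gap := dec_gap (b := fun j => n - c j)%N _.
have {}gap (i j : 'I_K) : (i <= j)%N -> (c i + (j - i) <= c j)%N.
  move=> le; have [|] := leqP (c i + (j - i)) (c j) => // lt.
  have := gap _ i j le; have := lt_c i; have := lt_c j => h1 h2 h3.
  have := h3 (fun a b ab => ltn_sub2l (lt_c a) (inc a b ab)); lia.
have [||l hl] := pconj_exists (m := m) (n := n) (f := fun j => j + m - c j)%N.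
- move=> i j le; have := gap i j le; lia.
- move=> j; have := gap (Ordinal K_gt0) j isT; rewrite /=; lia.
have lt_last : (K.-1 < K)%N by rewrite prednK.
exists l => j; rewrite /snum hl; have := gap j (Ordinal lt_last); have := lt_c (Ordinal lt_last).
have := ltn_ord j; rewrite /=; lia.
Qed.

End HBoxes.

Section ColumnOperations.
Variables (R : comNzRingType) (t : nat -> R) (m K : nat) (x : 'I_m -> R).
Implicit Types W : 'I_K -> 'I_(m + K) -> R.

Lemma cmx_perm W (s : 'S_K) :
  \det (cmx t x (fun b => W (s b))) = (-1) ^+ s * \det (cmx t x W).
Proof.
have -> : cmx t x (fun b => W (s b)) =
    cmx t x W *m block_mx 1%:M 0 0 (perm_mx s)^T.
  apply/matrixP => i j; rewrite [RHS]mxE big_split_ord /=.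
  case: (split_ordP j) => a ->.
    rewrite (bigD1 a) //= big1 ?addr0 => [|b ne].
      rewrite [X in _ + X]big1 ?addr0 => [|b _]; last by rewrite block_mxEdl [X in _ * X]mxE mulr0.
      by rewrite block_mxEul !mxE eqxx mulr1 !split_lshift.
    by rewrite block_mxEul !mxE (negPf ne) mulr0.
  rewrite big1 ?add0r => [|b _]; last by rewrite block_mxEur [X in _ * X]mxE mulr0.
  rewrite (bigD1 (s a)) //= big1 ?addr0 => [|b ne].
    by rewrite block_mxEdr !mxE !split_rshift eqxx mulr1.
  by rewrite block_mxEdr !mxE eq_sym (negPf ne) mulr0.
by rewrite det_mulmx det_lblock det1 mul1r det_tr det_perm mulrC.
Qed.

Lemma cmx_scale W (b0 : 'I_K) (c : R) :
  \det (cmx t x (fun b i => (if b == b0 then c else 1) * W b i)) = c * \det (cmx t x W).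
Proof.
pose d : 'rV[R]_(m + K) := \row_j (if j == rshift m b0 then c else 1).
have -> : cmx t x (fun b i => (if b == b0 then c else 1) * W b i) =
    cmx t x W *m diag_mx d.
  apply/matrixP => i j; rewrite mul_mx_diag !mxE.
  case: (split_ordP j) => a ->.
    rewrite ?split_lshift (_ : lshift K a == _ = false) ?mulr1 //.
    by apply/eqP => /(congr1 val) /=; have := ltn_ord a; lia.
  by rewrite ?split_rshift (inj_eq (@rshift_inj _ _)) mulrC.
rewrite det_mulmx det_diag mulrC (bigD1 (rshift m b0)) //= mxE eqxx big1 ?mulr1 // => j ne.
by rewrite mxE (negPf ne).
Qed.

End ColumnOperations.

Section HorizontalRule.
Variables (m n : nat) (B : comNzRingType) (t : nat -> B) (x : 'I_m -> B) (q : B).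
Hypothesis m_gt0 : (0 < m)%N.
Hypothesis lt_mn : (m < n)%N.
Hypothesis xq : forall j, fpow t (x j) n = (-1) ^+ m.-1 * q.
Local Notation K := (n - m)%N.
Local Notation Q := ((-1) ^+ m.-1 * q).
Implicit Types l mu : part m n.

Let le_mn : (m <= n)%N := ltnW lt_mn.
Let K_gt0 : (0 < K)%N. Proof. by rewrite subn_gt0. Qed.
Let o : 'I_K := Ordinal K_gt0.
Let last : 'I_K := cyc K o.

Definition psign l : B := (-1) ^+ perm (@pos_inj m n le_mn l).

Lemma psign_eq l mu e : odd (psize l) = odd (psize mu + e) ->
  psign l = (-1) ^+ e * psign mu.
Proof.
have [||g0 hg0] := @part_exists m n (fun=> 0%N) => //.
have s0 : psize g0 = 0%N by rewrite /psize big1.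
move=> h; rewrite /psign (pos_odd le_mn l s0) (pos_odd le_mn mu s0) h oddD.
have key (a b c : bool) : (-1) ^+ (a (+) (b (+) c)) = (-1) ^+ c * (-1) ^+ (a (+) b) :> B.
  by rewrite addbA [LHS]signr_addb mulrC.
by rewrite key signr_odd.
Qed.

Lemma psignK l a : psign l * (psign l * a) = a.
Proof. by rewrite /psign signrMK. Qed.

Lemma alt_psign l : alt t x (bnum l) = psign l * calt t x (snum l).
Proof. by rewrite /psign calt_pos. Qed.

(* The effect on the alternant of mu of moving the steps J of the complement. *)
Definition hmove mu (J : {set 'I_K}) : B :=
  (-1) ^+ #|J| * (psign mu * cmove t x Q (snum mu) J).

Lemma hcoef_hmove mu k : (k <= K)%N ->
  hcoef t x k * alt t x (bnum mu) =
  \sum_(I : {set 'I_K}) \sum_(E : {set 'I_K} | [disjoint E & I] && (#|I| + #|E| == k)%N)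
    (\prod_(b in E) (t (n - (nabove (I :|: E) b).+1)%N - t (snum mu b))) * hmove mu I.
Proof.
move=> lekK.
have eK : (m + K = n)%N by rewrite subnKC.
have [||g0 hg0] := @part_exists m n (fun=> 0%N) => //.
have s0 : psize g0 = 0%N by rewrite /psize big1.
have b0 i : bnum g0 i = (m - i.+1)%N by rewrite /bnum hg0.
have c0 (j : 'I_K) : snum g0 j = (m + j)%N.
  by rewrite /snum pconj_sum big1 ?subn0 1?addnC // => i _; rewrite hg0.
have eq_calt (w w' : 'I_K -> nat) : w =1 w' -> calt t x w = calt t x w'.
  by move=> e; apply: eq_cmx => b i; rewrite e.
have alt0 : alt t x (fun i : 'I_m => m - i.+1)%N = psign g0 * calt t x (fun b : 'I_K => m + b)%N.
  by rewrite -(eq_calt _ _ c0) -alt_psign; apply: eq_alt => i; rewrite b0.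
have xQ j : fpow t (x j) (m + K) = Q by rewrite eK xq.
(* This is [hcoef_alt0] for complementary minors: the row (k') lowers the first k' side-steps of the
   empty partition by one, and its k' boxes give the sign. *)
have hrow k' : (k' <= K)%N ->
     (-1) ^+ k' * calt t x (fun b : 'I_K => m + b - (b < k'))%N =
     hcoef t x k' * calt t x (fun b : 'I_K => m + b)%N.
  move=> le'; pose g := prow m n k'.
  have gE i : g i = (if i == 0%N :> nat then k' else 0%N) :> nat by apply: prowE.
  have sg : psize g = k'.
    rewrite /psize (bigD1 (Ordinal m_gt0)) //= gE /= big1 ?addn0 // => i ne.
    by rewrite gE; case: eqP => // i0; case/eqP: ne; apply: val_inj.
  have cg (j : 'I_K) : snum g j = (m + j - (j < k'))%N.
    rewrite /snum pconj_sum (bigD1 (Ordinal m_gt0)) //= gE /= big1 ?addn0 => [|i ne].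
      by rewrite addnC.
    by rewrite gE; case: eqP => // i0; case/eqP: ne; apply: val_inj.
  rewrite -(eq_calt _ _ cg); have := hcoef_alt0 t x m_gt0 k'.
  rewrite (_ : alt _ _ _ = alt t x (bnum g)); last first.
    apply: eq_alt => i; rewrite /bnum gE; case: eqP => [->|//].
    by rewrite subn1 addnC.
  rewrite alt0 alt_psign (@psign_eq g g0 k') ?sg ?s0 // => h.
  rewrite -[LHS](psignK g0) -[RHS](psignK g0); congr (_ * _).
  by rewrite mulrCA mulrA h mulrCA.
have [s hs] := alt_factor t x (bnum mu).
have lt_w (b : 'I_K) : (snum mu b < m + K)%N by rewrite eK snum_lt.
have ws : calt t x (snum mu) = psign mu * (s * psign g0) * calt t x (fun b : 'I_K => m + b)%N.
  by rewrite -[LHS](psignK mu) -alt_psign hs alt0 !mulrA.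
have := hcoef_calt xQ m_gt0 hrow lt_w ws lekK; rewrite alt_psign => h.
rewrite mulrCA h big_distrr /=; apply: eq_bigr => I _.
rewrite big_distrr /=; apply: eq_bigr => E _; rewrite eK /hmove.
by ring.
Qed.

(** The counterpart of [alt_vmove]: the side-steps in [J] go down by one, step 0 becoming [n.-1].
    Either two of them coincide, or they are the side-steps of a single [l], with d = 1 precisely
    when step 0 has wrapped around. *)
Lemma hmove_strips mu (J : {set 'I_K}) :
  hmove mu J =
  \sum_l \sum_(d < 2 | hstrip #|J| l d mu && (hsupp l d mu == J)) q ^+ d * alt t x (bnum l).
Proof.
have eK1 : ((m + K).-1 = n.-1)%N by rewrite subnKC.
have o_eq (j : 'I_K) : (j == o) = (j == 0%N :> nat) by [].
have cyc_o : cyc K o = K.-1 :> nat by rewrite cycE.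
have cyc_n (j : 'I_K) : j != o -> cyc K j = j.-1 :> nat by rewrite o_eq cycE => /negPf ->.
have cardJ : #|J| = (\sum_(j < K) (j \in J))%N.
  by rewrite -sum1_card big_mkcond; apply: eq_bigr => i _; case: ifP.
have wrap l : (forall j, lconj l 1 j = pconj mu j + (j \in J))%N ->
    snum mu o = 0%N /\ snum l (cyc K o) = n.-1.
  move/(hrel1 m_gt0 lt_mn) => h; have := h o; have := snum_lt le_mn l (cyc K o).
  by rewrite /= mul1n; case: (o \in J); lia.
have altE l (d : 'I_2) : hstrip #|J| l d mu && (hsupp l d mu == J) ->
    hmove mu J = q ^+ d * alt t x (bnum l).
  move=> /(hstrip_suppP m_gt0 lt_mn _ _ _ (ltn_ord d)).
  case: d => -[|[|//]] /= ltd h.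
    rewrite mul1r alt_psign (@psign_eq l mu #|J|); last first.
      by rewrite !psize_pconj cardJ -big_split /=; congr odd; apply: eq_bigr => j _; rewrite -h.
    move/(hrel0 m_gt0 lt_mn): h => h; rewrite /hmove mulrA; congr (_ * _).
    apply: eq_cmx => b i; rewrite h; case: (b \in J); last by rewrite addn0.
    by rewrite addn1.
  have hsz : (psize l + n = psize mu + #|J|)%N.
    have e0 : (\sum_(j < K) (j == 0%N :> nat) * m = m)%N.
      rewrite (bigD1 o) //= mul1n big1 ?addn0 // => j.
      by rewrite o_eq => /negPf ->.
    have e1 : (\sum_(j < K) lconj l 1 j = psize l + K + m)%N.
      rewrite /lconj !big_split /= e0 sum_nat_const card_ord muln1 psize_pconj.
      by rewrite [in RHS](reindex_inj (@perm_inj _ (cyc K))).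
    rewrite [psize mu]psize_pconj cardJ -big_split /=.
    by rewrite -(eq_bigr _ (fun j _ => h j)) e1 -addnA subnK.
  have [mu0 l_last] := wrap _ h; move/(hrel1 m_gt0 lt_mn): h => h.
  have J0 : o \in J.
    have := h o; rewrite mu0 l_last /= mul1n; case: (o \in J) => //.
    by lia.
  rewrite /hmove.
  have -> : cmove t x Q (snum mu) J = Q * ((-1) ^+ cyc K * calt t x (snum l)).
    rewrite -cmx_perm -(cmx_scale _ _ _ o); apply: eq_cmx => b i.
    have := h b; case: (eqVneq b o) => [->|ne]; last first.
      rewrite -[(b == 0%N :> nat)]o_eq (negPf ne) addn0 mul1r => ->.
      by case: (b \in J); rewrite ?addn1 ?addn0.
    by rewrite J0 mu0 l_last /= eK1.
  rewrite expr1 alt_psign cyc_odd signr_odd (@psign_eq l mu (#|J| + n)); last first.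
    by rewrite addnA -hsz -addnA oddD addnn odd_double addbF.
  (* The relation and the [K]-cycle contribute m - 1 and K - 1, whose sum is n - 2. By [hsz], the
     resulting sign relates the shuffle signs of [l] and [mu]. *)
  have key : (-1) ^+ #|J| * ((-1) ^+ m.-1 * (-1) ^+ K.-1) = (-1) ^+ (#|J| + n) :> B.
    rewrite -!exprD -signr_odd -[RHS]signr_odd !oddD; congr (_ ^+ nat_of_bool (_ (+) _)).
    have e : (m.-1 + K.-1).+2 = n by have := K_gt0; lia.
    by rewrite -oddD -[in RHS]e /= negbK.
  by rewrite -key; ring.
have [/existsP [l /existsP [d h]]|] := boolP [exists l, exists d : 'I_2,
    hstrip #|J| l d mu && (hsupp l d mu == J)].
  have uniq l' (d' : 'I_2) : hstrip #|J| l' d' mu && (hsupp l' d' mu == J) -> l' = l /\ d' = d.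
    move: h => /(hstrip_suppP m_gt0 lt_mn _ _ _ (ltn_ord d)) h.
    move=> /(hstrip_suppP m_gt0 lt_mn _ _ _ (ltn_ord d')) h'.
    case: d h => -[|[|//]] /= ltd h; case: d' h' => -[|[|//]] /= ltd' h'.
    - split; last exact: val_inj.
      by apply: pconj_ext => j; have := h j; have := h' j; rewrite /lconj; lia.
    - exfalso; have [mu0 _] := wrap _ h'; move/(hrel1 m_gt0 lt_mn): h' => h'.
      have := h' o; have := (hrel0 m_gt0 lt_mn _ _ _).1 h o; rewrite mu0 /=.
      by have := snum_lt le_mn l' (cyc K o); case: (o \in J); lia.
    - exfalso; have [mu0 _] := wrap _ h; move/(hrel1 m_gt0 lt_mn): h => h.
      have := h o; have := (hrel0 m_gt0 lt_mn _ _ _).1 h' o; rewrite mu0 /=.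
      by have := snum_lt le_mn l (cyc K o); case: (o \in J); lia.
    - split; last exact: val_inj.
      apply: pconj_ext => j; rewrite -(permKV (cyc K) j).
      have := h ((cyc K)^-1%g j); have := h' ((cyc K)^-1%g j); rewrite /lconj; lia.
  rewrite (bigD1 l) //= (bigD1 d) //= -(altE _ _ h) [X in _ + X + _]big1 => [|d' /andP [h' ne]].
    rewrite big1 ?addr0 // => l' ne; rewrite big_pred0 // => d'.
    by apply/negbTE/negP => /uniq [e _]; rewrite e eqxx in ne.
  by case: (uniq _ _ h') => _ e; rewrite e eqxx in ne.
rewrite negb_exists => /forallP nex.
have {}nex l (d : 'I_2) : (forall j, lconj l d j = pconj mu j + (j \in J))%N -> False.
  move/(hstrip_suppP m_gt0 lt_mn _ _ _ (ltn_ord d)) => h.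
  by have := nex l; rewrite negb_exists => /forallP /(_ d); rewrite h.
rewrite [RHS]big1 => [|l _]; last first.
  rewrite big_pred0 // => d; apply/negbTE/negP.
  by move=> /(hstrip_suppP m_gt0 lt_mn _ _ _ (ltn_ord d)); apply: nex.
rewrite /hmove /cmove.
suff -> : \det (cmx t x (fun b => if b \in J then dcol Q (snum mu b)
    else ucol B (snum mu b))) = 0 :> B by rewrite !mulr0.
(* [w] tells whether step 0 wraps around, and [v] lists the moved side-steps. If [v] were injective
   it would define a strip, against [nex]; so two columns are equal. *)
pose w := (snum mu o == 0%N) && (o \in J).
pose v j := if w && (j == o) then n.-1 else (snum mu j - (j \in J))%N.
have snum0 (j : 'I_K) : j != o -> (0 < snum mu j)%N.
  move=> ne; apply: leq_ltn_trans (snum_mono mu (_ : o < j)%N) => //=.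
  by rewrite lt0n -o_eq.
have lt_v j : (v j < n)%N.
  rewrite /v; case: ifP => _; first by lia.
  by apply: leq_ltn_trans (leq_subr _ _) (snum_lt le_mn _ _).
have -> : \det (cmx t x (fun b => if b \in J then dcol Q (snum mu b)
    else ucol B (snum mu b))) =
   (if w then Q else 1) * \det (cmx t x (fun b => ucol B (v b))).
  have vE (j : 'I_K) : ~~ (w && (j == o)) ->
      (if j \in J then dcol Q (snum mu j) else ucol B (snum mu j)) =1
       (ucol B (v j) : 'I_(m + K) -> B).
    move=> nw i; rewrite /v (negPf nw); case: (boolP (j \in J)) => jJ; last by rewrite subn0.
    have : (0 < snum mu j)%N.
      have [jo|/snum0 //] := eqVneq j o.
      by move: nw; rewrite /w jo eqxx andbT -jo jJ andbT lt0n.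
    by case: (snum mu j) => // s _; rewrite subn1.
  case: ifP => hw; last by rewrite mul1r; apply: eq_cmx => b; apply: vE; rewrite hw.
  rewrite -(cmx_scale _ _ _ o); apply: eq_cmx => b i.
  have [->|ne] := eqVneq b o; last by rewrite vE ?hw ?(negPf ne) // mul1r.
  by case/andP: (hw) => /eqP s0 ->; rewrite s0 /v hw eqxx /= eK1.
have [/injectiveP inj_v|/injectivePn [i [j ne e]]] := boolP (injectiveb v); last first.
  by rewrite (@cmx_coldup _ _ _ _ _ _ i j) ?mulr0 // => a; rewrite e.
exfalso; have inc (i j : 'I_K) : ~~ (w && (i == o)) -> (i < j)%N -> (v i < v j)%N.
  move=> nw lt; rewrite ltn_neqAle; apply/andP; split.
    by apply/eqP => /inj_v e; rewrite e ltnn in lt.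
  have nj : (j == o) = false by rewrite o_eq; lia.
  have := snum_mono mu lt; rewrite /v (negPf nw) nj andbF.
  by case: (i \in J); case: (j \in J); lia.
case: (boolP w) => hw.
  pose c j := v ((cyc K)^-1%g j).
  have cE j : c (cyc K j) = v j by rewrite /c permK.
  have inc_c (i j : 'I_K) : (i < j)%N -> (c i < c j)%N.
    rewrite -(permKV (cyc K) i) -(permKV (cyc K) j) !cE.
    move: ((cyc K)^-1%g i) ((cyc K)^-1%g j) => {}i {}j.
    have [->|nei] := eqVneq i o; first by rewrite cyc_o; have := ltn_ord (cyc K j); lia.
    have [->|nej] := eqVneq j o.
      move=> _; have vo : v o = n.-1 by rewrite /v hw eqxx.
      have : v i != v o by apply: contra nei => /eqP/inj_v ->.
      by have := lt_v i; rewrite vo; lia.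
    rewrite !cyc_n // => lt; apply: inc; rewrite ?(negPf nei) ?andbF //.
    by move: nei nej; rewrite !o_eq; lia.
  have [|l hl] := snum_exists m_gt0 lt_mn inc_c.
    by move=> j; rewrite -(permKV (cyc K) j) cE.
  apply: (nex l (Ordinal (ltnSn 1))); apply/(hrel1 m_gt0 lt_mn) => j.
  rewrite hl cE -[(j == 0%N :> nat)]o_eq /v hw; case/andP: (hw) => /eqP s0 oJ.
  have [->|ne] := eqVneq j o; first by rewrite s0 oJ /=; lia.
  by have := snum0 j ne; case: (j \in J) => /=; lia.
have [||l hl] := snum_exists m_gt0 lt_mn (c := v) => //.
  by move=> i j; apply: inc; rewrite (negPf hw).
apply: (nex l (Ordinal (ltn0Sn 1))); apply/(hrel0 m_gt0 lt_mn) => j.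
rewrite hl /v (negPf hw) /=.
case: (boolP (j \in J)) => jJ; last by rewrite subn0 addn0.
rewrite subnK //; have [jo|/snum0 //] := eqVneq j o.
by move: hw; rewrite /w -jo jJ andbT lt0n.
Qed.

End HorizontalRule.

(** * The quantum Pieri rules *)

Lemma eq_alt_below (R : comNzRingType) m N (t t' : nat -> R) (x : 'I_m -> R) b :
  (forall i, b i <= N)%N -> (forall k, (k < N)%N -> t k = t' k) -> alt t x b = alt t' x b.
Proof.
move=> hb ht; congr (\det _); apply/matrixP => i j; rewrite !mxE.
by apply: eq_bigr => l _; rewrite ht // (leq_trans (ltn_ord l)).
Qed.

Lemma fpowD (R : comNzRingType) (t : nat -> R) y n k :
  (forall l, t (n + l)%N = t l) -> fpow t y (n + k) = fpow t y n * fpow t y k.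
Proof.
move=> ht; rewrite /fpow big_split_ord; congr (_ * _).
by apply: eq_bigr => l _; rewrite /= ht.
Qed.

Lemma ev_class_pos m n (B : comNzRingType) (F : {rmorphism {poly {mpoly int[n]}} -> B})
    (t : nat -> B) (x : 'I_m -> B) : (0 < m)%N -> (m < n)%N ->
  (forall k j, fpow t (x j) (k + n) = (-1) ^+ m.-1 * F 'X * fpow t (x j) k) ->
  forall g : part m (2 * n - 1), ev F t x (phi_class g) = alt t x (bnum g).
Proof. by case: m x => // m x _; apply: ev_phi_class. Qed.

Section QuantumProduct.
Variables m n : nat.
Hypothesis m_gt0 : (0 < m)%N.
Hypothesis lt_mn : (m < n)%N.
Local Notation N := (2 * n - 1)%N.
Local Notation L := {mpoly int[N]}.
Variable xi : part m N -> part m N -> L.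
Hypothesis xiP : schubert_classes xi.
Variable c : part m N -> part m N -> part m N -> L.
Hypothesis cP : structure_constants xi c.

Definition tper (k : nat) : {poly {mpoly int[n]}} := (tvar n (k %% n).+1)%:P.

Lemma star_sigma (l mu : part m n) : star c (sigma l) (sigma mu) = star_basis c l mu.
Proof.
have sE (g h : part m n) : sigma g h = if h == g then 1 else 0 by rewrite ffunE.
rewrite /star; under eq_bigr => l' _ do under eq_bigr => mu' _ do rewrite !sE.
rewrite (bigD1 l) //= [X in _ + X]big1 => [|l' /negPf ne]; last first.
  by rewrite big1 // => mu' _; rewrite ne mul0r scale0r.
rewrite addr0 (bigD1 mu) //= [X in _ + X]big1 => [|mu' /negPf ne]; last first.
  by rewrite ne mulr0 scale0r.
by rewrite !eqxx mulr1 scale1r addr0.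
Qed.

Variables (B : comNzRingType) (F : {rmorphism {poly {mpoly int[n]}} -> B}) (x : 'I_m -> B).
Hypothesis xq : forall j, fpow (F \o tper) (x j) n = (-1) ^+ m.-1 * F 'X.
Local Notation t := (F \o tper).

Lemma fpow_period k j : fpow t (x j) (k + n) = (-1) ^+ m.-1 * F 'X * fpow t (x j) k.
Proof.
rewrite addnC fpowD => [|l]; first by congr (_ * _).
by rewrite /= /tper modnDl.
Qed.

(** The images of the t_i agree with the periodic parameters below [N], and an alternant with
    exponents below [N] involves no others. *)
Lemma phi_alt (g : part m N) :
  alt ((F \o (polyC \o (comp_mpoly [tuple tvar n (i %% n).+1 | i < N]))) \o tL N) x (bnum g) =
  alt t x (bnum g).
Proof.
have le_mN : (m <= N)%N by lia.
apply: (@eq_alt_below _ _ N) => [i|k lt]; first exact: ltnW (bnum_lt le_mN g i).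
rewrite /= (tL_ord (Ordinal lt)) comp_mpolyXU -tnth_nth tnth_mktuple.
by [].
Qed.

Lemma ev_star (l mu : part m n) k (u : {mpoly L[m]}) : (n + k <= N)%N ->
  raising (tL N) k u ->
  u * alt (@tU _ (tL N) m) (@xU L m) (fun i => m - i.+1)%N =
    alt (@tU _ (tL N) m) (@xU L m) (bnum l) ->
  exists2 v, v * alt t x (fun i => m - i.+1)%N = alt t x (bnum l) &
    v * alt t x (bnum mu) = ev F t x (star c (sigma l) (sigma mu)).
Proof.
move=> leN hu ul; have le_mN : (m <= N)%N by lia.
have bw (g : part m n) : bnum (pwiden g) =1 bnum g by move=> i; rewrite bnum_pwiden.
rewrite -(eq_alt _ _ (bw l)) in ul.
have hD i : (bnum (pwiden mu) i < n)%N by rewrite bw bnum_lt // ltnW.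
have [v vl vmu] := product_alt le_mN xiP cP hu ul hD leN
  (F \o (polyC \o (comp_mpoly [tuple tvar n (i %% n).+1 | i < N]))) x.
have [||g0 hg0] := @part_exists m N (fun=> 0%N) => //.
have b0 : bnum g0 =1 (fun i => m - i.+1)%N by move=> i; rewrite /bnum hg0.
move: vl vmu; rewrite -(eq_alt _ _ b0) !phi_alt (eq_alt _ _ b0) !(eq_alt _ _ (bw _)).
move=> vl vmu; exists v => //; rewrite vmu star_sigma /star_basis ev_sum.
apply: eq_bigr => g _; rewrite evZ phi_alt; congr (_ * _).
symmetry; exact: (ev_class_pos m_gt0 lt_mn fpow_period g).
Qed.

(** The alternant of the empty partition cannot be cancelled in general, but by [alt_factor] every
    alternant is a multiple of it; two multipliers that agree on it agree on all alternants. *)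
Lemma mul_alt_factor (v w : B) (l mu : part m n) :
  v * alt t x (fun i => m - i.+1)%N = alt t x (bnum l) ->
  w * alt t x (fun i => m - i.+1)%N = alt t x (bnum l) ->
  v * alt t x (bnum mu) = w * alt t x (bnum mu).
Proof.
by move=> hv hw; have [s ->] := alt_factor t x (bnum mu); rewrite mulrCA hv -hw mulrCA.
Qed.

End QuantumProduct.

(** Identifies the Newton index with r(alpha) - b(alpha) - 1 for rows and c(alpha) - rt(alpha) - 1
    for columns. *)
Lemma nabove_disjoint K (I E : {set 'I_K}) (i : 'I_K) : [disjoint E & I] ->
  (nabove (I :|: E) i + (#|[set i' in I | (i < i')%N]| + #|[set i' in E | (i < i')%N]|) =
   K - i.+1)%N.
Proof.
move=> dEI; have cK : #|[set i' : 'I_K | (i < i')%N]| = (K - i.+1)%N.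
  transitivity #|[set: 'I_K] :\: [set k : 'I_K | (k < i.+1)%N]|; last first.
    by rewrite cardsDS ?subsetT // cardsT card_ord card_ord_lt.
  by apply: eq_card => k; rewrite !inE andbT -leqNgt.
rewrite -cK -cardsUI; set U := _ :|: _; set V := _ :&: _.
have -> : V = set0.
  apply/setP => k; rewrite !inE; apply/negbTE/negP => /andP [/andP [kI _] /andP [kE _]].
  by rewrite (disjointFr dEI kE) in kI.
rewrite cards0 addn0 /nabove -cardsUI.
set V' := _ :&: _; have -> : V' = set0.
  by apply/setP => k; rewrite !inE negb_or; case: (k \in I); case: (k \in E); rewrite ?andbF.
rewrite cards0 addn0; apply: eq_card => k; rewrite !inE negb_or.
by case: (k \in I); case: (k \in E); case: (i < k)%N.
Qed.

Section Rules.
Variables m n : nat.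
Hypothesis m_gt0 : (0 < m)%N.
Hypothesis lt_mn : (m < n)%N.
Variables (B : comNzRingType) (F : {rmorphism {poly {mpoly int[n]}} -> B}) (x : 'I_m -> B).
Hypothesis xq : forall j, fpow (F \o @tper n) (x j) n = (-1) ^+ m.-1 * F 'X.
Local Notation t := (F \o @tper n).
Local Notation K := (n - m)%N.
Implicit Types l mu : part m n.

Lemma tper_diff a b a' b' : a = a'.+1 -> b = b'.+1 -> (a' < n)%N -> (b' < n)%N ->
  F (tvar n a - tvar n b)%:P = t a' - t b'.
Proof.
move=> -> -> lta ltb; have ta c : (c < n)%N -> t c = F (tvar n c.+1)%:P.
  by move=> ltc; rewrite /= /tper modn_small.
by rewrite (ta _ lta) (ta _ ltb) -rmorphB -polyCB.
Qed.

Lemma wtvE r l d mu (E : {set 'I_m}) i : vstrip r l d mu -> [disjoint E & vsupp l d mu] ->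
  F (wtv l d mu E i)%:P = t (bnum mu i) - t (nabove (vsupp l d mu :|: E) i).
Proof.
move=> st dE; have := nabove_disjoint i dE; have := ltn_ord i => lti nb.
rewrite /wtv (vstrip_count_above _ st).
apply: tper_diff; [exact: upnumE|lia|exact: bnum_lt (ltnW lt_mn) _ _|lia].
Qed.

Lemma wthE r l d mu (E : {set 'I_K}) j : (d < 2)%N -> hstrip r l d mu ->
  [disjoint E & hsupp l d mu] ->
  F (wth l d mu E j)%:P = t (n - (nabove (hsupp l d mu :|: E) j).+1)%N - t (snum mu j).
Proof.
move=> d2 st dE; have := nabove_disjoint j dE; have := ltn_ord j => ltj nb.
rewrite /wth (hstrip_count_right lt_mn _ d2 st).
apply: tper_diff; [lia|exact: sidenumE|lia|exact: snum_lt (ltnW lt_mn) _ _].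
Qed.

Lemma vertical_rule p mu : (p <= m)%N ->
  (-1) ^+ p * ecoef t x p * alt t x (bnum mu) =
  ev F t x (\sum_(r < p.+1) \sum_(lam : part m n) \sum_(d < 2 | vstrip r lam d mu)
          \sum_(E : {set 'I_m} | vextension r p lam d mu E)
            ('X^d * (\prod_(i in E) wtv lam d mu E i)%:P) *: sigma lam).
Proof.
move=> lepm; rewrite -mulrA ecoef_mul // big_distrr /=.
(* As [p = #|I| + #|E|], the sign (-1)^p cancels (-1)^|I| and leaves (-1)^|E|, which reverses the
   differences into those of [wtv]. *)
pose W (I E : {set 'I_m}) : B :=
  (-1) ^+ #|E| * \prod_(i in E) (t (nabove (I :|: E) i) - t (bnum mu i)).
pose T (I : {set 'I_m}) := alt t x (fun i => bnum mu i + (i \in I))%N.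
transitivity (\sum_(I : {set 'I_m}) \sum_(E : {set 'I_m} |
    [disjoint E & I] && (#|I| + #|E| == p)%N) W I E * T I).
  apply: eq_bigr => I _; rewrite big_distrr /=; apply: eq_bigr => E /andP [_ /eqP <-].
  rewrite /W !mulrA; congr (_ * _ * _).
  by rewrite exprD mulrAC -exprD addnn -muln2 exprM sqrr_sign mul1r.
rewrite (@pieri_assemble B m p _ (F 'X) (fun r l d => vstrip r l d mu)
  (fun l d => vsupp l d mu) (fun i => 0 < mu i)%N T (fun l => alt t x (bnum l)) W); first last.
- move=> r l d E i st dE iE; rewrite -leqNgt leqn0 => /eqP mui.
  have [h _] := vstripP _ _ _ _ st.
  (* From row [i] on, mu is empty and the strip has no box: for d = 0 because row [i] of [l] is
     empty too; d = 1 is excluded, as row [i] of the loop would be nonempty. *)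
  rewrite /W (weight0 (tau := t) iE) ?mulr0 // => i' le.
    by rewrite /bnum; have := part_mono mu le; rewrite mui leqn0 => /eqP ->.
  have d2 := strip_lt2 m_gt0 lt_mn (introT orP (or_introl st)).
  have iS : i \notin vsupp l d mu by rewrite (disjointFr dE iE).
  apply/negP => i'S; have := h i; have := h i'.
  rewrite i'S (negPf iS) mui; have := part_mono mu le; rewrite mui leqn0 => /eqP ->.
  case: d d2 {st dE h iS i'S} => [|[|//]] _; rewrite !(loop_d0, loop_d1) //; last by lia.
  by have := part_mono l le; lia.
- by move=> r l d /vstripP [].
- by move=> I; apply: alt_vmove m_gt0 lt_mn (fpow_period xq) mu I.
rewrite ev_sum; apply: eq_bigr => r _; rewrite ev_sum; apply: eq_bigr => l _.
rewrite ev_sum; apply: eq_bigr => d st; rewrite ev_sum.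
apply: eq_big => [E|E /andP [_ /forall_inP hE]].
  rewrite /vextension; congr (_ && _); apply: eq_forallb => i.
  by rewrite in_set negbK.
have dE : [disjoint E & vsupp l d mu].
  by rewrite disjoint_subset; apply/subsetP => i /hE /andP [].
rewrite evZ ev_sigma rmorphM rmorphXn; congr (_ * _ * _).
rewrite /W rmorph_prod rmorph_prod -prodrN; apply: eq_bigr => i _.
by rewrite (wtvE i st dE) opprB.
Qed.

Lemma horizontal_rule k mu : (k <= K)%N ->
  hcoef t x k * alt t x (bnum mu) =
  ev F t x (\sum_(r < k.+1) \sum_(lam : part m n) \sum_(d < 2 | hstrip r lam d mu)
          \sum_(E : {set 'I_K} | hextension r k lam d mu E)
            ('X^d * (\prod_(j in E) wth lam d mu E j)%:P) *: sigma lam).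
Proof.
move=> lekK; rewrite (hcoef_hmove m_gt0 lt_mn xq mu lekK).
pose W (I E : {set 'I_K}) : B :=
  \prod_(b in E) (t (n - (nabove (I :|: E) b).+1)%N - t (snum mu b)).
rewrite (@pieri_assemble B K k _ (F 'X) (fun r l d => (d < 2)%N && hstrip r l d mu)
  (fun l d => hsupp l d mu) (fun j => 0 < pconj mu j)%N (hmove t x (F 'X) lt_mn mu)
  (fun l => alt t x (bnum l)) W); first last.
- move=> r l d E i /andP [d2 st] dE iE; rewrite -leqNgt leqn0 => /eqP mui.
  have [h _] := hstripP m_gt0 lt_mn _ _ _ d2 st.
  apply: (weight0 (tau := fun c => t (n - c.+1)%N) iE) => i' le.
    rewrite /snum; have := pconj_mono mu le; rewrite mui leqn0 => /eqP ->.
    by congr t; have := ltn_ord i'; lia.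
  have iS : i \notin hsupp l d mu by rewrite (disjointFr dE iE).
  apply/negP => i'S; have := h i; have := h i'.
  rewrite i'S (negPf iS) mui; have := pconj_mono mu le; rewrite mui leqn0 => /eqP ->.
  case: d d2 {st dE h iS i'S} => [|[|//]] _; rewrite /lconj; last by lia.
  by have := pconj_mono l le; lia.
- by move=> r l d /andP [d2 /(hstripP m_gt0 lt_mn _ _ _ d2) []].
- move=> I; rewrite (hmove_strips _ _ _ m_gt0 lt_mn).
  by apply: eq_bigr => l _; apply: eq_bigl => d; rewrite ltn_ord.
rewrite ev_sum; apply: eq_bigr => r _; rewrite ev_sum; apply: eq_bigr => l _.
rewrite ev_sum; apply: eq_big => [d|d /andP [d2 st]]; first by rewrite ltn_ord.
rewrite ev_sum; apply: eq_big => [E|E /andP [_ /forall_inP hE]].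
  rewrite /hextension; congr (_ && _); apply: eq_forallb => i.
  by rewrite in_set.
have dE : [disjoint E & hsupp l d mu].
  by rewrite disjoint_subset; apply/subsetP => i /hE /andP [].
rewrite evZ ev_sigma rmorphM rmorphXn; congr (_ * _ * _).
rewrite /W rmorph_prod rmorph_prod; apply: eq_bigr => i _.
by rewrite (wthE i d2 st dE).
Qed.

End Rules.

Theorem theorem1p1 (m n : nat) (m_gt0 : (1 <= m)%N) (m_le : (m <= n - 1)%N)
    (xi : part m (2 * n - 1) -> part m (2 * n - 1) -> {mpoly int[2 * n - 1]})
    (xiP : schubert_classes xi)
    (c : part m (2 * n - 1) -> part m (2 * n - 1) -> part m (2 * n - 1) ->
         {mpoly int[2 * n - 1]})
    (cP : structure_constants xi c)
    (p k : nat) (hp : (1 <= p <= m)%N) (hk : (1 <= k <= n - m)%N)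
    (mu : part m n) :
  [/\ forall (r : nat) (lam : part m n) (d : nat),
        vstrip r lam d mu || hstrip r lam d mu -> (d < 2)%N,
      star c (sigma (pcol m n p)) (sigma mu) =
        \sum_(r < p.+1) \sum_(lam : part m n) \sum_(d < 2 | vstrip r lam d mu)
          \sum_(E : {set 'I_m} | vextension r p lam d mu E)
            ('X^d * (\prod_(i in E) wtv lam d mu E i)%:P) *: sigma lam
    & star c (sigma (prow m n k)) (sigma mu) =
        \sum_(r < k.+1) \sum_(lam : part m n) \sum_(d < 2 | hstrip r lam d mu)
          \sum_(E : {set 'I_(n - m)} | hextension r k lam d mu E)
            ('X^d * (\prod_(j in E) wth lam d mu E j)%:P) *: sigma lam].
Proof.
have lt_mn : (m < n)%N by lia.
have n_gt1 : (1 < n)%N by lia.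
have [B [F [x [hx free]]]] := tensor_ring (@tper n) ((-1) ^+ m.-1 * 'X) m n_gt1.
have xq j : fpow (F \o @tper n) (x j) n = (-1) ^+ m.-1 * F 'X.
  by rewrite hx rmorphM rmorph_sign.
have inj := ev_inj (ltnW lt_mn) free.
case/andP: hp => _ lepm; case/andP: hk => k_gt0 lekK.
split; first by move=> r lam d; apply: strip_lt2.
- apply: inj; rewrite -(vertical_rule m_gt0 lt_mn xq mu lepm).
  pose tU' := @tU _ (tL (2 * n - 1)) m; pose xU' := @xU {mpoly int[2 * n - 1]} m.
  have colE (R : comNzRingType) (t : nat -> R) (y : 'I_m -> R) :
      (-1) ^+ p * ecoef t y p * alt t y (fun i => m - i.+1)%N = alt t y (bnum (pcol m n p)).
    rewrite -mulrA ecoef_alt0 // signrMK; apply: eq_alt => i.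
    by rewrite /bnum pcolE // addnC.
  have leN : (n + 1 <= 2 * n - 1)%N by lia.
  have hu : raising (tL (2 * n - 1)) 1 ((-1) ^+ p * ecoef tU' xU' p).
    have -> : (-1) ^+ p = ((-1) ^+ p)%:MP :> {mpoly {mpoly int[2 * n - 1]}[m]}.
      by rewrite rmorph_sign.
    exact: (raisingM (raisingC _) (raising_ecoef lepm)).
  have [v vl <-] := ev_star m_gt0 lt_mn xiP cP xq mu leN hu (colE _ _ _).
  exact: (mul_alt_factor _ vl (colE _ _ _)).
- apply: inj; rewrite -(horizontal_rule m_gt0 lt_mn xq mu lekK).
  have rowE (R : comNzRingType) (t : nat -> R) (y : 'I_m -> R) :
      hcoef t y k * alt t y (fun i => m - i.+1)%N = alt t y (bnum (prow m n k)).
    rewrite -hcoef_alt0 //; apply: eq_alt => i; rewrite /bnum prowE //.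
    by case: eqP => [->|//]; rewrite subn1 addnC.
  (* Here [k <= n - m <= n - 1]: the spread of the row multiplier fits in Gr(m, 2n-1). *)
  have leN : (n + k <= 2 * n - 1)%N by lia.
  have [v vl <-] := ev_star m_gt0 lt_mn xiP cP xq mu leN (raising_hcoef _) (rowE _ _ _).
  exact: (mul_alt_factor _ vl (rowE _ _ _)).
Qed.
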